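(* Let $n\ge3$, let $r_1,\dots,r_n\in(-1,1)$ be distinct and let $s_1,\dots,s_n\in\mathbb B$, where $\mathbb B$ is the open quaternionic unit ball. Consider the interpolation problem of finding a slice regular $f:\mathbb B\to\mathbb B$ with $f(r_m)=s_m$ for all $m=1,\dots,n$. Let $Q_0^m:=s_m$ for $m=1,\dots,n$, $Q_1^m:=M_{r_1}(r_m)^{-1}M_{s_1}(s_m)$ for $m=2,\dots,n$, and for $\kappa=2,\dots,n-1$, $\ell=\kappa+1,\dots,n$, $$Q_\kappa^\ell:=\begin{cases}M_{r_\kappa}(r_\ell)^{-1}M_{Q_{\kappa-1}^\kappa}(Q_{\kappa-1}^\ell)&\text{if }Q_{\kappa-1}^\kappa,Q_{\kappa-1}^\ell\in\mathbb B,\\ Q_{\kappa-1}^\kappa&\text{if }Q_{\kappa-1}^\kappa=Q_{\kappa-1}^\ell\in\partial\mathbb B,\\ \infty&\text{otherwise.}\end{cases}$$ If $|Q_{n-1}^n|<1$, the interpolation problem is non-singular, i.e. it has infinitely many solutions. If $|Q_{n-1}^n|=1$, it is singular, i.e. it has a unique solution, which is a regular Blaschke product; its degree is $\kappa_0\in\{1,\dots,n-1\}$ if and only if $Q_{\kappa_0}^{\kappa_0+1}=\cdots=Q_{\kappa_0}^n\in\partial\mathbb B$ but $Q_{\kappa_0-1}^\ell\in\mathbb B$ for some (hence any) $\ell\in\{\kappa_0,\kappa_0+1,\dots,n\}$. Otherwise, the problem has no solutions.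
   Context: $\mathbb H$ is the skew-field of quaternions, $\mathbb B=\{q\in\mathbb H:|q|<1\}$, $\partial\mathbb B=\{|q|=1\}$, $\mathbb S=\{I\in\mathbb H:I^2=-1\}$, $\mathbb C_I=\mathbb R+\mathbb RI$. A function $f:\mathbb B\to\mathbb H$ is slice regular if it has continuous partial derivatives and $\frac12(\partial_x+I\partial_y)f(x+yI)=0$ on $\mathbb B\cap\mathbb C_I$ for every $I\in\mathbb S$; equivalently $f(q)=\sum_{m\ge0}q^ma_m$ with $a_m\in\mathbb H$, converging on $\mathbb B$. For $f=\sum q^ma_m$, $g=\sum q^mb_m$: $f\ast g=\sum_m q^m\sum_{\ell=0}^m a_{m-\ell}b_\ell$, $f^c=\sum q^m\overline{a_m}$, $f^s=f\ast f^c$, $f^{-\ast}(q)=f^s(q)^{-1}f^c(q)$ off the zero set of $f^s$. For $p\in\mathbb B$: $M_p(q)=(1-q\overline p)^{-1}(q-p)$ (pointwise product) and $\mathcal M_p(q)=(1-q\overline p)^{-\ast}\ast(q-p)$. A regular (finite) Blaschke product is a function $\mathcal M_{t_1}\ast\cdots\ast\mathcal M_{t_\kappa}u$ with $\kappa\ge1$, $t_1,\dots,t_\kappa\in\mathbb B$, $|u|=1$; $\kappa$ is uniquely determined and called its degree. The symbol $\infty$ is purely conventional: it is not a quaternion and is regarded as having modulus greater than $1$. *)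

(* Defs.v *)
From Stdlib Require Export Reals List.
From Stdlib Require Import ClassicalEpsilon.
From Coquelicot Require Export Coquelicot.
Export ListNotations.
Open Scope R_scope.

(** (a, b, c, d) stands for a + b i + c j + d k.  Being an iterated product
    of copies of [R], the type inherits Coquelicot's normed module structure
    over [R], hence [is_derive], [continuous] and [is_series]. *)

Definition quat : Type := (R * R * R * R)%type.

Definition cre (q : quat) : R := fst (fst (fst q)).
Definition cim1 (q : quat) : R := snd (fst (fst q)).
Definition cim2 (q : quat) : R := snd (fst q).
Definition cim3 (q : quat) : R := snd q.

Definition qreal (x : R) : quat := (x, 0, 0, 0).

Definition qadd (p q : quat) : quat := plus p q.
Definition qopp (q : quat) : quat := opp q.
Definition qscal (x : R) (q : quat) : quat := scal x q.

Definition qmul (p q : quat) : quat :=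
  (cre p * cre q - cim1 p * cim1 q - cim2 p * cim2 q - cim3 p * cim3 q,
   cre p * cim1 q + cim1 p * cre q + cim2 p * cim3 q - cim3 p * cim2 q,
   cre p * cim2 q - cim1 p * cim3 q + cim2 p * cre q + cim3 p * cim1 q,
   cre p * cim3 q + cim1 p * cim2 q - cim2 p * cim1 q + cim3 p * cre q).

Definition qconj (q : quat) : quat := (cre q, - cim1 q, - cim2 q, - cim3 q).

Definition qnorm (q : quat) : R :=
  sqrt (cre q ^ 2 + cim1 q ^ 2 + cim2 q ^ 2 + cim3 q ^ 2).

(* total: the inverse of 0 is 0 *)
Definition qinv (q : quat) : quat := qscal (/ (qnorm q ^ 2)) (qconj q).

Declare Scope quat_scope.
Delimit Scope quat_scope with quat.
Bind Scope quat_scope with quat.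
Infix "+" := qadd : quat_scope.
Infix "*" := qmul : quat_scope.
Notation "- q" := (qopp q) : quat_scope.
Notation "p - q" := (qadd p (qopp q)) : quat_scope.

Fixpoint qpow (q : quat) (m : nat) : quat :=
  match m with
  | O => qreal 1
  | S k => (q * qpow q k)%quat
  end.

Definition quat_eq_dec (p q : quat) : {p = q} + {p <> q}.
Proof. repeat decide equality; apply Req_EM_T. Qed.

Definition in_ball (q : quat) : Prop := qnorm q < 1.
Definition in_sphere (q : quat) : Prop := qnorm q = 1.

Definition imag_unit (I : quat) : Prop := (I * I = - qreal 1)%quat.

Definition slice_pt (I : quat) (x y : R) : quat := (qreal x + qreal y * I)%quat.

(** Functions on the ball are represented by total functions, whose values
    outside the ball are irrelevant. *)

(* The partial derivatives are those of (x, y) |-> f (x + y I), for each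
   fixed I. *)
Definition slice_regular (f : quat -> quat) : Prop :=
  forall I : quat, imag_unit I ->
  exists fx fy : R -> R -> quat,
  forall x y : R, in_ball (slice_pt I x y) ->
    is_derive (fun t => f (slice_pt I t y)) x (fx x y) /\
    is_derive (fun t => f (slice_pt I x t)) y (fy x y) /\
    continuous (fun z : R * R => fx (fst z) (snd z)) (x, y) /\
    continuous (fun z : R * R => fy (fst z) (snd z)) (x, y) /\
    qscal (/ 2) (fx x y + I * fy x y)%quat = qreal 0.

Definition eq_on_ball (f g : quat -> quat) : Prop :=
  forall q : quat, in_ball q -> f q = g q.

Definition has_expansion (f : quat -> quat) (a : nat -> quat) : Prop :=
  forall q : quat, in_ball q ->
    is_series (fun m => (qpow q m * a m)%quat : quat) (f q).

(* The coefficients are unique when they exist; otherwise they are arbitrary. *)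
Definition coeffs (f : quat -> quat) : nat -> quat :=
  epsilon (inhabits (fun _ => qreal 0)) (has_expansion f).

Definition power_series (a : nat -> quat) (q : quat) : quat :=
  (Series (fun m => cre (qpow q m * a m)%quat),
   Series (fun m => cim1 (qpow q m * a m)%quat),
   Series (fun m => cim2 (qpow q m * a m)%quat),
   Series (fun m => cim3 (qpow q m * a m)%quat)).

Definition qconv (a b : nat -> quat) (m : nat) : quat :=
  sum_n (fun l => (a (m - l)%nat * b l)%quat : quat) m.

Definition rstar (f g : quat -> quat) : quat -> quat :=
  power_series (qconv (coeffs f) (coeffs g)).

Definition rconj (f : quat -> quat) : quat -> quat :=
  power_series (fun m => qconj (coeffs f m)).

Definition rsym (f : quat -> quat) : quat -> quat := rstar f (rconj f).

Definition rinv (f : quat -> quat) (q : quat) : quat :=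
  (qinv (rsym f q) * rconj f q)%quat.

Definition moebius (p q : quat) : quat :=
  (qinv (qreal 1 - q * qconj p) * (q - p))%quat.

Definition rmoebius (p : quat) : quat -> quat :=
  rstar (rinv (fun q => (qreal 1 - q * qconj p)%quat)) (fun q => (q - p)%quat).

Definition rstar_prod (fs : list (quat -> quat)) : quat -> quat :=
  fold_right rstar (fun _ => qreal 1) fs.

Definition blaschke_of_degree (kappa : nat) (f : quat -> quat) : Prop :=
  (1 <= kappa)%nat /\
  exists (ts : list quat) (u : quat),
    length ts = kappa /\ List.Forall in_ball ts /\ in_sphere u /\
    eq_on_ball f (fun q => (rstar_prod (map rmoebius ts) q * u)%quat).

Definition regular_blaschke (f : quat -> quat) : Prop :=
  exists kappa : nat, blaschke_of_degree kappa f.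

(** Nodes and values are sequences of which only the entries with indices
    1, ..., n matter. *)

Definition interpolant (n : nat) (r : nat -> R) (s : nat -> quat)
    (f : quat -> quat) : Prop :=
  slice_regular f /\
  (forall q : quat, in_ball q -> in_ball (f q)) /\
  (forall m : nat, (1 <= m <= n)%nat -> f (qreal (r m)) = s m).

(* [None] is the symbol infinity, so it is neither in the ball nor on the
   sphere. *)
Definition ext_in_ball (w : option quat) : Prop :=
  match w with Some q => in_ball q | None => False end.
Definition ext_in_sphere (w : option quat) : Prop :=
  match w with Some q => in_sphere q | None => False end.

Definition ball_dec (q : quat) : {in_ball q} + {~ in_ball q} :=
  Rlt_dec (qnorm q) 1.
Definition sphere_dec (q : quat) : {in_sphere q} + {~ in_sphere q} :=
  Req_EM_T (qnorm q) 1.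

(* The passage from Q_(kappa-1) to Q_kappa: [w1] and [w2] are the entries of
   upper index kappa and l, and [r1], [r2] are the corresponding nodes. *)
Definition Q_step (r1 r2 : R) (w1 w2 : option quat) : option quat :=
  match w1, w2 with
  | Some q1, Some q2 =>
      if ball_dec q1 then
        if ball_dec q2 then
          Some (qinv (moebius (qreal r1) (qreal r2)) * moebius q1 q2)%quat
        else None
      else if quat_eq_dec q1 q2 then
        if sphere_dec q1 then Some q1 else None
      else None
  | _, _ => None
  end.

(* [Qtab r s kappa l] is Q_kappa^l, meaningful for kappa < l <= n. *)
Fixpoint Qtab (r : nat -> R) (s : nat -> quat) (kappa l : nat) : option quat :=
  match kappa with
  | O => Some (s l)
  | S O =>
      Some (qinv (moebius (qreal (r 1%nat)) (qreal (r l)))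
            * moebius (s 1%nat) (s l))%quat
  | S k => Q_step (r kappa) (r l) (Qtab r s k kappa) (Qtab r s k l)
  end.

Definition infinitely_many_solutions (P : (quat -> quat) -> Prop) : Prop :=
  exists F : nat -> quat -> quat,
    (forall i : nat, P (F i)) /\
    (forall i j : nat, i <> j -> ~ eq_on_ball (F i) (F j)).

Definition row_constant_unimodular (n : nat) (r : nat -> R) (s : nat -> quat)
    (kappa : nat) : Prop :=
  exists w : quat, in_sphere w /\
    forall l : nat, (kappa + 1 <= l <= n)%nat -> Qtab r s kappa l = Some w.

(* Main.v *)
Require Import Defs.
From Stdlib Require Import Lra Lia Arith FunctionalExtensionality ClassicalEpsilon Classical.

(** Everything is done with the sequences of coefficients.  A sequence [a] is a
    Schur series ([schur]) when multiplication by it does not increase any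
    truncated square norm [sum_(m <= n) |h_m|^2].  Slice regular functions have
    power series expansions ([slice_regular_expansion], from the Cauchy formula
    on each slice), and those bounded by one are exactly the Schur series
    ([schur_of_bounded], by Parseval on spheres, and [schur_ball]).  Two
    identities between finite sums make the class convenient, although
    evaluation at quaternions is not multiplicative: [moebius_defect], which
    lets Schur series be composed with a Moebius map, and the Blaschke defect
    identities, which let a zero be divided out ([blaschke_division]).

    At a real point evaluation is multiplicative, so one step of the Schur
    algorithm, Moebius map followed by division by the Blaschke factor of a real
    node, acts on the values at the other nodes by the rule that defines the
    table: when the interpolation problem has a solution [f_0], row [k] consists
    of the values of the series [f_k] produced by [k] steps ([Qtab_descends]).
    Conversely a step can be undone ([ascend], [schur_next_injective]); a series
    whose values form row [k] leads back to exactly one solution.  The last row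
    has a single entry.  It may be the value of infinitely many Schur series
    when it lies in the ball, of one only, the constant, when it lies on the
    sphere by the maximum principle, and of none otherwise.

    In the singular case the algorithm reaches a unimodular constant, at step
    [kappa0] say, and the solution arises from it by [kappa0] inverse steps.
    Each inverse step multiplies by a Blaschke factor, which raises the degree
    by one, and applies a Moebius map.  The latter sends Blaschke products to
    Blaschke products of the same degree ([blaschke_moebius]): a product of [k]
    factors satisfies an identity expressing its defect by [k] squares
    ([rank_le]), which survives Moebius maps; the identity makes the transform
    inner with [energy] at most [k]; an inner series that is regular beyond the
    closed ball is constant or has a zero ([inner_without_zeros]); and splitting
    off a zero removes one Blaschke factor and lowers the energy by exactly one.
    The energy also shows that the degree is unique. *)

(** * Quaternion arithmetic *)

Definition nsq (q : quat) : R := cre q ^ 2 + cim1 q ^ 2 + cim2 q ^ 2 + cim3 q ^ 2.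

(** The Euclidean inner product, that is the real part of [p * qconj q]. *)
Definition qdot (p q : quat) : R :=
  cre p * cre q + cim1 p * cim1 q + cim2 p * cim2 q + cim3 p * cim3 q.

Lemma quat_ext (p q : quat) :
  cre p = cre q -> cim1 p = cim1 q -> cim2 p = cim2 q -> cim3 p = cim3 q -> p = q.
Proof.
destruct p as [[[p0 p1] p2] p3], q as [[[q0 q1] q2] q3].
unfold cre, cim1, cim2, cim3; simpl; intros; subst; reflexivity.
Qed.

Lemma cre_add p q : cre (p + q)%quat = cre p + cre q.
Proof. reflexivity. Qed.
Lemma cim1_add p q : cim1 (p + q)%quat = cim1 p + cim1 q.
Proof. reflexivity. Qed.
Lemma cim2_add p q : cim2 (p + q)%quat = cim2 p + cim2 q.
Proof. reflexivity. Qed.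
Lemma cim3_add p q : cim3 (p + q)%quat = cim3 p + cim3 q.
Proof. reflexivity. Qed.
Lemma cre_opp p : cre (- p)%quat = - cre p.
Proof. reflexivity. Qed.
Lemma cim1_opp p : cim1 (- p)%quat = - cim1 p.
Proof. reflexivity. Qed.
Lemma cim2_opp p : cim2 (- p)%quat = - cim2 p.
Proof. reflexivity. Qed.
Lemma cim3_opp p : cim3 (- p)%quat = - cim3 p.
Proof. reflexivity. Qed.

Ltac qbreak :=
  repeat match goal with q : quat |- _ =>
    let a := fresh q "0" in let b := fresh q "1" in
    let c := fresh q "2" in let d := fresh q "3" in
    destruct q as [[[a b] c] d] end.

Ltac qunfold :=
  unfold nsq, qdot, qadd, qopp, qscal, qmul, qconj, qreal, cre, cim1, cim2, cim3,
    plus, opp, scal, prod_plus, prod_opp, prod_scal, mult; cbn -[Rplus Rmult Ropp pow];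
  unfold plus, opp, scal, prod_plus, prod_opp, prod_scal, mult; cbn -[Rplus Rmult Ropp pow].

(** Maximal subterms that are not built by quaternion operations become variables;
    otherwise the expansion into components would unfold them. *)
Ltac qatoms t :=
  lazymatch t with
  | qadd ?a ?b => qatoms a; qatoms b
  | qmul ?a ?b => qatoms a; qatoms b
  | qopp ?a => qatoms a
  | qconj ?a => qatoms a
  | qscal _ ?a => qatoms a
  | qreal _ => idtac
  | _ => tryif is_var t then idtac else (let x := fresh "q" in generalize t; intro x)
  end.

(** Identities between noncommutative polynomials, checked on components. *)
Ltac qring :=
  intros; lazymatch goal with |- ?l = ?r => qatoms l; qatoms r end;
  repeat match goal with H : _ |- _ => clear H end;
  apply quat_ext; qbreak; qunfold; unfold plus, opp, scal, mult; simpl; ring.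
Ltac qrring := intros; qbreak; qunfold; unfold plus, opp, scal, mult; simpl; ring.

Lemma qmulA p q r : (p * (q * r) = p * q * r)%quat.  Proof. qring. Qed.
Lemma qmulDl p q r : ((p + q) * r = p * r + q * r)%quat.  Proof. qring. Qed.
Lemma qmulDr p q r : (p * (q + r) = p * q + p * r)%quat.  Proof. qring. Qed.
Lemma qmul1l p : (qreal 1 * p = p)%quat.  Proof. qring. Qed.
Lemma qmul1r p : (p * qreal 1 = p)%quat.  Proof. qring. Qed.
Lemma qmul0l p : (qreal 0 * p = qreal 0)%quat.  Proof. qring. Qed.
Lemma qmul0r p : (p * qreal 0 = qreal 0)%quat.  Proof. qring. Qed.
Lemma qaddC p q : (p + q = q + p)%quat.  Proof. qring. Qed.
Lemma qaddA p q r : (p + (q + r) = p + q + r)%quat.  Proof. qring. Qed.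
Lemma qadd0l p : (qreal 0 + p = p)%quat.  Proof. qring. Qed.
Lemma qadd0r p : (p + qreal 0 = p)%quat.  Proof. qring. Qed.
Lemma qaddN p : (p - p = qreal 0)%quat.  Proof. qring. Qed.
Lemma qconjM p q : qconj (p * q) = (qconj q * qconj p)%quat.  Proof. qring. Qed.
Lemma qconjD p q : qconj (p + q) = (qconj p + qconj q)%quat.  Proof. qring. Qed.
Lemma qconjK p : qconj (qconj p) = p.  Proof. qring. Qed.
Lemma qconjM_self p : (qconj p * p = qreal (nsq p))%quat.  Proof. qring. Qed.
Lemma qmul_conj_self p : (p * qconj p = qreal (nsq p))%quat.  Proof. qring. Qed.
Lemma qreal_comm x p : (qreal x * p = p * qreal x)%quat.  Proof. qring. Qed.
Lemma qrealM x y : (qreal x * qreal y = qreal (x * y))%quat.  Proof. qring. Qed.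
Lemma qscalE x p : qscal x p = (qreal x * p)%quat.  Proof. qring. Qed.

Lemma nsqM p q : nsq (p * q) = nsq p * nsq q.  Proof. qrring. Qed.
Lemma nsqN p : nsq (- p) = nsq p.  Proof. qrring. Qed.
Lemma nsq_conj p : nsq (qconj p) = nsq p.  Proof. qrring. Qed.
Lemma nsq_real x : nsq (qreal x) = x ^ 2.  Proof. qrring. Qed.
Lemma nsqD p q : nsq (p + q) = nsq p + 2 * qdot p q + nsq q.  Proof. qrring. Qed.

Lemma nsq_ge0 p : 0 <= nsq p.
Proof. unfold nsq; nra. Qed.

Lemma nsq_eq0 p : nsq p = 0 -> p = qreal 0.
Proof.
unfold nsq; intros H.
assert (H0 := pow2_ge_0 (cre p)); assert (H1 := pow2_ge_0 (cim1 p)).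
assert (H2 := pow2_ge_0 (cim2 p)); assert (H3 := pow2_ge_0 (cim3 p)).
assert (forall x : R, x ^ 2 = 0 -> x = 0) as Z by (intros x Hx; simpl in Hx; nra).
apply quat_ext; apply Z; lra.
Qed.

Lemma nsq_neq0 p : p <> qreal 0 -> 0 < nsq p.
Proof.
intros H; destruct (nsq_ge0 p) as [|E]; auto.
exfalso; apply H, nsq_eq0; auto.
Qed.

Lemma qnorm_sqr p : qnorm p ^ 2 = nsq p.
Proof. unfold qnorm; rewrite <- Rsqr_pow2; apply Rsqr_sqrt, nsq_ge0. Qed.

Lemma qnorm_ge0 p : 0 <= qnorm p.
Proof. apply sqrt_pos. Qed.

Lemma qnorm_nsq p : qnorm p = sqrt (nsq p).
Proof. reflexivity. Qed.

Lemma qnormM p q : qnorm (p * q) = qnorm p * qnorm q.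
Proof. rewrite !qnorm_nsq, nsqM; apply sqrt_mult; apply nsq_ge0. Qed.

Lemma qnormN p : qnorm (- p) = qnorm p.
Proof. now rewrite !qnorm_nsq, nsqN. Qed.

Lemma qnorm_conj p : qnorm (qconj p) = qnorm p.
Proof. now rewrite !qnorm_nsq, nsq_conj. Qed.

Lemma qnorm_real x : qnorm (qreal x) = Rabs x.
Proof. rewrite qnorm_nsq, nsq_real, <- Rsqr_pow2; apply sqrt_Rsqr_abs. Qed.

(** The norm carried by the normed module structure is the Euclidean one, so
    limits and series of quaternions may be estimated with [qnorm]. *)
Lemma norm_qnorm (p : quat) : norm p = qnorm p.
Proof.
destruct p as [[[a b] c] d].
assert (forall x : R, 0 <= x -> sqrt x ^ 2 = x) as E.
{ intros x Hx; now rewrite <- !Rsqr_pow2, !Rsqr_sqrt. }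
assert (forall x : R, Rabs x = sqrt (x ^ 2)) as A.
{ intros x; rewrite <- Rsqr_pow2; symmetry; apply sqrt_Rsqr_abs. }
change (norm (((a, b), c), d) : R) with
  (sqrt (sqrt (sqrt (Rabs a ^ 2 + Rabs b ^ 2) ^ 2 + Rabs c ^ 2) ^ 2 + Rabs d ^ 2)).
unfold qnorm, cre, cim1, cim2, cim3; cbn [fst snd].
rewrite !A; rewrite !E; try reflexivity; repeat apply Rplus_le_le_0_compat; apply pow2_ge_0.
Qed.

Lemma qnorm_triangle p q : qnorm (p + q) <= qnorm p + qnorm q.
Proof. rewrite <- !norm_qnorm; apply (norm_triangle p q). Qed.

Lemma qnorm_eq0 p : qnorm p = 0 -> p = qreal 0.
Proof. intros H; apply nsq_eq0; rewrite <- qnorm_sqr, H; simpl; ring. Qed.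

Lemma qnorm_lt1 p : qnorm p < 1 <-> nsq p < 1.
Proof. assert (H := qnorm_ge0 p); rewrite <- qnorm_sqr; split; intros; nra. Qed.

Lemma qnorm_le1 p : qnorm p <= 1 <-> nsq p <= 1.
Proof. assert (H := qnorm_ge0 p); rewrite <- qnorm_sqr; split; intros; nra. Qed.

Lemma qnorm_eq1 p : qnorm p = 1 <-> nsq p = 1.
Proof. assert (H := qnorm_ge0 p); rewrite <- qnorm_sqr; split; intros; nra. Qed.

Lemma qinvE p : (qinv p = qreal (/ nsq p) * qconj p)%quat.
Proof. unfold qinv; now rewrite qnorm_sqr, qscalE. Qed.

Lemma qmulVl p : p <> qreal 0 -> (qinv p * p = qreal 1)%quat.
Proof.
intros H; rewrite qinvE, <- qmulA, qconjM_self, qrealM.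
f_equal; apply Rinv_l; apply nsq_neq0 in H; lra.
Qed.

Lemma qmulVr p : p <> qreal 0 -> (p * qinv p = qreal 1)%quat.
Proof.
intros H; rewrite qinvE, qreal_comm, qmulA, qmul_conj_self, qrealM.
f_equal; apply Rinv_r; apply nsq_neq0 in H; lra.
Qed.

Lemma nsq_inv p : p <> qreal 0 -> nsq (qinv p) = / nsq p.
Proof.
intros H; rewrite qinvE, nsqM, nsq_conj, nsq_real.
apply nsq_neq0 in H; field; lra.
Qed.

Lemma qmul_eq0 p q : (p * q = qreal 0)%quat -> p = qreal 0 \/ q = qreal 0.
Proof.
intros H; assert (nsq p * nsq q = 0) as E by (rewrite <- nsqM, H, nsq_real; simpl; ring).
apply Rmult_integral in E; destruct E as [E|E]; apply nsq_eq0 in E; auto.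
Qed.

Lemma qmul_cancel_l p q r : p <> qreal 0 -> (p * q = p * r)%quat -> q = r.
Proof.
intros Hp H; rewrite <- (qmul1l q), <- (qmul1l r), <- (qmulVl p Hp).
now rewrite <- !qmulA, H.
Qed.

Lemma qsub_eq0 p q : (p - q = qreal 0)%quat -> p = q.
Proof.
intros H; rewrite <- (qadd0l q), <- H; qring.
Qed.

Lemma qpow_real x m : qpow (qreal x) m = qreal (x ^ m).
Proof. induction m as [|m IH]; simpl; [easy | now rewrite IH, qrealM]. Qed.

Lemma qpow_S_r q m : qpow q (S m) = (qpow q m * q)%quat.
Proof.
induction m as [|m IH]; simpl; [now rewrite qmul1l, qmul1r |].
simpl in IH; now rewrite IH at 1; rewrite qmulA.
Qed.

Lemma qpowD q m k : qpow q (m + k) = (qpow q m * qpow q k)%quat.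
Proof. induction m as [|m IH]; simpl; [now rewrite qmul1l | now rewrite IH, qmulA]. Qed.

Lemma qnorm_pow q m : qnorm (qpow q m) = qnorm q ^ m.
Proof.
induction m as [|m IH]; simpl; [rewrite qnorm_real; apply Rabs_R1 | now rewrite qnormM, IH].
Qed.

Lemma nsq_pow q m : nsq (qpow q m) = nsq q ^ m.
Proof.
induction m as [|m IH]; simpl; [rewrite nsq_real; ring | now rewrite nsqM, IH].
Qed.

Lemma qpow_conjugate w q m : w <> qreal 0 ->
  (qpow q m * w = w * qpow (qinv w * q * w) m)%quat.
Proof.
intros Hw; induction m as [|m IH]; simpl; [now rewrite qmul1l, qmul1r|].
rewrite <- qmulA, IH, !qmulA, qmulVr, qmul1l; auto.
Qed.

Lemma nsq_conjugate w q : w <> qreal 0 -> nsq (qinv w * q * w) = nsq q.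
Proof.
intros Hw; rewrite !nsqM, nsq_inv by auto; apply nsq_neq0 in Hw; field; lra.
Qed.

(** * Formal series *)

Infix "**" := qconv (at level 40, left associativity).

Definition sadd (a b : nat -> quat) (m : nat) : quat := (a m + b m)%quat.
Infix "+:" := sadd (at level 50, left associativity).
Definition cst (c : quat) (m : nat) : quat := match m with O => c | S _ => qreal 0 end.
(** Multiplication by the variable. *)
Definition shift (a : nat -> quat) (m : nat) : quat :=
  match m with O => qreal 0 | S k => a k end.
Definition tail (a : nat -> quat) (m : nat) : quat := a (S m).
Definition sconj (a : nat -> quat) (m : nat) : quat := qconj (a m).
(** The polynomial [c + q d]. *)
Definition lin (c d : quat) : nat -> quat := cst c +: shift (cst d).
(** The reciprocal of [lin 1 (- w)]. *)
Definition geom (w : quat) (m : nat) : quat := qpow w m.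

Lemma qsum_S (u : nat -> quat) n :
  sum_n (fun m => u m : quat) (S n) = (sum_n (fun m => u m : quat) n + u (S n))%quat.
Proof. exact (sum_Sn u n). Qed.

Lemma qsum_0 (u : nat -> quat) : sum_n (fun m => u m : quat) 0 = u O.
Proof. exact (sum_O u). Qed.

Lemma qconv_0 a b : (a ** b) O = (a O * b O)%quat.
Proof. unfold qconv; now rewrite qsum_0. Qed.

Lemma qsum_ext_le (u v : nat -> quat) n : (forall m, (m <= n)%nat -> u m = v m) ->
  sum_n (fun m => u m : quat) n = sum_n (fun m => v m : quat) n.
Proof. intros H; now apply sum_n_ext_loc. Qed.

Lemma qconv_S a b n : (a ** b) (S n) = (a O * b (S n) + (tail a ** b) n)%quat.
Proof.
unfold qconv; rewrite qsum_S, qaddC; f_equal.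
- now rewrite Nat.sub_diag.
- apply qsum_ext_le; intros m Hm; unfold tail; do 2 f_equal; lia.
Qed.

Lemma qconv_ext a a' b b' n : (forall m, (m <= n)%nat -> a m = a' m) ->
  (forall m, (m <= n)%nat -> b m = b' m) -> (a ** b) n = (a' ** b') n.
Proof.
intros Ha Hb; apply qsum_ext_le; intros m Hm; rewrite Ha, Hb; auto; lia.
Qed.

Lemma qconv_Sr a b n : (a ** b) (S n) = (a (S n) * b O + (a ** tail b) n)%quat.
Proof.
revert a; induction n as [|n IH]; intros a; rewrite qconv_S.
- rewrite !qconv_0; apply qaddC.
- rewrite IH, qconv_S; unfold tail; rewrite !qaddA; f_equal; apply qaddC.
Qed.

Lemma sext (a b : nat -> quat) : (forall m, a m = b m) -> a = b.
Proof. intros; now apply functional_extensionality. Qed.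

Lemma qconvDl a b c : (a +: b) ** c = a ** c +: b ** c.
Proof.
apply sext; intros n; revert a b; induction n as [|n IH]; intros a b; unfold sadd.
- rewrite !qconv_0; apply qmulDl.
- rewrite !qconv_S, qmulDl.
  change (tail (fun m => (a m + b m)%quat)) with (tail a +: tail b).
  rewrite IH; unfold sadd; qring.
Qed.

Lemma qconvDr a b c : a ** (b +: c) = a ** b +: a ** c.
Proof.
apply sext; intros n; revert a; induction n as [|n IH]; intros a; unfold sadd.
- rewrite !qconv_0; apply qmulDr.
- rewrite !qconv_S; fold (b +: c); rewrite IH; unfold sadd; qring.
Qed.

Definition lscale (c : quat) (a : nat -> quat) (m : nat) : quat := (c * a m)%quat.
Definition rscale (a : nat -> quat) (c : quat) (m : nat) : quat := (a m * c)%quat.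

Lemma lscale_qconv c a b : lscale c a ** b = lscale c (a ** b).
Proof.
apply sext; intros n; revert a; induction n as [|n IH]; intros a; unfold lscale.
- rewrite !qconv_0; now rewrite qmulA.
- rewrite !qconv_S; change (tail (fun m => (c * a m)%quat)) with (lscale c (tail a)).
  rewrite IH; unfold lscale; qring.
Qed.

Lemma qconvA a b c : a ** (b ** c) = a ** b ** c.
Proof.
apply sext; intros n; revert a; induction n as [|n IH]; intros a.
- now rewrite !qconv_0, qmulA.
- rewrite !qconv_S, IH.
  replace (tail (a ** b)) with (lscale (a O) (tail b) +: tail a ** b)
    by (apply sext; intros m; unfold tail at 3; now rewrite qconv_S).
  rewrite qconvDl, lscale_qconv, qconv_0; unfold lscale, sadd; qring.
Qed.

Lemma cst_qconv c a : cst c ** a = lscale c a.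
Proof.
apply sext; intros n; unfold lscale; destruct n; [apply qconv_0 |].
rewrite qconv_S; cbn [cst].
enough (forall n b, (tail (cst c) ** b) n = qreal 0) as E by (rewrite E; apply qadd0r).
clear; intros n b; assert (E : forall m, tail (cst c) m = qreal 0) by reflexivity; revert E.
generalize (tail (cst c)); revert b; induction n as [|n IH]; intros b u E.
- rewrite qconv_0, E; apply qmul0l.
- rewrite qconv_S, E, IH; [qring | intros; apply E].
Qed.

Lemma qconv_cst a c : a ** cst c = rscale a c.
Proof.
apply sext; intros n; unfold rscale; revert a; induction n as [|n IH]; intros a.
- now rewrite qconv_0.
- rewrite qconv_S, IH; unfold tail; simpl; qring.
Qed.

Lemma cst1_qconv a : cst (qreal 1) ** a = a.
Proof. rewrite cst_qconv; apply sext; intros m; apply qmul1l. Qed.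

Lemma qconv_cst1 a : a ** cst (qreal 1) = a.
Proof. rewrite qconv_cst; apply sext; intros m; apply qmul1r. Qed.

Lemma shift_qconv a b : shift a ** b = shift (a ** b).
Proof.
apply sext; intros [|n].
- rewrite qconv_0; apply qmul0l.
- rewrite qconv_S; cbn [shift]; rewrite qmul0l, qadd0l; reflexivity.
Qed.

Lemma qconv_shift a b : a ** shift b = shift (a ** b).
Proof.
apply sext; intros [|n].
- rewrite qconv_0; apply qmul0r.
- rewrite qconv_Sr; cbn [shift]; rewrite qmul0r, qadd0l; reflexivity.
Qed.

Lemma tail_shift a : tail (shift a) = a.
Proof. now apply sext. Qed.

Lemma sconj_qconv a b : sconj (a ** b) = sconj b ** sconj a.
Proof.
apply sext; intros n; unfold sconj at 1; revert a; induction n as [|n IH]; intros a.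
- rewrite !qconv_0; apply qconjM.
- rewrite qconv_S, qconv_Sr, qconjD, qconjM, IH; reflexivity.
Qed.

Lemma sconjK a : sconj (sconj a) = a.
Proof. apply sext; intros m; apply qconjK. Qed.

Lemma lin_qconv c d a : lin c d ** a = lscale c a +: shift (lscale d a).
Proof. unfold lin; now rewrite qconvDl, shift_qconv, !cst_qconv. Qed.

Lemma qconv_lin c d a : a ** lin c d = rscale a c +: shift (rscale a d).
Proof. unfold lin; now rewrite qconvDr, qconv_shift, !qconv_cst. Qed.

Lemma geom_inv_l w : lin (qreal 1) (- w)%quat ** geom w = cst (qreal 1).
Proof.
rewrite lin_qconv; apply sext; intros [|n]; unfold sadd, lscale, geom; simpl; [qring|].
generalize (qpow w n); intros p; qring.
Qed.

Lemma geom_inv_r w : geom w ** lin (qreal 1) (- w)%quat = cst (qreal 1).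
Proof.
rewrite qconv_lin; apply sext; intros [|n]; unfold sadd, rscale, geom; [simpl; qring|].
rewrite qpow_S_r; cbn [shift cst]; generalize (qpow w n); intros p; qring.
Qed.

(** An inverse [b] is a fixed point of [b |-> w + q (d b)] with [w] the inverse
    of the constant term; since [q] shifts the coefficients, each application
    of this map settles one more of them. *)
Lemma right_inverse_exists a : a O <> qreal 0 -> exists b, a ** b = cst (qreal 1).
Proof.
intros H0; pose (w := qinv (a O)); pose (d := lscale (- w)%quat (tail a)).
pose (T := fun b => cst w +: shift (d ** b)).
pose (B := fun k => Nat.iter k T (cst (qreal 0))).
assert (stable : forall n k k', (n < k)%nat -> (n < k')%nat -> B k n = B k' n).
{ induction n as [n IH] using (well_founded_induction Wf_nat.lt_wf); intros [|k] [|k'] Hk Hk'; try lia.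
  change (B (S k)) with (T (B k)); change (B (S k')) with (T (B k')); unfold T, sadd.
  destruct n as [|n]; [reflexivity|]; cbn [shift]; f_equal.
  apply qconv_ext; [reflexivity|]; intros m Hm; apply IH; lia. }
pose (b := fun n => B (S n) n); exists b.
assert (Tb : forall n, b n = T b n).
{ intros [|n]; [reflexivity|]; unfold b.
  change (B (S (S n))) with (T (B (S n))); unfold T, sadd; cbn [shift]; f_equal.
  apply qconv_ext; [reflexivity|]; intros m Hm; apply stable; lia. }
apply sext; intros [|n].
- rewrite qconv_0, (Tb O); unfold T, sadd; cbn [cst shift]; rewrite qadd0r; now apply qmulVr.
- rewrite qconv_S, (Tb (S n)); unfold T, sadd; cbn [cst shift]; rewrite qadd0l.
  unfold d; rewrite lscale_qconv; unfold lscale.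
  replace (a O * (- w * (tail a ** b) n))%quat with (- (a O * w) * (tail a ** b) n)%quat by qring.
  unfold w; rewrite qmulVr by auto; qring.
Qed.

(** As in any monoid, a right inverse that has itself a right inverse is
    two-sided. *)
Lemma right_inverse_left a b : a O <> qreal 0 ->
  a ** b = cst (qreal 1) -> b ** a = cst (qreal 1).
Proof.
intros H0 H.
assert (Hb : b O <> qreal 0).
{ intros E; assert (E1 := f_equal (fun u => u O) H); cbn [cst] in E1.
  rewrite qconv_0, E, qmul0r in E1; apply (f_equal cre) in E1.
  unfold cre, qreal in E1; simpl in E1; lra. }
destruct (right_inverse_exists b Hb) as [c Hc].
rewrite <- (qconv_cst1 a), <- Hc, (qconvA a), H, cst1_qconv at 1; exact Hc.
Qed.

Lemma inverse_exists a : a O <> qreal 0 ->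
  exists b, a ** b = cst (qreal 1) /\ b ** a = cst (qreal 1).
Proof.
intros H0; destruct (right_inverse_exists a H0) as [b Hb].
exists b; split; [exact Hb | now apply right_inverse_left].
Qed.

(** * Truncated square norms *)

Definition sqsum (u : nat -> quat) (n : nat) : R := sum_n (fun m => nsq (u m)) n.

Lemma sum_SnR (u : nat -> R) n : sum_n u (S n) = sum_n u n + u (S n).
Proof. exact (sum_Sn u n). Qed.
Lemma sum_SnlR (u : nat -> R) n : sum_n u (S n) = u O + sum_n (fun m => u (S m)) n.
Proof.
change (@eq R (sum_n u (S n)) (u O + sum_n (fun m => u (S m)) n)).
induction n as [|n IH]; [now rewrite sum_SnR, !sum_O | rewrite sum_SnR, IH, sum_SnR; ring].
Qed.

Lemma sum_scal_R (k : R) (u : nat -> R) n : k * sum_n u n = sum_n (fun m => k * u m) n.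
Proof.
change (@eq R (k * sum_n u n) (sum_n (fun m => k * u m) n)).
induction n as [|n IH]; [now rewrite !sum_O | rewrite !sum_SnR, <- IH; ring].
Qed.

Lemma sum_n_le_R (u v : nat -> R) n : (forall m, (m <= n)%nat -> u m <= v m) -> sum_n u n <= sum_n v n.
Proof.
induction n as [|n IH]; intros H; [rewrite !sum_O; apply H; lia|].
rewrite !sum_SnR; apply Rplus_le_compat; [apply IH; intros; apply H; lia | apply H; lia].
Qed.

Lemma sum_n_mono_R (u : nat -> R) n N : (forall m, 0 <= u m) -> (n <= N)%nat -> sum_n u n <= sum_n u N.
Proof.
intros H; induction 1 as [|N HN IH]; [lra|]; rewrite sum_SnR; specialize (H (S N)); lra.
Qed.

Lemma sqsum_0 u : sqsum u 0 = nsq (u O).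
Proof. apply sum_O. Qed.
Lemma sqsum_S u n : sqsum u (S n) = sqsum u n + nsq (u (S n)).
Proof. apply (sum_Sn (fun m => nsq (u m))). Qed.

Lemma sqsum_Sl u n : sqsum u (S n) = nsq (u O) + sqsum (tail u) n.
Proof.
induction n as [|n IH].
- now rewrite sqsum_S, !sqsum_0.
- rewrite sqsum_S, IH, sqsum_S; unfold tail at 3; ring.
Qed.

Lemma sqsum_ge0 u n : 0 <= sqsum u n.
Proof.
induction n as [|n IH]; rewrite ?sqsum_0, ?sqsum_S; [apply nsq_ge0|].
assert (H := nsq_ge0 (u (S n))); lra.
Qed.

Lemma sqsum_mono u n m : (n <= m)%nat -> sqsum u n <= sqsum u m.
Proof.
induction 1 as [|m Hm IH]; [lra|]; rewrite sqsum_S; assert (H := nsq_ge0 (u (S m))); lra.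
Qed.

Lemma sqsum_term u n m : (m <= n)%nat -> nsq (u m) <= sqsum u n.
Proof.
intros H; apply Rle_trans with (sqsum u m); [|now apply sqsum_mono].
destruct m as [|m]; [rewrite sqsum_0; lra | rewrite sqsum_S; assert (H1 := sqsum_ge0 u m); lra].
Qed.

Lemma sqsum_ext u v n : (forall m, (m <= n)%nat -> u m = v m) -> sqsum u n = sqsum v n.
Proof. intros H; apply sum_n_ext_loc; intros m Hm; now rewrite H. Qed.

Lemma sqsum_sconj u n : sqsum (sconj u) n = sqsum u n.
Proof. apply sum_n_ext; intros m; apply nsq_conj. Qed.

Lemma sqsum_rscale u c n : sqsum (rscale u c) n = sqsum u n * nsq c.
Proof.
induction n as [|n IH]; rewrite ?sqsum_0, ?sqsum_S, ?IH; unfold rscale; rewrite nsqM; ring.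
Qed.

Lemma sqsum_lscale c u n : sqsum (lscale c u) n = nsq c * sqsum u n.
Proof.
induction n as [|n IH]; rewrite ?sqsum_0, ?sqsum_S, ?IH; unfold lscale; rewrite nsqM; ring.
Qed.

Lemma sqsum_shift u n : sqsum (shift u) (S n) = sqsum u n.
Proof. rewrite sqsum_Sl, tail_shift; simpl; rewrite nsq_real; ring. Qed.

Lemma sqsum_cst c n : sqsum (cst c) n = nsq c.
Proof.
induction n as [|n IH]; rewrite ?sqsum_0, ?sqsum_S, ?IH; simpl; rewrite ?nsq_real; ring.
Qed.

(** The inequality of Cauchy and Schwarz in an additive form; together with the
    case of equality [qconv_rev_conj] it gives duality for truncated norms. *)
Lemma cre_qconv_le u v n : 2 * cre ((u ** v) n) <= sqsum u n + sqsum v n.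
Proof.
assert (A : forall p q, 2 * cre (p * q)%quat <= nsq p + nsq q).
{ intros p q; assert (H := nsq_ge0 (p - qconj q)%quat).
  replace (nsq (p - qconj q)%quat) with (nsq p + nsq q - 2 * cre (p * q)%quat) in H by qrring.
  lra. }
revert u; induction n as [|n IH]; intros u.
- rewrite qconv_0, !sqsum_0; apply A.
- rewrite qconv_S, cre_add, sqsum_Sl, sqsum_S.
  assert (H := IH (tail u)); assert (H' := A (u O) (v (S n))); lra.
Qed.

Definition rev_conj (n : nat) (z : nat -> quat) (j : nat) : quat := qconj (z (n - j)%nat).

Lemma qconv_rev_conj z n :
  cre ((z ** rev_conj n z) n) = sqsum z n /\ sqsum (rev_conj n z) n = sqsum z n.
Proof.
revert z; induction n as [|n IH]; intros z.
- rewrite qconv_0, !sqsum_0; unfold rev_conj; simpl; rewrite nsq_conj; split; [qrring | easy].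
- assert (E : forall m, (m <= n)%nat -> rev_conj (S n) z m = rev_conj n (tail z) m).
  { intros m Hm; unfold rev_conj, tail; do 2 f_equal; lia. }
  destruct (IH (tail z)) as [IH1 IH2].
  rewrite qconv_S, (sqsum_S (rev_conj _ _)), (sqsum_Sl z), (sqsum_ext _ _ n E), IH2, cre_add.
  rewrite (qconv_ext (tail z) (tail z) _ (rev_conj n (tail z)) n (fun m _ => eq_refl) E), IH1.
  unfold rev_conj; rewrite Nat.sub_diag, nsq_conj; split; [|ring].
  f_equal; generalize (z O); qrring.
Qed.

(** * Convergence and evaluation of series *)

(** Convergence is measured by [qnorm], which reduces limits of quaternions to
    limits of real sequences. *)
Definition tends (u : nat -> quat) (l : quat) : Prop :=
  is_lim_seq (fun n => qnorm (u n - l)) 0.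

Lemma is_lim_seq_0_le (u v : nat -> R) :
  (forall n, 0 <= u n <= v n) -> is_lim_seq v 0 -> is_lim_seq u 0.
Proof.
intros H Hv; apply is_lim_seq_le_le with (fun _ => 0) v; auto; apply is_lim_seq_const.
Qed.

Lemma tends_squeeze u l (v : nat -> R) :
  (forall n, qnorm (u n - l) <= v n) -> is_lim_seq v 0 -> tends u l.
Proof. intros H; apply is_lim_seq_0_le; intros n; split; [apply qnorm_ge0 | apply H]. Qed.

Lemma qnorm_sub_sym p q : qnorm (p - q) = qnorm (q - p).
Proof. rewrite <- qnormN; f_equal; qring. Qed.

Lemma qsub_qnorm_le p q : qnorm p <= qnorm q + qnorm (p - q).
Proof. replace p with (q + (p - q))%quat at 1 by qring; apply qnorm_triangle. Qed.

Lemma tends_unique u l l' : tends u l -> tends u l' -> l = l'.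
Proof.
intros H H'; apply qsub_eq0, qnorm_eq0.
assert (H2 : is_lim_seq (fun n => qnorm (u n - l) + qnorm (u n - l')) 0).
{ replace (Finite 0) with (Finite (0 + 0)) by (f_equal; ring); now apply is_lim_seq_plus'. }
assert (H3 : forall n, qnorm (l - l') <= qnorm (u n - l) + qnorm (u n - l')).
{ intros n; rewrite (qnorm_sub_sym (u n)).
  replace (l - l')%quat with ((l - u n) + (u n - l'))%quat by qring; apply qnorm_triangle. }
apply Rle_antisym; [|apply qnorm_ge0].
exact (is_lim_seq_le _ _ _ _ H3 (is_lim_seq_const _) H2).
Qed.

Lemma tends_qnorm u l : tends u l -> is_lim_seq (fun n => qnorm (u n)) (qnorm l).
Proof.
intros H.
apply is_lim_seq_le_le with (fun n => qnorm l - qnorm (u n - l)) (fun n => qnorm l + qnorm (u n - l)).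
- intros n; split.
  + assert (E := qnorm_triangle (u n) (l - u n)); rewrite (qnorm_sub_sym l) in E.
    replace (u n + (l - u n))%quat with l in E by qring; lra.
  + replace (u n) with (l + (u n - l))%quat at 1 by qring; apply qnorm_triangle.
- replace (Finite (qnorm l)) with (Finite (qnorm l - 0)) by (f_equal; ring).
  apply is_lim_seq_minus'; [apply is_lim_seq_const | exact H].
- replace (Finite (qnorm l)) with (Finite (qnorm l + 0)) by (f_equal; ring).
  apply is_lim_seq_plus'; [apply is_lim_seq_const | exact H].
Qed.

Lemma tends_le u l c : (forall n, qnorm (u n) <= c) -> tends u l -> qnorm l <= c.
Proof.
intros H Hl; apply (is_lim_seq_le _ _ _ _ H (tends_qnorm _ _ Hl) (is_lim_seq_const c)).
Qed.

Lemma tends_const l : tends (fun _ => l) l.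
Proof.
apply is_lim_seq_ext with (fun _ => 0); [|apply is_lim_seq_const].
intros _; rewrite qaddN, qnorm_real, Rabs_R0; reflexivity.
Qed.

Lemma tends_add u v l l' : tends u l -> tends v l' -> tends (fun n => u n + v n)%quat (l + l')%quat.
Proof.
intros H H'; apply tends_squeeze with (fun n => qnorm (u n - l) + qnorm (v n - l')).
- intros n; replace ((u n + v n) - (l + l'))%quat with ((u n - l) + (v n - l'))%quat by qring.
  apply qnorm_triangle.
- replace (Finite 0) with (Finite (0 + 0)) by (f_equal; ring); now apply is_lim_seq_plus'.
Qed.

Lemma tends_mul_l c u l : tends u l -> tends (fun n => c * u n)%quat (c * l)%quat.
Proof.
intros H; apply tends_squeeze with (fun n => qnorm c * qnorm (u n - l)).
- intros n; replace (c * u n - c * l)%quat with (c * (u n - l))%quat by qring.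
  rewrite qnormM; lra.
- replace (Finite 0) with (Finite (qnorm c * 0)) by (f_equal; ring).
  apply (is_lim_seq_scal_l _ (qnorm c) 0), H.
Qed.

Lemma tends_mul_r c u l : tends u l -> tends (fun n => u n * c)%quat (l * c)%quat.
Proof.
intros H; apply tends_squeeze with (fun n => qnorm c * qnorm (u n - l)).
- intros n; replace (u n * c - l * c)%quat with ((u n - l) * c)%quat by qring.
  rewrite qnormM; lra.
- replace (Finite 0) with (Finite (qnorm c * 0)) by (f_equal; ring).
  apply (is_lim_seq_scal_l _ (qnorm c) 0), H.
Qed.

Lemma tends_conj u l : tends u l -> tends (fun n => qconj (u n)) (qconj l).
Proof.
apply is_lim_seq_ext; intros n; rewrite <- qnorm_conj; f_equal; qring.
Qed.

Lemma tends_of_incr u l : tends (fun n => u (S n)) l -> tends u l.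
Proof. exact (proj2 (is_lim_seq_incr_1 (fun n => qnorm (u n - l)) 0)). Qed.

Lemma tends_incr u l : tends u l -> tends (fun n => u (S n)) l.
Proof. exact (proj1 (is_lim_seq_incr_1 (fun n => qnorm (u n - l)) 0)). Qed.

Lemma tends_ext u v l : (forall n, u n = v n) -> tends u l -> tends v l.
Proof. intros H; apply is_lim_seq_ext; intros n; now rewrite H. Qed.

Lemma is_series_tends (u : nat -> quat) (l : quat) :
  is_series (u : nat -> quat) l <-> tends (fun n => sum_n (u : nat -> quat) n) l.
Proof.
etransitivity; [exact (filterlim_locally_ball_norm (sum_n (u : nat -> quat)) l)|].
unfold tends; rewrite <- is_lim_seq_spec; unfold is_lim_seq'.
split; intros H eps; destruct (H eps) as [N HN]; exists N; intros n Hn; specialize (HN n Hn).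
- unfold ball_norm in HN; rewrite norm_qnorm in HN.
  rewrite Rminus_0_r, Rabs_pos_eq by apply qnorm_ge0; exact HN.
- unfold ball_norm; rewrite norm_qnorm.
  rewrite Rminus_0_r, Rabs_pos_eq in HN by apply qnorm_ge0; exact HN.
Qed.

Lemma components_le_qnorm p : Rabs (cre p) <= qnorm p /\ Rabs (cim1 p) <= qnorm p /\
  Rabs (cim2 p) <= qnorm p /\ Rabs (cim3 p) <= qnorm p.
Proof.
assert (forall x s, x ^ 2 <= s -> Rabs x <= sqrt s) as E.
{ intros x s H; rewrite <- (sqrt_Rsqr_abs x); apply sqrt_le_1_alt; rewrite Rsqr_pow2; exact H. }
rewrite qnorm_nsq; unfold nsq; repeat split; apply E;
  assert (H0 := pow2_ge_0 (cre p)); assert (H1 := pow2_ge_0 (cim1 p));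
  assert (H2 := pow2_ge_0 (cim2 p)); assert (H3 := pow2_ge_0 (cim3 p)); lra.
Qed.

Lemma qnorm_le_components p :
  qnorm p <= Rabs (cre p) + Rabs (cim1 p) + Rabs (cim2 p) + Rabs (cim3 p).
Proof.
assert (P0 := Rabs_pos (cre p)); assert (P1 := Rabs_pos (cim1 p)).
assert (P2 := Rabs_pos (cim2 p)); assert (P3 := Rabs_pos (cim3 p)).
rewrite qnorm_nsq; apply Rsqr_incr_0_var; [|lra].
rewrite Rsqr_sqrt by apply nsq_ge0; unfold nsq, Rsqr.
rewrite <- (pow2_abs (cre p)), <- (pow2_abs (cim1 p)), <- (pow2_abs (cim2 p)), <- (pow2_abs (cim3 p)).
nra.
Qed.

Lemma sum_components (u : nat -> quat) n :
  cre (sum_n (u : nat -> quat) n) = sum_n (fun m => cre (u m)) n /\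
  cim1 (sum_n (u : nat -> quat) n) = sum_n (fun m => cim1 (u m)) n /\
  cim2 (sum_n (u : nat -> quat) n) = sum_n (fun m => cim2 (u m)) n /\
  cim3 (sum_n (u : nat -> quat) n) = sum_n (fun m => cim3 (u m)) n.
Proof.
induction n as [|n (IH0 & IH1 & IH2 & IH3)]; [now rewrite !sum_O|].
rewrite !(sum_Sn (fun m => _ (u m))), <- IH0, <- IH1, <- IH2, <- IH3.
rewrite (sum_Sn u n); now repeat split.
Qed.

Lemma is_series_components (u : nat -> quat) l : is_series (u : nat -> quat) l <->
  is_series (fun m => cre (u m)) (cre l) /\ is_series (fun m => cim1 (u m)) (cim1 l) /\
  is_series (fun m => cim2 (u m)) (cim2 l) /\ is_series (fun m => cim3 (u m)) (cim3 l).
Proof.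
assert (R : forall (v : nat -> R) (x : R), is_series v x <->
   is_lim_seq (fun n => Rabs (sum_n v n - x)) 0).
{ intros v x; split; intros H.
  - apply (proj1 (is_lim_seq_abs_0 _)).
    replace (Finite 0) with (Finite (x - x)) by (f_equal; ring).
    apply is_lim_seq_minus'; [exact H | apply is_lim_seq_const].
  - apply (proj2 (is_lim_seq_abs_0 _)) in H.
    change (is_lim_seq (sum_n v) x).
    apply is_lim_seq_ext with (fun n => (sum_n v n - x) + x); [intros; ring|].
    replace (Finite x) with (Finite (0 + x)) by (f_equal; ring).
    apply is_lim_seq_plus'; [exact H | apply is_lim_seq_const]. }
rewrite is_series_tends, !R; split.
- intros H; repeat split; (eapply is_lim_seq_0_le; [|exact H]); intros n; (split; [apply Rabs_pos|]);
    destruct (sum_components u n) as (E0 & E1 & E2 & E3);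
    destruct (components_le_qnorm (sum_n (u : nat -> quat) n - l)) as (B0 & B1 & B2 & B3);
    [rewrite <- E0 | rewrite <- E1 | rewrite <- E2 | rewrite <- E3]; assumption.
- intros (H0 & H1 & H2 & H3); eapply tends_squeeze.
  + intros n; eapply Rle_trans; [apply qnorm_le_components|].
    destruct (sum_components u n) as (E0 & E1 & E2 & E3).
    rewrite cre_add, cim1_add, cim2_add, cim3_add, cre_opp, cim1_opp, cim2_opp, cim3_opp.
    rewrite E0, E1, E2, E3; apply Rle_refl.
  + replace (Finite 0) with (Finite (0 + 0 + 0 + 0)) by (f_equal; ring).
    repeat apply is_lim_seq_plus'; assumption.
Qed.

(** The coefficients grow slower than any exponential, which is the condition
    for convergence on the whole unit ball. *)
Definition tame (a : nat -> quat) : Prop :=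
  forall rho, 0 < rho < 1 -> exists C, forall m, qnorm (a m) * rho ^ m <= C.

Definition psum (a : nat -> quat) (q : quat) (n : nat) : quat :=
  sum_n (fun m => (qpow q m * a m)%quat : quat) n.

Lemma tame_geometric a r : tame a -> 0 <= r < 1 ->
  exists C t, 0 <= C /\ 0 <= t < 1 /\ forall m, qnorm (a m) * r ^ m <= C * t ^ m.
Proof.
intros Ha Hr; destruct (Ha ((1 + r) / 2) ltac:(lra)) as [C HC].
exists C, (r / ((1 + r) / 2)); split; [|split].
- specialize (HC O); simpl in HC; assert (H := qnorm_ge0 (a O)); lra.
- split; [apply Rmult_le_pos; [lra | apply Rlt_le, Rinv_0_lt_compat; lra]|].
  apply Rmult_lt_reg_r with ((1 + r) / 2); [lra|]; field_simplify; lra.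
- intros m; specialize (HC m).
  assert (0 < ((1 + r) / 2) ^ m) by (apply pow_lt; lra).
  assert (0 <= r ^ m) by (apply pow_le; lra).
  unfold Rdiv at 1; rewrite Rpow_mult_distr, pow_inv.
  apply Rmult_le_reg_r with (((1 + r) / 2) ^ m); [auto|].
  replace (C * (r ^ m * / ((1 + r) / 2) ^ m) * ((1 + r) / 2) ^ m) with (C * r ^ m) by (field; lra).
  replace (qnorm (a m) * r ^ m * ((1 + r) / 2) ^ m) with (qnorm (a m) * ((1 + r) / 2) ^ m * r ^ m) by ring.
  now apply Rmult_le_compat_r.
Qed.

Lemma power_series_correct a q : tame a -> in_ball q ->
  is_series (fun m => (qpow q m * a m)%quat : quat) (power_series a q).
Proof.
intros Ha Hq.
destruct (tame_geometric a (qnorm q) Ha) as (C & t & HC & Ht & H); [split; [apply qnorm_ge0 | exact Hq]|].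
assert (E : ex_series (fun m => C * t ^ m)).
{ apply (ex_series_scal C (fun m => t ^ m)), ex_series_geom; rewrite Rabs_pos_eq; lra. }
assert (B : forall m, qnorm (qpow q m * a m) <= C * t ^ m).
{ intros m; rewrite qnormM, qnorm_pow, Rmult_comm; apply H. }
assert (S : forall v : nat -> R, (forall m, Rabs (v m) <= qnorm (qpow q m * a m)) ->
  is_series v (Series v)).
{ intros v Hv; apply Series_correct, (ex_series_le v (fun m => C * t ^ m)); [|exact E].
  intros m; eapply Rle_trans; [apply Hv | apply B]. }
apply is_series_components; repeat split; apply S; intros m; apply components_le_qnorm.
Qed.

Lemma power_series_unique a q l :
  is_series (fun m => (qpow q m * a m)%quat : quat) l -> power_series a q = l.
Proof.
rewrite is_series_components; intros (H0 & H1 & H2 & H3); apply quat_ext; now apply is_series_unique.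
Qed.

Lemma psum_tends a q : tame a -> in_ball q -> tends (psum a q) (power_series a q).
Proof. intros Ha Hq; apply is_series_tends; now apply power_series_correct. Qed.

Lemma power_series_tends a q l : tends (psum a q) l -> power_series a q = l.
Proof. intros H; apply power_series_unique, is_series_tends; exact H. Qed.

Lemma psum_0 a q : psum a q 0 = a O.
Proof. unfold psum; rewrite (qsum_0 (fun m => qpow q m * a m)%quat); apply qmul1l. Qed.

Lemma psum_S a q n : psum a q (S n) = (psum a q n + qpow q (S n) * a (S n))%quat.
Proof. exact (qsum_S (fun m => qpow q m * a m)%quat n). Qed.

Lemma psum_Sl a q n : psum a q (S n) = (a O + q * psum (tail a) q n)%quat.
Proof.
induction n as [|n IH].
- rewrite psum_S, !psum_0; simpl; unfold tail; qring.
- rewrite psum_S, IH, psum_S, qmulDr, qaddA; f_equal.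
  symmetry; apply qmulA.
Qed.

Lemma psum_add x y q n : psum (x +: y) q n = (psum x q n + psum y q n)%quat.
Proof.
induction n as [|n IH]; [now rewrite !psum_0|].
rewrite !psum_S, IH; unfold sadd; qring.
Qed.

Lemma psum_rscale x c q n : psum (rscale x c) q n = (psum x q n * c)%quat.
Proof.
induction n as [|n IH]; [now rewrite !psum_0|].
rewrite !psum_S, IH; unfold rscale; qring.
Qed.

Lemma psum_remainder a q C t l : 0 <= C -> 0 <= t < 1 ->
  (forall m, qnorm (a m) * qnorm q ^ m <= C * t ^ m) ->
  tends (psum a q) l -> forall n, qnorm (l - psum a q n) <= C / (1 - t) * t ^ n.
Proof.
intros HC Ht H Hl n.
assert (B : forall k, qnorm (psum a q (n + k) - psum a q n) <= C / (1 - t) * (t ^ n - t ^ (n + k))).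
{ induction k as [|k IH].
  - rewrite Nat.add_0_r, qaddN, qnorm_real, Rabs_R0; lra.
  - rewrite Nat.add_succ_r, psum_S.
    replace (psum a q (n + k) + qpow q (S (n + k)) * a (S (n + k)) - psum a q n)%quat
      with ((psum a q (n + k) - psum a q n) + qpow q (S (n + k)) * a (S (n + k)))%quat by qring.
    eapply Rle_trans; [apply qnorm_triangle|].
    rewrite qnormM, qnorm_pow, (Rmult_comm (qnorm q ^ _)).
    assert (H1 := H (S (n + k))).
    assert (0 <= t ^ (n + k)) by (apply pow_le; lra).
    replace (C / (1 - t) * (t ^ n - t ^ S (n + k))) with
      (C / (1 - t) * (t ^ n - t ^ (n + k)) + C * t ^ (n + k)) by (simpl; field; lra).
    assert (C * t ^ S (n + k) <= C * t ^ (n + k)) by (apply Rmult_le_compat_l; [auto | simpl; nra]).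
    lra. }
assert (L : tends (fun k => psum a q (n + k) - psum a q n)%quat (l - psum a q n)%quat).
{ apply tends_add; [|apply tends_const].
  apply (is_lim_seq_incr_n (fun k => qnorm (psum a q k - l)) n 0) in Hl.
  revert Hl; apply is_lim_seq_ext; intros k; now rewrite Nat.add_comm. }
apply tends_le with (2 := L); intros k; eapply Rle_trans; [apply B|].
apply Rmult_le_compat_l.
- apply Rmult_le_pos; [auto | apply Rlt_le, Rinv_0_lt_compat; lra].
- assert (0 <= t ^ (n + k)) by (apply pow_le; lra); lra.
Qed.

Lemma linear_times_geom_le t n : 0 <= t < 1 -> INR (S n) * t ^ n * (1 - t) <= 1 - t ^ S n.
Proof.
intros Ht; induction n as [|n IH]; [simpl; lra|].
assert (0 <= t ^ S n <= 1) by (split; [apply pow_le; lra | rewrite <- (pow1 (S n)); apply pow_incr; lra]).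
rewrite S_INR; change (t ^ S (S n)) with (t * t ^ S n).
replace ((INR (S n) + 1) * t ^ S n * (1 - t)) with
  (t * (INR (S n) * t ^ n * (1 - t)) + t ^ S n * (1 - t)) by (simpl; ring).
nra.
Qed.

Lemma linear_times_geom t : 0 <= t < 1 ->
  exists K s, 0 <= K /\ 0 <= s < 1 /\ forall n, INR (S n) * t ^ n <= K * s ^ n.
Proof.
intros Ht; set (s := (1 + t) / 2); set (w := t / s).
assert (Hs : 0 < s < 1) by (unfold s; lra).
assert (Hw : 0 <= w < 1).
{ unfold w; split; [apply Rmult_le_pos; [lra | apply Rlt_le, Rinv_0_lt_compat; lra]|].
  apply Rmult_lt_reg_r with s; [lra|]; unfold Rdiv; rewrite Rmult_assoc, Rinv_l; unfold s; lra. }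
exists (/ (1 - w)), s; repeat split; try lra.
- apply Rlt_le, Rinv_0_lt_compat; lra.
- intros n; replace t with (w * s) by (unfold w; field; lra).
  rewrite Rpow_mult_distr, <- Rmult_assoc; apply Rmult_le_compat_r; [apply pow_le; lra|].
  assert (H := linear_times_geom_le w n Hw).
  assert (0 <= w ^ S n) by (apply pow_le; lra).
  apply Rmult_le_reg_r with (1 - w); [lra|]; rewrite Rinv_l by lra; lra.
Qed.

Lemma is_lim_seq_scal_geom C t : 0 <= t < 1 -> is_lim_seq (fun n => C * t ^ n) 0.
Proof.
intros Ht; replace (Finite 0) with (Finite (C * 0)) by (f_equal; ring).
apply (is_lim_seq_scal_l _ C 0), is_lim_seq_geom; rewrite Rabs_pos_eq; lra.
Qed.

(** Evaluation is not multiplicative: multiplying [v] on the left by a power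
    of the variable has to bypass the value of [u]. *)
Lemma power_series_qconv_lscale u v q : tame u -> tame v -> in_ball q ->
  tends (psum (u ** v) q) (power_series (lscale (power_series u q) v) q).
Proof.
intros Hu Hv Hq; set (w := power_series u q).
assert (Hr : 0 <= qnorm q < 1) by (split; [apply qnorm_ge0 | exact Hq]).
destruct (tame_geometric u (qnorm q) Hu Hr) as (C & t & HC & Ht & Bu).
destruct (tame_geometric v (qnorm q) Hv Hr) as (C' & t' & HC' & Ht' & Bv).
set (s := Rmax t t'); assert (Hs : 0 <= s < 1).
{ unfold s; split; [apply Rle_trans with t; [lra | apply Rmax_l] | apply Rmax_lub_lt; lra]. }
assert (mono : forall x n, 0 <= x <= s -> x ^ n <= s ^ n) by (intros; apply pow_incr; lra).
assert (Bu' := psum_remainder u q C t w HC Ht Bu (psum_tends u q Hu Hq)).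
set (D := C / (1 - t)); assert (HD : 0 <= D).
{ apply Rmult_le_pos; [auto | apply Rlt_le, Rinv_0_lt_compat; lra]. }
(* The error after n terms is a convolution of the tails of u with v. *)
assert (main : forall n K E z, 0 <= K -> 0 <= E -> (forall l, K * (qnorm (z l) * qnorm q ^ l) <= E * s ^ l) ->
   K * qnorm (psum (lscale w z) q n - psum (u ** z) q n) <= INR (S n) * (D * E * s ^ n)).
{ assert (split_r : forall z, u ** z = rscale u (z O) +: shift (u ** tail z)).
  { intros z; rewrite <- qconv_cst, <- qconv_shift, <- qconvDr; f_equal.
    apply sext; intros [|m]; unfold sadd; simpl; unfold tail; [now rewrite qadd0r | now rewrite qadd0l]. }
  induction n as [|n IH]; intros K E z HK HE Hz.
  - rewrite !psum_0, qconv_0; unfold lscale.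
    replace (w * z O - u O * z O)%quat with ((w - u O) * z O)%quat by qring.
    rewrite qnormM; specialize (Hz O); specialize (Bu' O); rewrite psum_0 in Bu'.
    simpl in *; assert (H1 := qnorm_ge0 (z O)); assert (H2 := qnorm_ge0 (w - u O)).
    fold D in Bu'; replace (K * (qnorm (w - u O) * qnorm (z O))) with (qnorm (w - u O) * (K * qnorm (z O))) by ring.
    apply Rle_trans with (D * (K * qnorm (z O))); [apply Rmult_le_compat_r; nra | nra].
  - rewrite split_r, psum_add, psum_rscale, psum_Sl, (psum_Sl (shift _)), tail_shift.
    change (lscale w z O) with (w * z O)%quat; change (tail (lscale w z)) with (lscale w (tail z)); cbn [shift].
    replace (w * z O + q * psum (lscale w (tail z)) q n -
      (psum u q (S n) * z O + (qreal 0 + q * psum (u ** tail z) q n)))%quat with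
      ((w - psum u q (S n)) * z O + q * (psum (lscale w (tail z)) q n - psum (u ** tail z) q n))%quat by qring.
    eapply Rle_trans; [apply Rmult_le_compat_l, qnorm_triangle; auto|].
    rewrite !qnormM, Rmult_plus_distr_l.
    assert (I1 : K * (qnorm (w - psum u q (S n)) * qnorm (z O)) <= D * E * s ^ S n).
    { specialize (Hz O); specialize (Bu' (S n)); fold D in Bu'; simpl (_ ^ 0) in Hz.
      assert (H1 := qnorm_ge0 (z O)); assert (M := mono t (S n)).
      assert (t ^ S n <= s ^ S n) by (apply M; split; [lra | apply Rmax_l]).
      replace (K * (qnorm (w - psum u q (S n)) * qnorm (z O))) with
        (qnorm (w - psum u q (S n)) * (K * qnorm (z O))) by ring.
      apply Rle_trans with ((D * s ^ S n) * (K * qnorm (z O))).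
      - apply Rmult_le_compat_r; [nra|]; eapply Rle_trans; [apply Bu'|]; now apply Rmult_le_compat_l.
      - replace (D * E * s ^ S n) with ((D * s ^ S n) * E) by ring; apply Rmult_le_compat_l; [|lra].
        apply Rmult_le_pos; [auto | apply pow_le; lra]. }
    assert (I2 : K * (qnorm q * qnorm (psum (lscale w (tail z)) q n - psum (u ** tail z) q n)) <=
       INR (S n) * (D * (E * s) * s ^ n)).
    { rewrite <- Rmult_assoc; apply IH; [nra | nra |].
      intros l; specialize (Hz (S l)); unfold tail; simpl in Hz |- *.
      replace (K * qnorm q * (qnorm (z (S l)) * qnorm q ^ l)) with
        (K * (qnorm (z (S l)) * (qnorm q * qnorm q ^ l))) by ring.
      eapply Rle_trans; [exact Hz|]; right; ring. }
    rewrite S_INR.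
    replace ((INR (S n) + 1) * (D * E * s ^ S n)) with
      (D * E * s ^ S n + INR (S n) * (D * (E * s) * s ^ n)) by (simpl; ring).
    lra. }
assert (Hw : tame (lscale w v)).
{ intros rho Hrho; destruct (Hv rho Hrho) as [B HB]; exists (qnorm w * B); intros m.
  unfold lscale; rewrite qnormM, Rmult_assoc; apply Rmult_le_compat_l; [apply qnorm_ge0 | apply HB]. }
destruct (linear_times_geom s Hs) as (K & sg & HK & Hsg & BK).
assert (T := psum_tends (lscale w v) q Hw Hq).
assert (Z : is_lim_seq (fun n => qnorm (psum (u ** v) q n - psum (lscale w v) q n)) 0).
{ apply is_lim_seq_0_le with (fun n => (D * C' * K) * sg ^ n); [|now apply is_lim_seq_scal_geom].
  intros n; split; [apply qnorm_ge0|]; rewrite qnorm_sub_sym.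
  rewrite <- (Rmult_1_l (qnorm _)); eapply Rle_trans.
  - apply (main n 1 C' v); [lra | auto |]; intros l; rewrite Rmult_1_l.
    eapply Rle_trans; [apply Bv|]; apply Rmult_le_compat_l; auto; apply mono; split; [lra | apply Rmax_r].
  - specialize (BK n); replace (INR (S n) * (D * C' * s ^ n)) with ((D * C') * (INR (S n) * s ^ n)) by ring.
    replace (D * C' * K * sg ^ n) with (D * C' * (K * sg ^ n)) by ring.
    apply Rmult_le_compat_l; [apply Rmult_le_pos|]; auto. }
apply tends_squeeze with
  (fun n => qnorm (psum (u ** v) q n - psum (lscale w v) q n) +
            qnorm (psum (lscale w v) q n - power_series (lscale w v) q)).
- intros n; replace (psum (u ** v) q n - power_series (lscale w v) q)%quat with
    ((psum (u ** v) q n - psum (lscale w v) q n) + (psum (lscale w v) q n - power_series (lscale w v) q))%quat by qring.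
  apply qnorm_triangle.
- replace (Finite 0) with (Finite (0 + 0)) by (f_equal; ring); now apply is_lim_seq_plus'.
Qed.

Lemma in_ball_conjugate w q : w <> qreal 0 -> in_ball q -> in_ball (qinv w * q * w).
Proof. intros Hw; unfold in_ball; rewrite !qnorm_lt1, nsq_conjugate; auto. Qed.

Lemma power_series_cst0 q : power_series (cst (qreal 0)) q = qreal 0.
Proof.
apply power_series_tends, tends_ext with (fun _ => qreal 0); [|apply tends_const].
intros n; induction n as [|n IH]; [now rewrite psum_0|].
rewrite psum_S, <- IH; simpl; qring.
Qed.

Lemma power_series_qconv u v q : tame u -> tame v -> in_ball q ->
  power_series (u ** v) q =
  (power_series u q * power_series v (qinv (power_series u q) * q * power_series u q))%quat.
Proof.
intros Hu Hv Hq; set (w := power_series u q).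
assert (H := power_series_tends _ _ _ (power_series_qconv_lscale u v q Hu Hv Hq)); fold w in H.
rewrite H; destruct (classic (w = qreal 0)) as [E|E].
- rewrite E, qmul0l; transitivity (power_series (cst (qreal 0)) q); [|apply power_series_cst0].
  f_equal; apply sext; intros m; unfold lscale.
  rewrite qmul0l; now destruct m.
- apply power_series_tends.
  eapply tends_ext; [|apply tends_mul_l, (psum_tends v _ Hv (in_ball_conjugate w q E Hq))].
  intros n; cbn beta; induction n as [|n IH]; [now rewrite !psum_0|].
  rewrite !psum_S, <- IH, qmulDr; f_equal; unfold lscale.
  now rewrite !qmulA, qpow_conjugate.
Qed.

Lemma in_ball_real x : -1 < x < 1 -> in_ball (qreal x).
Proof. intros H; unfold in_ball; rewrite qnorm_real; apply Rabs_def1; lra. Qed.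

Lemma power_series_qconv_real u v x : tame u -> tame v -> -1 < x < 1 ->
  power_series (u ** v) (qreal x) = (power_series u (qreal x) * power_series v (qreal x))%quat.
Proof.
intros Hu Hv Hx; rewrite power_series_qconv by (auto; now apply in_ball_real).
set (w := power_series u (qreal x)); destruct (classic (w = qreal 0)) as [E|E].
- now rewrite E, !qmul0l.
- now rewrite <- qmulA, qreal_comm, qmulA, qmulVl, qmul1l.
Qed.

Lemma tame_qconv u v : tame u -> tame v -> tame (u ** v).
Proof.
intros Hu Hv rho Hrho.
destruct (tame_geometric u rho Hu ltac:(lra)) as (C & t & HC & Ht & Bu).
destruct (tame_geometric v rho Hv ltac:(lra)) as (C' & t' & HC' & Ht' & Bv).
set (s := Rmax t t'); assert (Hs : 0 <= s < 1).
{ unfold s; split; [apply Rle_trans with t; [lra | apply Rmax_l] | apply Rmax_lub_lt; lra]. }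
assert (main : forall n E z, 0 <= E -> (forall l, qnorm (z l) * rho ^ l <= E * s ^ l) ->
  qnorm ((z ** v) n) * rho ^ n <= INR (S n) * (E * C' * s ^ n)).
{ assert (Bv' : forall l, qnorm (v l) * rho ^ l <= C' * s ^ l).
  { intros l; eapply Rle_trans; [apply Bv|]; apply Rmult_le_compat_l; auto.
    apply pow_incr; split; [lra | apply Rmax_r]. }
  induction n as [|n IH]; intros E z HE Hz.
  - rewrite qconv_0, qnormM; specialize (Hz O); specialize (Bv' O); simpl in *.
    assert (H1 := qnorm_ge0 (z O)); assert (H2 := qnorm_ge0 (v O)); nra.
  - rewrite qconv_S.
    apply Rle_trans with ((qnorm (z O) * qnorm (v (S n)) + qnorm ((tail z ** v) n)) * rho ^ S n).
    { apply Rmult_le_compat_r; [apply pow_le; lra|]; rewrite <- qnormM; apply qnorm_triangle. }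
    rewrite Rmult_plus_distr_r, S_INR.
    assert (I1 : qnorm (z O) * qnorm (v (S n)) * rho ^ S n <= E * C' * s ^ S n).
    { rewrite !Rmult_assoc; specialize (Hz O); simpl in Hz; apply Rmult_le_compat; try lra.
      - apply qnorm_ge0.
      - apply Rmult_le_pos; [apply qnorm_ge0 | apply pow_le; lra].
      - apply Bv'. }
    assert (I2 : qnorm ((tail z ** v) n) * rho ^ S n <= INR (S n) * (E * C' * s ^ S n)).
    { assert (H : forall l, qnorm (qreal rho * tail z l) * rho ^ l <= E * s * s ^ l).
      { intros l; rewrite qnormM, qnorm_real, Rabs_pos_eq by lra; specialize (Hz (S l)).
        unfold tail; simpl in Hz; nra. }
      specialize (IH (E * s) (lscale (qreal rho) (tail z)) ltac:(nra) H).
      rewrite lscale_qconv in IH; unfold lscale in IH; rewrite qnormM, qnorm_real, Rabs_pos_eq in IH by lra.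
      rewrite <- !tech_pow_Rmult; eapply Rle_trans; [|eapply Rle_trans; [exact IH|]]; right; ring. }
    lra. }
destruct (linear_times_geom s Hs) as (K & sg & HK & Hsg & BK).
exists (C * C' * K); intros m; eapply Rle_trans.
- apply (main m C u HC); intros l; eapply Rle_trans; [apply Bu|]; apply Rmult_le_compat_l; auto.
  apply pow_incr; split; [lra | apply Rmax_l].
- specialize (BK m); replace (INR (S m) * (C * C' * s ^ m)) with (C * C' * (INR (S m) * s ^ m)) by ring.
  apply Rmult_le_compat_l; [nra|].
  assert (sg ^ m <= 1) by (rewrite <- (pow1 m); apply pow_incr; lra); nra.
Qed.

Lemma tame_bounded a C : (forall m, qnorm (a m) <= C) -> tame a.
Proof.
intros H rho Hrho; exists C; intros m; assert (H1 := H m); assert (H2 := qnorm_ge0 (a m)).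
assert (0 <= rho ^ m <= 1) by (split; [apply pow_le; lra | rewrite <- (pow1 m); apply pow_incr; lra]).
nra.
Qed.

Lemma tame_add u v : tame u -> tame v -> tame (u +: v).
Proof.
intros Hu Hv rho Hrho; destruct (Hu rho Hrho) as [C HC]; destruct (Hv rho Hrho) as [C' HC'].
exists (C + C'); intros m; specialize (HC m); specialize (HC' m).
assert (H := qnorm_triangle (u m) (v m)); unfold sadd.
assert (0 <= rho ^ m) by (apply pow_le; lra); nra.
Qed.

Lemma tame_cst c : tame (cst c).
Proof.
apply tame_bounded with (qnorm c); intros [|m]; simpl; [lra|].
rewrite qnorm_real, Rabs_R0; apply qnorm_ge0.
Qed.

Lemma tame_shift a : tame a -> tame (shift a).
Proof.
intros H; replace (shift a) with (shift (cst (qreal 1)) ** a) by (now rewrite shift_qconv, cst1_qconv).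
apply tame_qconv; auto; apply tame_bounded with 1; intros [|[|m]]; simpl; rewrite qnorm_real;
 rewrite ?Rabs_R0, ?Rabs_R1; lra.
Qed.

Lemma tame_lin c d : tame (lin c d).
Proof. apply tame_add; [|apply tame_shift]; apply tame_cst. Qed.

Lemma tame_rscale a c : tame a -> tame (rscale a c).
Proof. intros H; rewrite <- qconv_cst; apply tame_qconv; auto; apply tame_cst. Qed.

Lemma tame_lscale a c : tame a -> tame (lscale c a).
Proof. intros H; rewrite <- cst_qconv; apply tame_qconv; auto; apply tame_cst. Qed.

Lemma tame_sconj a : tame a -> tame (sconj a).
Proof.
intros H rho Hr; destruct (H rho Hr) as [C HC]; exists C; intros m; unfold sconj; now rewrite qnorm_conj.
Qed.

Lemma tame_geom w : in_ball w -> tame (geom w).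
Proof.
intros H; apply tame_bounded with 1; intros m; unfold geom; rewrite qnorm_pow, <- (pow1 m).
apply pow_incr; split; [apply qnorm_ge0 | unfold in_ball in H; lra].
Qed.

Lemma tame_tail a : tame a -> tame (tail a).
Proof.
intros H rho Hr; destruct (H rho Hr) as [C HC]; exists (C / rho); intros m; specialize (HC (S m)).
unfold tail; apply Rmult_le_reg_r with rho; [lra|]; unfold Rdiv; rewrite (Rmult_assoc C), Rinv_l by lra.
simpl in HC; lra.
Qed.

Lemma power_series_add u v q : tame u -> tame v -> in_ball q ->
  power_series (u +: v) q = (power_series u q + power_series v q)%quat.
Proof.
intros Hu Hv Hq; apply power_series_tends.
eapply tends_ext; [|apply tends_add; [apply (psum_tends u q) | apply (psum_tends v q)]]; auto.
intros n; symmetry; apply psum_add.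
Qed.

Lemma power_series_rscale u c q : tame u -> in_ball q ->
  power_series (rscale u c) q = (power_series u q * c)%quat.
Proof.
intros Hu Hq; apply power_series_tends.
eapply tends_ext; [|apply tends_mul_r, (psum_tends u q)]; auto.
intros n; symmetry; apply psum_rscale.
Qed.

Lemma power_series_cst c q : power_series (cst c) q = c.
Proof.
apply power_series_tends, tends_ext with (fun _ => c); [|apply tends_const].
intros n; induction n as [|n IH]; [now rewrite psum_0|].
rewrite psum_S, <- IH; simpl; qring.
Qed.

Lemma power_series_shift u q : tame u -> in_ball q ->
  power_series (shift u) q = (q * power_series u q)%quat.
Proof.
intros Hu Hq; apply power_series_tends, tends_of_incr.
eapply tends_ext; [|apply tends_mul_l, (psum_tends u q)]; auto.
intros n; rewrite psum_Sl, tail_shift; simpl; now rewrite qadd0l.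
Qed.

Lemma power_series_lin c d q : in_ball q -> power_series (lin c d) q = (c + q * d)%quat.
Proof.
intros Hq; unfold lin; rewrite power_series_add, power_series_shift, !power_series_cst; auto;
 try apply tame_shift; apply tame_cst.
Qed.

Lemma power_series_split u q : tame u -> in_ball q ->
  power_series u q = (u O + q * power_series (tail u) q)%quat.
Proof.
intros Hu Hq; apply power_series_tends, tends_of_incr.
eapply tends_ext; [|apply tends_add; [apply tends_const | apply tends_mul_l, (psum_tends (tail u) q)]]; auto.
- intros n; cbn beta; now rewrite psum_Sl.
- now apply tame_tail.
Qed.

Lemma power_series_at_0 u : power_series u (qreal 0) = u O.
Proof.
apply power_series_tends, tends_ext with (fun _ => u O); [|apply tends_const].
intros [|n]; [now rewrite psum_0 | rewrite psum_Sl; qring].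
Qed.

Lemma psum_real_bounded a x l : 0 <= x -> tends (psum a (qreal x)) l ->
  exists C, forall m, qnorm (a m) * x ^ m <= C.
Proof.
intros Hx H.
assert (D : is_lim_seq (fun n => qnorm (psum a (qreal x) (S n) - psum a (qreal x) n)) 0).
{ apply is_lim_seq_0_le with (fun n => qnorm (psum a (qreal x) (S n) - l) +
    qnorm (psum a (qreal x) n - l)).
  - intros n; split; [apply qnorm_ge0|]; rewrite (qnorm_sub_sym (psum a (qreal x) n)).
    replace (psum a (qreal x) (S n) - psum a (qreal x) n)%quat with
     ((psum a (qreal x) (S n) - l) + (l - psum a (qreal x) n))%quat by qring.
    apply qnorm_triangle.
  - replace (Finite 0) with (Finite (0 + 0)) by (f_equal; ring); apply is_lim_seq_plus'; [|exact H].
    now apply tends_incr. }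
assert (ex_finite_lim_seq (fun n => qnorm (psum a (qreal x) (S n) - psum a (qreal x) n))) as F
  by (exists 0; exact D).
destruct (filterlim_bounded _ F) as [M HM].
exists (Rmax M (qnorm (a O))); intros [|m].
- simpl; rewrite Rmult_1_r; apply Rmax_r.
- eapply Rle_trans; [|apply Rmax_l]; specialize (HM m).
  apply (Rle_trans _ _ _ (Rle_abs _)) in HM; rewrite psum_S in HM.
  replace (psum a (qreal x) m + qpow (qreal x) (S m) * a (S m) - psum a (qreal x) m)%quat
    with (qpow (qreal x) (S m) * a (S m))%quat in HM by qring.
  rewrite qnormM, qnorm_pow, qnorm_real, Rabs_pos_eq in HM by lra; lra.
Qed.

Lemma series_inj_local a b r : 0 < r ->
  (forall x, - r < x < r -> exists l, tends (psum a (qreal x)) l /\ tends (psum b (qreal x)) l) ->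
  a = b.
Proof.
intros Hr H.
assert (rad : forall (c : quat -> R) u, (forall q, Rabs (c q) <= qnorm q) ->
  (exists C, forall m, qnorm (u m) * (r / 2) ^ m <= C) -> Rbar_lt 0 (CV_radius (fun m => c (u m)))).
{ intros c u Bc [C HC]; apply Rbar_lt_le_trans with (r / 2); [simpl; lra|].
  apply CV_radius_bounded; exists C; intros n.
  assert (0 <= (r / 2) ^ n) by (apply pow_le; lra).
  rewrite Rabs_mult, (Rabs_pos_eq ((r / 2) ^ n)) by auto.
  eapply Rle_trans; [|apply HC]; now apply Rmult_le_compat_r. }
assert (main : forall c : quat -> R, (forall x q, c (qreal x * q)%quat = c q * x) ->
  (forall q, Rabs (c q) <= qnorm q) ->
  (forall u x l, tends (psum u (qreal x)) l ->
     Series (fun m => c (qpow (qreal x) m * u m)%quat) = c l) ->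
  forall m, c (a m) = c (b m)).
{ intros c Hc Bc Hl m.
  destruct (H (r / 2) ltac:(lra)) as (l & La & Lb).
  apply (PSeries_ext_recip (fun m => c (a m)) (fun m => c (b m)) m).
  - apply rad; auto; apply (psum_real_bounded a (r / 2) l); auto; lra.
  - apply rad; auto; apply (psum_real_bounded b (r / 2) l); auto; lra.
  - exists (mkposreal r Hr); intros x Hx.
    unfold ball in Hx; simpl in Hx; unfold AbsRing_ball, minus, plus, opp, abs in Hx; simpl in Hx.
    rewrite Ropp_0, Rplus_0_r in Hx; apply Rabs_def2 in Hx.
    destruct (H x ltac:(lra)) as (lx & Lax & Lbx).
    assert (E : forall u, PSeries (fun m => c (u m)) x = Series (fun m => c (qpow (qreal x) m * u m)%quat)).
    { intros u; apply Series_ext; intros k; now rewrite qpow_real, Hc. }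
    rewrite !E, (Hl a x lx), (Hl b x lx); auto. }
assert (comp : forall u x l, tends (psum u (qreal x)) l ->
  power_series u (qreal x) = l) by (intros; now apply power_series_tends).
apply sext; intros m; apply quat_ext; (apply main; [ qrring | intros q; apply components_le_qnorm |
  intros u x l L; rewrite <- (comp u x l L); reflexivity ]).
Qed.

(** A slice regular function is determined by its restriction to the reals. *)
Lemma power_series_inj_real a b : tame a -> tame b ->
  (forall x, -1 < x < 1 -> power_series a (qreal x) = power_series b (qreal x)) -> a = b.
Proof.
intros Ha Hb H; apply (series_inj_local a b 1 Rlt_0_1); intros x Hx.
exists (power_series a (qreal x)); split; [|rewrite H by auto]; apply psum_tends; auto; now apply in_ball_real.
Qed.

Lemma has_expansion_tame f a : has_expansion f a -> tame a.
Proof.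
intros H rho Hrho; apply (psum_real_bounded a rho (f (qreal rho))); [lra|].
apply is_series_tends, H, in_ball_real; lra.
Qed.

Lemma has_expansion_power_series a : tame a -> has_expansion (power_series a) a.
Proof. intros Ha q Hq; now apply power_series_correct. Qed.

Lemma has_expansion_eq f a q : has_expansion f a -> in_ball q -> f q = power_series a q.
Proof. intros H Hq; symmetry; apply power_series_unique, H, Hq. Qed.

Lemma has_expansion_unique f a b : has_expansion f a -> has_expansion f b -> a = b.
Proof.
intros Ha Hb; apply power_series_inj_real; try (eapply has_expansion_tame; eassumption).
intros x Hx; apply in_ball_real in Hx.
now rewrite <- (has_expansion_eq f a), <- (has_expansion_eq f b).
Qed.

Lemma coeffs_expansion f a : has_expansion f a -> coeffs f = a.
Proof.
intros H; apply has_expansion_unique with f; [|exact H].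
unfold coeffs; apply epsilon_spec; now exists a.
Qed.

(** * The Schur class *)

(** The lower triangular Toeplitz matrices of [a] are contractions.  This
    version of [|f| <= 1] passes to products at once. *)
Definition schur (a : nat -> quat) : Prop :=
  forall h n, sqsum (h ** a) n <= sqsum h n.

(** The left factor that realizes the truncated norm of [z] as a coefficient;
    it turns estimates of coefficients into estimates of norms. *)
Lemma norming_series z n : exists h, cre ((h ** z) n) = sqsum z n /\ sqsum h n = sqsum z n.
Proof.
destruct (qconv_rev_conj (sconj z) n) as [E1 E2]; set (k := rev_conj n (sconj z)) in *.
exists (sconj k); rewrite !sqsum_sconj in *; split; [|exact E2].
rewrite <- E1, <- (sconjK (sconj k ** z)), sconj_qconv, sconjK; reflexivity.
Qed.

(** By duality the norm of [a ** h] is a coefficient of [k ** a ** h] for a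
    suitable [k], and there [a] may be taken together with [k]. *)
Lemma schur_left a : schur a -> forall h n, sqsum (a ** h) n <= sqsum h n.
Proof.
intros Ha h n; destruct (norming_series (a ** h) n) as (k & E1 & E2).
rewrite qconvA in E1; assert (H := cre_qconv_le (k ** a) h n).
assert (H1 := Ha k n); lra.
Qed.

Lemma schur_sconj a : schur a -> schur (sconj a).
Proof.
intros Ha h n; rewrite <- sqsum_sconj, sconj_qconv, sconjK, <- (sqsum_sconj h); now apply schur_left.
Qed.

Lemma schur_sqsum a n : schur a -> sqsum a n <= 1.
Proof.
intros Ha; assert (H := Ha (cst (qreal 1)) n).
rewrite cst1_qconv, sqsum_cst, nsq_real in H; lra.
Qed.

Lemma schur_coef a m : schur a -> qnorm (a m) <= 1.
Proof.
intros Ha; apply qnorm_le1; apply Rle_trans with (sqsum a m); [now apply sqsum_term | now apply schur_sqsum].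
Qed.

Lemma schur_tame a : schur a -> tame a.
Proof. intros Ha; apply tame_bounded with 1; intros m; now apply schur_coef. Qed.

Lemma schur_qconv a b : schur a -> schur b -> schur (a ** b).
Proof. intros Ha Hb h n; rewrite qconvA; eapply Rle_trans; [apply Hb | apply Ha]. Qed.

Lemma schur_cst c : nsq c <= 1 -> schur (cst c).
Proof.
intros Hc h n; rewrite qconv_cst, sqsum_rscale; assert (H := sqsum_ge0 h n); nra.
Qed.

(** The norm of [a] is at most one and its first term already exhausts it. *)
Lemma schur_unimodular_const a : schur a -> nsq (a O) = 1 -> a = cst (a O).
Proof.
intros Ha H0; apply sext; intros [|m]; [reflexivity|]; apply nsq_eq0.
assert (H := schur_sqsum a (S m) Ha); rewrite sqsum_Sl in H.
assert (H1 := sqsum_term (tail a) m m (le_n m)); unfold tail at 1 in H1.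
assert (H2 := nsq_ge0 (a (S m))); lra.
Qed.

(** The two factors of the regular Moebius transform of [f] at [a], which is
    the quotient of [mnum] by [mden]. *)
Definition mden (f : nat -> quat) (a : quat) : nat -> quat := cst (qreal 1) +: rscale f (- qconj a)%quat.
Definition mnum (f : nat -> quat) (a : quat) : nat -> quat := f +: cst (- a)%quat.

(** This is [1 - |M_a(w)|^2 = (1 - |a|^2)(1 - |w|^2) / |1 - w conj(a)|^2], with
    values replaced by truncated norms. *)
Lemma moebius_defect f a k n :
  sqsum (k ** mden f a) n - sqsum (k ** mnum f a) n =
  (1 - nsq a) * (sqsum k n - sqsum (k ** f) n).
Proof.
unfold mden, mnum; rewrite !qconvDr, qconv_cst1, qconv_cst.
replace (k ** rscale f (- qconj a)%quat) with (rscale (k ** f) (- qconj a)%quat)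
  by now rewrite <- !qconv_cst, qconvA.
generalize (k ** f); intros y.
assert (E : forall x y, nsq (x + y * - qconj a) - nsq (y + x * - a) = (1 - nsq a) * (nsq x - nsq y))
  by qrring.
induction n as [|n IH]; rewrite ?sqsum_0, ?sqsum_S.
- apply E.
- specialize (E (k (S n)) (y (S n))); unfold sadd, rscale in *; lra.
Qed.

Lemma mden_0_neq0 f a : nsq (f O) <= 1 -> nsq a < 1 -> mden f a O <> qreal 0.
Proof.
intros Hf Ha E; unfold mden, sadd, rscale, cst in E.
assert (E' : (f O * qconj a)%quat = qreal 1).
{ apply qsub_eq0.
  replace (f O * qconj a - qreal 1)%quat with (- (qreal 1 + f O * - qconj a))%quat by qring.
  rewrite E; qring. }
assert (H : nsq (f O) * nsq a = 1) by (rewrite <- (nsq_conj a), <- nsqM, E', nsq_real; ring).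
assert (H1 := nsq_ge0 (f O)); assert (H2 := nsq_ge0 a); nra.
Qed.

(** An equation rather than a quotient, so that no inverse has to be named. *)
Definition is_moebius (f : nat -> quat) (a : quat) (g : nat -> quat) : Prop :=
  mden f a ** g = mnum f a.

(** [moebius_defect] for [k = h ** u] with [u] the inverse of the denominator. *)
Lemma is_moebius_defect f a g u : is_moebius f a g -> u ** mden f a = cst (qreal 1) ->
  forall h n, sqsum h n - sqsum (h ** g) n =
    (1 - nsq a) * (sqsum (h ** u) n - sqsum (h ** u ** f) n).
Proof.
intros Hg Hu h n; rewrite <- moebius_defect, <- qconvA, Hu, qconv_cst1.
now rewrite <- Hg, <- !qconvA, (qconvA u), Hu, cst1_qconv.
Qed.

Lemma moebius_exists f a : schur f -> nsq a < 1 ->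
  exists g, is_moebius f a g /\ schur g.
Proof.
intros Hf Ha.
destruct (inverse_exists (mden f a)) as (u & Hu & Hu').
{ apply mden_0_neq0; auto; apply qnorm_le1, schur_coef, Hf. }
exists (u ** mnum f a); assert (G : is_moebius f a (u ** mnum f a)).
{ unfold is_moebius; now rewrite qconvA, Hu, cst1_qconv. }
split; [exact G|]; intros h n.
assert (H := is_moebius_defect f a _ u G Hu' h n); assert (H1 := Hf (h ** u) n).
assert (H2 : 0 <= (1 - nsq a) * (sqsum (h ** u) n - sqsum (h ** u ** f) n)) by (apply Rmult_le_pos; lra).
lra.
Qed.

Lemma tame_mden f a : tame f -> tame (mden f a).
Proof. intros Hf; apply tame_add; [apply tame_cst | now apply tame_rscale]. Qed.

Lemma tame_mnum f a : tame f -> tame (mnum f a).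
Proof. intros Hf; apply tame_add; [auto | apply tame_cst]. Qed.

Lemma power_series_mden f a q : tame f -> in_ball q ->
  power_series (mden f a) q = (qreal 1 - power_series f q * qconj a)%quat.
Proof.
intros Hf Hq; unfold mden; rewrite power_series_add, power_series_cst, power_series_rscale; auto.
- qring.
- apply tame_cst.
- now apply tame_rscale.
Qed.

Lemma power_series_mnum f a q : tame f -> in_ball q ->
  power_series (mnum f a) q = (power_series f q - a)%quat.
Proof.
intros Hf Hq; unfold mnum; rewrite power_series_add, power_series_cst; auto; apply tame_cst.
Qed.

Lemma moebius_den_neq0 a w : nsq a < 1 -> nsq w <= 1 -> (qreal 1 - w * qconj a)%quat <> qreal 0.
Proof.
intros Ha Hw E; apply qsub_eq0 in E.
assert (H : nsq w * nsq a = 1) by (rewrite <- (nsq_conj a), <- nsqM, <- E, nsq_real; ring).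
assert (H1 := nsq_ge0 w); assert (H2 := nsq_ge0 a); nra.
Qed.

Lemma moebius_mul a w : nsq a < 1 -> nsq w <= 1 ->
  ((qreal 1 - w * qconj a) * moebius a w = w - a)%quat.
Proof. intros; unfold moebius; rewrite qmulA, qmulVr, qmul1l; auto; now apply moebius_den_neq0. Qed.

Lemma moebius_inv a w : nsq a < 1 -> nsq w <= 1 -> moebius (- a)%quat (moebius a w) = w.
Proof.
intros Ha Hw; set (z := moebius a w); assert (Hz := moebius_mul a w Ha Hw); fold z in Hz.
assert (D := moebius_den_neq0 a w Ha Hw).
assert (nz : (qreal 1 - z * qconj (- a))%quat <> qreal 0).
{ intros E; assert (E1 : (z * qconj (- a))%quat = qreal 1) by (symmetry; now apply qsub_eq0).
  assert (E2 : (qreal 1 - w * qconj a = qreal (nsq a) - w * qconj a)%quat).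
  { transitivity ((qreal 1 - w * qconj a) * (z * qconj (- a)))%quat; [now rewrite E1, qmul1r|].
    rewrite qmulA, Hz; qring. }
  apply (f_equal (fun p => cre (p + w * qconj a)%quat)) in E2.
  rewrite !cre_add, !cre_opp in E2; unfold qreal, cre in E2; simpl in E2; lra. }
apply (qmul_cancel_l _ _ _ nz).
unfold moebius at 1; rewrite qmulA, qmulVr, qmul1l by exact nz.
apply (qmul_cancel_l _ _ _ D).
clearbody z; remember (qreal 1 - w * qconj a)%quat as d eqn:Ed.
replace (d * (z - - a))%quat with (d * z + d * a)%quat by qring.
replace (d * ((qreal 1 - z * qconj (- a)) * w))%quat with (d * w + d * z * (qconj a * w))%quat.
2:{ replace (qreal 1 - z * qconj (- a))%quat with (qreal 1 + z * qconj a)%quat by qring.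
  now rewrite qmulDl, qmul1l, qmulDr, !qmulA. }
rewrite Hz, Ed; qring.
Qed.

Lemma moebius_self a : nsq a < 1 -> moebius a a = qreal 0.
Proof. intros Ha; unfold moebius; rewrite qaddN; apply qmul0r. Qed.

(** On the real axis regular operations are pointwise. *)
Lemma is_moebius_real f a g x : schur f -> schur g -> nsq a < 1 -> -1 < x < 1 ->
  nsq (power_series f (qreal x)) <= 1 ->
  is_moebius f a g -> power_series g (qreal x) = moebius a (power_series f (qreal x)).
Proof.
intros Hf Hg Ha Hx Hw H; assert (B := in_ball_real x Hx).
apply schur_tame in Hf; apply schur_tame in Hg.
apply (f_equal (fun u => power_series u (qreal x))) in H.
rewrite power_series_qconv_real, power_series_mden, power_series_mnum in H; auto; [|now apply tame_mden].
apply (qmul_cancel_l _ _ _ (moebius_den_neq0 a _ Ha Hw)); rewrite H; symmetry; now apply moebius_mul.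
Qed.

(** * Boundedness on the ball *)

(** The Schur inequality is tested on the polynomial with coefficients [q^n],
    ..., [q], [1]; its product with [a] has as coefficients the partial sums of
    [a] at [q], multiplied by powers of [q]. *)
Lemma schur_psum_bound a q n l : schur a -> (l <= n)%nat ->
  sum_n (fun k => nsq q ^ k * nsq (psum a q (n - k))) l <= sum_n (fun k => nsq q ^ k) n.
Proof.
intros Ha Hl.
pose (h := fun m => qpow q (n - m)).
assert (E : forall m, (m <= n)%nat -> (h ** a) m = (qpow q (n - m) * psum a q m)%quat).
{ induction m as [|m IH]; intros Hm.
  - now rewrite qconv_0, psum_0.
  - rewrite qconv_Sr.
    assert (T : forall b k, (k <= m)%nat ->
      ((h ** b) k = qpow q (n - S m) * (qpow q (S m - k) * psum b q k))%quat).
    { intros b k; revert b; induction k as [|k IHk]; intros b Hk.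
      - rewrite qconv_0, psum_0, qmulA, <- qpowD; unfold h; do 2 f_equal; lia.
      - rewrite qconv_Sr, IHk by lia; rewrite (psum_Sl b), !qmulDr; unfold h; f_equal.
        + rewrite qmulA, <- qpowD; do 2 f_equal; lia.
        + f_equal; rewrite !qmulA; f_equal.
          replace (S m - k)%nat with (S (S m - S k)) by lia; apply qpow_S_r. }
    rewrite T by lia; rewrite psum_Sl, qmulDr; unfold h; f_equal.
    replace (S m - m)%nat with 1%nat by lia; simpl; now rewrite qmul1r. }
assert (R : forall u : nat -> R, sum_n u n = sum_n (fun k => u (n - k)%nat) n).
{ clear; intros u; revert u; induction n as [|n IH]; intros u; [now rewrite !sum_O|].
  rewrite (sum_Sn (fun k => u (S n - k)%nat)), Nat.sub_diag.
  transitivity (plus (sum_n (fun k => u (S k)) n) (u O)).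
  - clear; induction n as [|n IH]; [rewrite sum_Sn, !sum_O; unfold plus; simpl; ring|].
    rewrite sum_Sn, IH, sum_Sn; unfold plus; simpl; ring.
  - f_equal; rewrite (IH (fun k => u (S k))); apply sum_n_ext_loc; intros k Hk; f_equal; lia. }
assert (S1 : sqsum (h ** a) n = sum_n (fun k => nsq q ^ k * nsq (psum a q (n - k))) n).
{ unfold sqsum; rewrite R; apply sum_n_ext_loc; intros k Hk.
  rewrite E by lia; rewrite nsqM, nsq_pow; do 2 f_equal; lia. }
assert (S2 : sqsum h n = sum_n (fun k => nsq q ^ k) n).
{ unfold sqsum; rewrite R; apply sum_n_ext_loc; intros k Hk; unfold h.
  rewrite nsq_pow; f_equal; lia. }
rewrite <- S2; eapply Rle_trans; [|apply Ha]; rewrite S1.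
set (u := fun k => nsq q ^ k * nsq (psum a q (n - k))).
assert (P : forall k, 0 <= u k) by (intros k; apply Rmult_le_pos; [apply pow_le|]; apply nsq_ge0).
clearbody u; clear - Hl P; induction Hl as [|m Hm IH]; [lra|].
rewrite sum_Sn; eapply Rle_trans; [apply IH|].
specialize (P (S m)); change (sum_n u m <= sum_n u m + u (S m)); lra.
Qed.

Lemma sum_geom x n : 0 <= x < 1 -> sum_n (fun k => x ^ k) n = (1 - x ^ S n) / (1 - x).
Proof.
intros Hx; induction n as [|n IH]; [rewrite sum_O; simpl; field; lra|].
rewrite sum_SnR, IH; simpl; field; lra.
Qed.

Lemma is_lim_seq_plus_0 u v l : is_lim_seq u (Finite l) -> is_lim_seq v 0 ->
  is_lim_seq (fun n => u n + v n) (Finite l).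
Proof.
intros Hu Hv; replace (Finite l) with (Finite (l + 0)) by (f_equal; ring); now apply is_lim_seq_plus'.
Qed.

Lemma is_lim_seq_scal_0 c u : is_lim_seq u 0 -> is_lim_seq (fun n => c * u n) 0.
Proof.
intros Hu; replace (Finite 0) with (Finite (c * 0)) by (f_equal; ring); now apply (is_lim_seq_scal_l u c 0).
Qed.

Lemma tends_nsq u l : tends u l -> is_lim_seq (fun n => nsq (u n)) (nsq l).
Proof.
intros H; apply tends_qnorm in H.
apply is_lim_seq_ext with (fun n => qnorm (u n) * qnorm (u n)).
- intros n; rewrite <- qnorm_sqr; ring.
- replace (nsq l) with (qnorm l * qnorm l) by (rewrite <- qnorm_sqr; ring).
  now apply is_lim_seq_mult'.
Qed.

(** In [schur_psum_bound] first [n] tends to infinity with [l] fixed, then [l]. *)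
Lemma schur_ball a q : schur a -> in_ball q -> nsq (power_series a q) <= 1.
Proof.
intros Ha Hq; set (F := nsq (power_series a q)); set (x := nsq q).
assert (Hx : 0 <= x < 1) by (split; [apply nsq_ge0 | now apply qnorm_lt1]).
assert (L : is_lim_seq (fun n => nsq (psum a q n)) F).
{ apply tends_nsq, psum_tends; auto; now apply schur_tame. }
assert (Ll : forall l, is_lim_seq (fun n => sum_n (fun k => x ^ k * nsq (psum a q (n - k))) l)
  (sum_n (fun k => x ^ k) l * F)).
{ assert (L1 : forall k, is_lim_seq (fun n => x ^ k * nsq (psum a q (n - k))) (x ^ k * F)).
  { intros k; apply (is_lim_seq_scal_l _ (x ^ k) F), (is_lim_seq_incr_n _ k).
    apply is_lim_seq_ext with (2 := L); intros n; do 2 f_equal; lia. }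
  induction l as [|l IH].
  - rewrite sum_O; apply is_lim_seq_ext with (2 := L1 O); intros n; now rewrite sum_O.
  - rewrite sum_SnR, Rmult_plus_distr_r.
    eapply is_lim_seq_ext; [|apply is_lim_seq_plus'; [apply IH | apply (L1 (S l))]].
    intros n; now rewrite sum_SnR. }
assert (B : forall l, (1 - x ^ S l) * F <= 1).
{ intros l; rewrite <- (Rmult_1_r 1); apply Rmult_le_reg_r with (/ (1 - x)).
  { apply Rinv_0_lt_compat; lra. }
  rewrite Rmult_1_r; replace ((1 - x ^ S l) * F * / (1 - x)) with (sum_n (fun k => x ^ k) l * F)
    by (rewrite sum_geom by auto; field; lra).
  assert (E : Hierarchy.eventually (fun n => sum_n (fun k => x ^ k * nsq (psum a q (n - k))) l <= / (1 - x))).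
  { exists l; intros n Hn; eapply Rle_trans; [now apply schur_psum_bound|].
    fold x; rewrite sum_geom by auto; assert (0 <= x ^ S n) by (apply pow_le; lra).
    apply Rmult_le_reg_r with (1 - x); [lra|]; field_simplify; lra. }
  rewrite Rmult_1_l; exact (is_lim_seq_le_loc _ _ _ _ E (Ll l) (is_lim_seq_const _)). }
assert (T : is_lim_seq (fun l => (1 - x ^ S l) * F) F).
{ apply is_lim_seq_ext with (fun l => F + (- (x * F)) * x ^ l).
  - intros l; simpl; ring.
  - apply is_lim_seq_plus_0; [apply is_lim_seq_const | now apply is_lim_seq_scal_geom]. }
exact (is_lim_seq_le _ _ _ _ B T (is_lim_seq_const 1)).
Qed.

Lemma power_series_bound a p c : (forall j, qnorm (a j) <= c) -> in_ball p ->
  qnorm (power_series a p) <= c / (1 - qnorm p).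
Proof.
intros Ha Hp; assert (Hr : 0 <= qnorm p < 1) by (split; [apply qnorm_ge0 | exact Hp]).
assert (Hc : 0 <= c) by (eapply Rle_trans; [apply qnorm_ge0 | apply (Ha O)]).
apply tends_le with (2 := psum_tends a p (tame_bounded a c Ha) Hp); intros n.
apply Rle_trans with (c * sum_n (fun k => qnorm p ^ k) n).
- induction n as [|n IH]; [rewrite psum_0, sum_O; simpl; rewrite Rmult_1_r; apply Ha|].
  rewrite psum_S, sum_SnR.
  eapply Rle_trans; [apply qnorm_triangle|]; rewrite Rmult_plus_distr_l.
  apply Rplus_le_compat; [exact IH|]; rewrite qnormM, qnorm_pow, Rmult_comm.
  apply Rmult_le_compat_r; [apply pow_le; lra | apply Ha].
- apply Rmult_le_compat_l; auto; rewrite sum_geom by auto.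
  assert (0 <= qnorm p ^ S n) by (apply pow_le; lra).
  apply Rmult_le_reg_r with (1 - qnorm p); [lra|]; field_simplify; lra.
Qed.

Lemma sqsum_bounded_cv u C : (forall n, sqsum u n <= C) -> exists l, is_lim_seq (sqsum u) (Finite l).
Proof.
intros H; apply (ex_finite_lim_seq_incr (sqsum u) C); auto.
intros n; apply sqsum_mono; lia.
Qed.

Lemma sqsum_cv_term u l : is_lim_seq (sqsum u) (Finite l) -> is_lim_seq (fun n => nsq (u n)) 0.
Proof.
intros H; apply is_lim_seq_incr_1.
apply is_lim_seq_ext with (fun n => sqsum u (S n) - sqsum u n); [intros n; rewrite sqsum_S; ring|].
replace (Finite 0) with (Finite (l - l)) by (f_equal; ring).
apply is_lim_seq_minus'; [now apply (is_lim_seq_incr_1 (sqsum u)) | exact H].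
Qed.

Lemma is_lim_nsq_0 u : is_lim_seq (fun n => nsq (u n)) 0 <-> tends u (qreal 0).
Proof.
assert (E : forall p, qnorm (p - qreal 0)%quat = qnorm p) by (intros; f_equal; qring).
split; intros H.
- apply is_lim_seq_ext with (fun n => sqrt (nsq (u n))); [intros n; now rewrite E|].
  replace (Finite 0) with (Finite (sqrt 0)) by (f_equal; apply sqrt_0).
  apply is_lim_seq_continuous; [apply continuity_pt_sqrt; lra | exact H].
- apply tends_nsq in H; rewrite nsq_real in H; replace (0 ^ 2) with 0 in H by ring; exact H.
Qed.

Lemma tends_0_conv e h n : tends e (qreal 0) -> (forall m, (n < m)%nat -> h m = qreal 0) ->
  tends (e ** h) (qreal 0).
Proof.
intros He; revert h; induction n as [|n IH]; intros h Hh.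
- replace h with (cst (h O)) by (apply sext; intros [|m]; [easy | symmetry; apply Hh; lia]).
  rewrite qconv_cst, <- (qmul0l (h O)) at 1; now apply tends_mul_r.
- apply tends_of_incr; eapply tends_ext.
  + intros m; symmetry; apply qconv_Sr.
  + replace (qreal 0) with (qreal 0 * h O + qreal 0)%quat at 1 by qring.
    apply tends_add; [apply tends_mul_r, tends_incr, He|].
    apply IH; intros m Hm; apply Hh; lia.
Qed.

Lemma schur_of_left a : (forall h n, sqsum (a ** h) n <= sqsum h n) -> schur a.
Proof.
intros Ha; rewrite <- (sconjK a); apply schur_sconj; intros h n.
rewrite <- sqsum_sconj, sconj_qconv, sconjK, <- (sqsum_sconj h); apply Ha.
Qed.

(** [|1 - x conj(p)|^2 - |x - p|^2 = (1 - |p|^2)(1 - |x|^2)] on the level of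
    truncated norms, where the sum over [1 - |x|^2] telescopes. *)
Lemma blaschke_defect_right p k n :
  sqsum (k ** lin (qreal 1) (- qconj p)%quat) n =
  sqsum (k ** lin (- p)%quat (qreal 1)) n + (1 - nsq p) * nsq (k n).
Proof.
rewrite !qconv_lin; induction n as [|n IH].
- rewrite !sqsum_0; unfold sadd, rscale; cbn [shift]; generalize (k O); qrring.
- rewrite !sqsum_S, IH; unfold sadd, rscale; cbn [shift]; generalize (k n) (k (S n)) (sqsum (rscale k (- p)%quat +: shift (rscale k (qreal 1))) n); qrring.
Qed.

Lemma blaschke_defect_left p k n :
  sqsum (lin (qreal 1) (- qconj p)%quat ** k) n =
  sqsum (lin (- p)%quat (qreal 1) ** k) n + (1 - nsq p) * nsq (k n).
Proof.
assert (E : forall c d, sconj (lin c d) = lin (qconj c) (qconj d)).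
{ intros c d; apply sext; intros [|[|m]]; unfold sconj, lin, sadd; simpl; qring. }
assert (H := blaschke_defect_right (qconj p) (sconj k) n).
rewrite <- (sqsum_sconj (lin _ _ ** k)), <- (sqsum_sconj (lin (- p)%quat _ ** k)), !sconj_qconv, !E.
replace (nsq (k n)) with (nsq (sconj k n)) by apply nsq_conj.
rewrite nsq_conj in H.
replace (qconj (qreal 1)) with (qreal 1) by qring.
replace (qconj (- qconj p)%quat) with (- qconj (qconj p))%quat by qring.
replace (qconj (- p)%quat) with (- qconj p)%quat by qring.
exact H.
Qed.

(** Horner's scheme: the tails of [f], evaluated at [p], satisfy the recursion
    for the quotient, and the remainder is the value of [f].  This formula shows
    that the quotient inherits the decay of the coefficients of [f]. *)
Lemma divide_linear f p : tame f -> in_ball p -> power_series f p = qreal 0 ->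
  exists e, f = lin (- p)%quat (qreal 1) ** e /\
    (forall m, e m = power_series (fun j => f (S m + j)%nat) p).
Proof.
intros Hf Hp H0; exists (fun m => power_series (fun j => f (S m + j)%nat) p); split; [|easy].
assert (Ht : forall m, tame (fun j => f (m + j)%nat)).
{ induction m as [|m IH]; [exact Hf|].
  intros rho Hr; destruct (tame_tail _ IH rho Hr) as [C HC]; exists C; intros j; specialize (HC j).
  unfold tail in HC; now rewrite Nat.add_succ_r in HC. }
assert (R : forall m, power_series (fun j => f (m + j)%nat) p =
   (f m + p * power_series (fun j => f (S m + j)%nat) p)%quat).
{ intros m; rewrite power_series_split by auto; rewrite Nat.add_0_r; do 3 f_equal.
  apply sext; intros j; unfold tail; f_equal; lia. }
rewrite lin_qconv; apply sext; intros [|m]; unfold sadd, lscale; cbn [shift].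
- assert (E := R O); cbn [Nat.add] in E; rewrite (H0 : power_series (fun j => f j) p = qreal 0) in E.
  replace (f O) with (f O + p * power_series (fun j => f (S j)) p +
     - p * power_series (fun j => f (S j)) p)%quat by qring.
  rewrite <- E; simpl; qring.
- rewrite (R (S m)); cbn [Nat.add]; qring.
Qed.

(** The coefficients of [f] tend to zero, being square summable, and [e m] is a
    weighted sum of those from index [m + 1] on. *)
Lemma division_tends_0 f p e : schur f -> in_ball p ->
  (forall m, e m = power_series (fun j => f (S m + j)%nat) p) -> tends e (qreal 0).
Proof.
intros Hf Hp He; assert (Hr : 0 <= qnorm p < 1) by (split; [apply qnorm_ge0 | exact Hp]).
destruct (sqsum_bounded_cv f 1 (fun n => schur_sqsum f n Hf)) as [l Hl].
apply sqsum_cv_term, is_lim_nsq_0, tends_qnorm in Hl.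
rewrite qnorm_real, Rabs_R0 in Hl.
unfold tends; apply is_lim_seq_spec; intros eps; apply is_lim_seq_spec in Hl.
assert (P : 0 < eps * (1 - qnorm p) / 2) by (assert (H := cond_pos eps); nra).
destruct (Hl (mkposreal _ P)) as [N HN]; exists N; intros n Hn; cbn [pos] in HN.
rewrite Rminus_0_r, Rabs_pos_eq by apply qnorm_ge0.
replace (e n - qreal 0)%quat with (e n) by qring; rewrite He.
eapply Rle_lt_trans.
- apply power_series_bound with (c := eps * (1 - qnorm p) / 2); auto; intros j.
  specialize (HN (S n + j)%nat ltac:(lia)); rewrite Rminus_0_r, Rabs_pos_eq in HN by apply qnorm_ge0; lra.
- replace (eps * (1 - qnorm p) / 2 / (1 - qnorm p)) with (eps / 2) by (field; lra).
  assert (H := cond_pos eps); lra.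
Qed.

(** Division by a Blaschke factor stays in the Schur class: in the limit the
    factor does not change norms, and the boundary term of the defect identity
    is a coefficient of a series that tends to zero. *)
Lemma schur_division f p e : schur f -> in_ball p -> tends e (qreal 0) ->
  f = lin (- p)%quat (qreal 1) ** e -> schur (lin (qreal 1) (- qconj p)%quat ** e).
Proof.
intros Hf Hp He Hfe; apply schur_of_left; intros h n.
set (g := lin (qreal 1) (- qconj p)%quat ** e).
pose (h' := fun m => if (m <=? n)%nat then h m else qreal 0).
assert (Hh : forall m, (m <= n)%nat -> h m = h' m).
{ intros m Hm; unfold h'; now apply Nat.leb_le in Hm as ->. }
assert (Hh0 : forall m, (n < m)%nat -> h' m = qreal 0).
{ intros m Hm; unfold h'; now apply Nat.leb_gt in Hm as ->. }
assert (Hs : forall N, (n <= N)%nat -> sqsum h' N = sqsum h n).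
{ induction 1 as [|N HN IH]; [symmetry; now apply sqsum_ext|].
  rewrite sqsum_S, IH, Hh0, nsq_real by lia; ring. }
assert (B : forall N, sqsum (g ** h) n <= sqsum h n + (1 - nsq p) * nsq ((e ** h') (N + n)%nat)).
{ intros N; rewrite (sqsum_ext (g ** h) (g ** h')).
  2:{ intros m Hm; apply qconv_ext; auto; intros k Hk; apply Hh; lia. }
  eapply Rle_trans; [apply (sqsum_mono _ n (N + n)); lia|].
  unfold g; rewrite <- qconvA, blaschke_defect_left, qconvA, <- Hfe.
  rewrite <- (Hs (N + n)%nat) by lia; apply Rplus_le_compat_r; now apply schur_left. }
assert (L := tends_0_conv e h' n He Hh0); apply is_lim_nsq_0 in L.
apply (is_lim_seq_incr_n _ n) in L.
exact (is_lim_seq_le _ _ _ _ B (is_lim_seq_const _)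
  (is_lim_seq_plus_0 _ _ _ (is_lim_seq_const _) (is_lim_seq_scal_0 _ _ L))).
Qed.

(** The coefficients of the regular Moebius transformation with zero [p]; the
    first factor is the inverse of its denominator. *)
Definition rM (p : quat) : nat -> quat := geom (qconj p) ** lin (- p)%quat (qreal 1).

Lemma qconj_in_ball p : in_ball p -> in_ball (qconj p).
Proof. unfold in_ball; now rewrite qnorm_conj. Qed.

(** Each Blaschke factor has a defect of rank one. *)
Lemma rM_defect p h n :
  sqsum h n = sqsum (h ** rM p) n + (1 - nsq p) * nsq ((h ** geom (qconj p)) n).
Proof.
unfold rM; rewrite qconvA, <- blaschke_defect_right, <- qconvA, geom_inv_r, qconv_cst1; reflexivity.
Qed.

Lemma schur_rM p : in_ball p -> schur (rM p).
Proof.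
intros Hp h n; rewrite (rM_defect p h n); apply qnorm_lt1 in Hp.
assert (H := nsq_ge0 ((h ** geom (qconj p)) n)); nra.
Qed.

Lemma lin_comm p : lin (- p)%quat (qreal 1) ** lin (qreal 1) (- qconj p)%quat =
  lin (qreal 1) (- qconj p)%quat ** lin (- p)%quat (qreal 1).
Proof.
rewrite !lin_qconv; apply sext; intros [|[|[|m]]]; unfold sadd, lscale, lin, sadd; simpl; qring.
Qed.

(** The two factors commute because both have their coefficients in the plane
    spanned by 1 and [p]. *)
Lemma rM_alt p : rM p = lin (- p)%quat (qreal 1) ** geom (qconj p).
Proof.
unfold rM.
rewrite <- (qconv_cst1 (lin (- p)%quat (qreal 1))) at 1.
now rewrite <- (geom_inv_l (qconj p)), !qconvA, <- (qconvA _ (lin (- p)%quat _)), lin_comm,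
  !qconvA, geom_inv_r, cst1_qconv.
Qed.

Lemma blaschke_division f p : schur f -> in_ball p -> power_series f p = qreal 0 ->
  exists e, (forall m, e m = power_series (fun j => f (S m + j)%nat) p) /\
    schur (lin (qreal 1) (- qconj p)%quat ** e) /\
    f = rM p ** (lin (qreal 1) (- qconj p)%quat ** e).
Proof.
intros Hf Hp H0.
destruct (divide_linear f p (schur_tame f Hf) Hp H0) as (e & Hfe & He).
exists e; split; [exact He | split].
- apply (schur_division f); auto; now apply (division_tends_0 f p).
- now rewrite rM_alt, <- (qconvA (lin _ _)), (qconvA (geom _)), geom_inv_r, cst1_qconv.
Qed.

Lemma rM_real r x : -1 < r < 1 -> -1 < x < 1 ->
  power_series (rM (qreal r)) (qreal x) = moebius (qreal r) (qreal x).
Proof.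
intros Hr Hx; assert (B := in_ball_real x Hx); assert (Br := in_ball_real r Hr).
assert (Bc := qconj_in_ball _ Br).
assert (N : forall y, -1 < y < 1 -> nsq (qreal y) < 1) by (intros y Hy; rewrite nsq_real; nra).
assert (D := moebius_den_neq0 (qreal r) (qreal x) (N r Hr) ltac:(specialize (N x Hx); lra)).
apply (qmul_cancel_l _ _ _ D); rewrite moebius_mul by (try apply N; auto; specialize (N x Hx); lra).
assert (E : lin (qreal 1) (- qconj (qreal r))%quat ** rM (qreal r) = lin (- qreal r)%quat (qreal 1))
  by (unfold rM; now rewrite qconvA, geom_inv_l, cst1_qconv).
apply (f_equal (fun u => power_series u (qreal x))) in E.
rewrite power_series_qconv_real, !power_series_lin in E; auto using tame_lin.
- transitivity ((qreal 1 + qreal x * - qconj (qreal r)) * power_series (rM (qreal r)) (qreal x))%quat.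
  + f_equal; qring.
  + rewrite E; qring.
- now apply schur_tame, schur_rM.
Qed.

(** The second factor is evaluated at a conjugate of [q], so it has to be
    controlled on the whole sphere of radius [|q|]. *)
Lemma power_series_le1_mul u v q : tame u -> tame v -> in_ball q ->
  (forall z, in_ball z -> nsq z = nsq q -> nsq (power_series v z) <= nsq q) ->
  nsq (power_series (u ** v) q) <= nsq (power_series u q) * nsq q.
Proof.
intros Hu Hv Hq H; rewrite power_series_qconv by auto.
set (w := power_series u q); rewrite nsqM.
destruct (classic (w = qreal 0)) as [E|E].
- rewrite E, nsq_real; simpl; lra.
- apply Rmult_le_compat_l; [apply nsq_ge0|]; apply H; [now apply in_ball_conjugate | now apply nsq_conjugate].
Qed.

(** Strict version of [schur_ball], by the lemma of Schwarz applied to the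
    Moebius transform that moves the value at the origin to zero. *)
Lemma schur_ball_strict a q : schur a -> nsq (a O) < 1 -> in_ball q ->
  nsq (power_series a q) < 1.
Proof.
intros Ha H0 Hq; set (c := a O) in *.
destruct (moebius_exists a c Ha H0) as (g & Hg & Sg).
assert (G0 : power_series g (qreal 0) = qreal 0).
{ rewrite (is_moebius_real a c g 0) by (auto; rewrite ?power_series_at_0; fold c; lra).
  rewrite power_series_at_0; now apply moebius_self. }
destruct (blaschke_division g (qreal 0) Sg (in_ball_real 0 ltac:(lra)) G0) as (k0 & _ & Sk & Ek).
set (k := lin (qreal 1) (- qconj (qreal 0))%quat ** k0) in *; clearbody k; clear k0.
assert (Egk : g = shift k).
{ rewrite Ek; unfold rM; rewrite <- qconvA, lin_qconv.
  apply sext; intros [|m]; rewrite ?qconv_0; unfold sadd, lscale; cbn [shift];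
   [unfold geom; simpl; qring|].
  rewrite qconv_S; cbn [shift].
  replace (tail (geom (qconj (qreal 0)))) with (cst (qreal 0)).
  - rewrite cst_qconv; unfold lscale, geom; simpl; qring.
  - apply sext; intros [|j]; unfold tail, geom; simpl; qring. }
assert (B := schur_ball a q Ha Hq); assert (Ta := schur_tame a Ha); assert (Tk := schur_tame k Sk).
assert (M : nsq (power_series a q - c)%quat <= nsq (qreal 1 - power_series a q * qconj c)%quat * nsq q).
{ rewrite <- (power_series_mnum a c), <- (power_series_mden a c), <- Hg, Egk by auto.
  apply power_series_le1_mul; auto; [now apply tame_mden | now apply tame_shift |].
  intros z Hz Ez; rewrite power_series_shift, nsqM, Ez by auto.
  assert (H1 := schur_ball k z Sk Hz); assert (H2 := nsq_ge0 q); nra. }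
assert (D := nsq_neq0 _ (moebius_den_neq0 c _ H0 B)).
set (w := power_series a q) in *.
(* If [|w| = 1] both sides of [M] have the same first factor, against [|q| < 1]. *)
assert (I : nsq (qreal 1 - w * qconj c)%quat - nsq (w - c)%quat = (1 - nsq c) * (1 - nsq w)) by qrring.
assert (Hq' : nsq q < 1) by now apply qnorm_lt1.
assert (0 < (1 - nsq q) * nsq (qreal 1 - w * qconj c)%quat) by (apply Rmult_lt_0_compat; lra).
nra.
Qed.

(** * Power series expansion of slice regular functions *)

(** Real components [u = L(f)], [v = L(I f)] of a slice regular function on a
    slice, [L] being any real linear form; [a] and [b] are the partial
    derivatives of [u], and the Cauchy-Riemann equations give those of [v]. *)
Definition cauchy_riemann (u v a b : R -> R -> R) : Prop :=
  forall x y, x ^ 2 + y ^ 2 < 1 ->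
    is_derive (fun t => u t y) x (a x y) /\ is_derive (fun t => u x t) y (b x y) /\
    is_derive (fun t => v t y) x (b x y) /\ is_derive (fun t => v x t) y (- a x y) /\
    continuous (fun z : R * R => a (fst z) (snd z)) (x, y) /\
    continuous (fun z : R * R => b (fst z) (snd z)) (x, y).

Lemma open_disc x y : x ^ 2 + y ^ 2 < 1 ->
  locally (x, y) (fun z : R * R => fst z ^ 2 + snd z ^ 2 < 1).
Proof.
intros H.
assert (C : continuous (fun z : R * R => fst z ^ 2 + snd z ^ 2) (x, y)).
{ apply (continuous_plus (fun z : R * R => fst z ^ 2) (fun z => snd z ^ 2)).
  - apply continuous_ext with (fun z : R * R => fst z * fst z); [intros; simpl; ring|].
    apply (continuous_mult (K := R_AbsRing)); apply continuous_fst.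
  - apply continuous_ext with (fun z : R * R => snd z * snd z); [intros; simpl; ring|].
    apply (continuous_mult (K := R_AbsRing)); apply continuous_snd. }
apply (C (fun s => s < 1)); exists (mkposreal (1 - (x ^ 2 + y ^ 2)) ltac:(lra)); intros z Hz.
unfold ball in Hz; simpl in Hz; unfold AbsRing_ball, abs, minus, plus, opp in Hz; simpl in Hz.
apply Rabs_def2 in Hz; simpl; lra.
Qed.

(** Continuity of one partial derivative suffices for the total derivative. *)
Lemma is_derive_chain2 (u a b : R -> R -> R) (X Y : R -> R) t X' Y' :
  (forall x y, x ^ 2 + y ^ 2 < 1 -> is_derive (fun s => u s y) x (a x y) /\
     is_derive (fun s => u x s) y (b x y) /\
     continuous (fun z : R * R => a (fst z) (snd z)) (x, y)) ->
  X t ^ 2 + Y t ^ 2 < 1 -> is_derive X t X' -> is_derive Y t Y' ->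
  is_derive (fun s => u (X s) (Y s)) t (a (X t) (Y t) * X' + b (X t) (Y t) * Y').
Proof.
intros H HD HX HY; unfold is_derive.
assert (F : filterdiff (fun z : R * R => u (fst z) (snd z)) (locally (X t, Y t))
  (fun z : R * R => plus (scal (fst z) (a (X t) (Y t))) (scal (snd z) (b (X t) (Y t))))).
{ apply is_derive_filterdiff.
  - apply filter_imp with (2 := open_disc _ _ HD); intros [x y] Hz; now apply H.
  - now apply H.
  - now apply H. }
eapply filterdiff_ext_lin.
- exact (filterdiff_comp'_2 X Y u t _ _
    (fun p q : R => plus (scal p (a (X t) (Y t))) (scal q (b (X t) (Y t)))) HX HY F).
- intros y; unfold plus, scal; simpl; unfold mult; simpl; ring.
Qed.

Lemma continuous_disc (u a b : R -> R -> R) x y :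
  (forall x y, x ^ 2 + y ^ 2 < 1 -> is_derive (fun s => u s y) x (a x y) /\
     is_derive (fun s => u x s) y (b x y) /\
     continuous (fun z : R * R => a (fst z) (snd z)) (x, y)) ->
  x ^ 2 + y ^ 2 < 1 -> continuous (fun z : R * R => u (fst z) (snd z)) (x, y).
Proof.
intros H HD; apply (filterdiff_continuous (K := R_AbsRing) (fun z : R * R => u (fst z) (snd z))).
eexists; apply (is_derive_filterdiff u x y a (b x y)).
- apply filter_imp with (2 := open_disc _ _ HD); intros [s t] Hz; now apply H.
- now apply H.
- now apply H.
Qed.

Lemma two_PI_pos : 0 <= 2 * PI.
Proof. assert (H := PI_RGT_0); lra. Qed.

Lemma cos2_sin2 th : cos th ^ 2 + sin th ^ 2 = 1.
Proof. assert (H := sin2_cos2 th); unfold Rsqr in H; simpl; lra. Qed.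

(** In what follows [zeta = rho exp(I th)] runs over a circle around the origin
    that encloses [z0 = x0 + I y0]; [cauchy_re] and [cauchy_im] are the
    components of [zeta / (zeta - z0)]. *)
Definition cauchy_den (x0 y0 rho th : R) : R := (rho * cos th - x0) ^ 2 + (rho * sin th - y0) ^ 2.
Definition cauchy_re (x0 y0 rho th : R) : R :=
  (rho * cos th * (rho * cos th - x0) + rho * sin th * (rho * sin th - y0)) / cauchy_den x0 y0 rho th.
Definition cauchy_im (x0 y0 rho th : R) : R :=
  (rho * sin th * (rho * cos th - x0) - rho * cos th * (rho * sin th - y0)) / cauchy_den x0 y0 rho th.

Lemma cauchy_den_pos x0 y0 rho th : x0 ^ 2 + y0 ^ 2 < rho ^ 2 -> 0 < cauchy_den x0 y0 rho th.
Proof.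
intros Hz0; unfold cauchy_den; assert (H := cos2_sin2 th).
assert (S1 := pow2_ge_0 (rho * cos th - x0)); assert (S2 := pow2_ge_0 (rho * sin th - y0)).
destruct (Req_dec (rho * cos th - x0) 0) as [E1|E1];
  [|assert (S3 := pow2_gt_0 _ E1); lra].
destruct (Req_dec (rho * sin th - y0) 0) as [E2|E2];
  [|assert (S3 := pow2_gt_0 _ E2); lra].
exfalso; replace x0 with (rho * cos th) in Hz0 by lra; replace y0 with (rho * sin th) in Hz0 by lra.
replace ((rho * cos th) ^ 2 + (rho * sin th) ^ 2) with (rho ^ 2 * (cos th ^ 2 + sin th ^ 2)) in Hz0 by ring.
rewrite H in Hz0; lra.
Qed.

Lemma cauchy_den_le x0 y0 rho th : rho ^ 2 < 1 -> x0 ^ 2 + y0 ^ 2 < rho ^ 2 -> cauchy_den x0 y0 rho th <= 4.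
Proof.
intros Hr Hz0; unfold cauchy_den; assert (H := cos2_sin2 th).
assert (S1 := pow2_ge_0 (rho * cos th + x0)); assert (S2 := pow2_ge_0 (rho * sin th + y0)).
assert (E : (rho * cos th - x0) ^ 2 + (rho * sin th - y0) ^ 2 + (rho * cos th + x0) ^ 2 +
    (rho * sin th + y0) ^ 2 = 2 * (rho ^ 2 * (cos th ^ 2 + sin th ^ 2)) + 2 * (x0 ^ 2 + y0 ^ 2)) by ring.
rewrite H in E; lra.
Qed.

(** The segments from [z0] to the circle can be prolonged a little at both
    ends without leaving the unit disc. *)
Lemma segment_in_disc x0 y0 rho t th : 0 < rho < 1 -> x0 ^ 2 + y0 ^ 2 < rho ^ 2 ->
  - ((1 - rho ^ 2) / 20) < t < 1 + (1 - rho ^ 2) / 20 ->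
  (x0 + t * (rho * cos th - x0)) ^ 2 + (y0 + t * (rho * sin th - y0)) ^ 2 < 1.
Proof.
intros Hrho Hz0 Ht.
assert (Hr2 : 0 < rho ^ 2 < 1) by (simpl; nra).
assert (E : (x0 + t * (rho * cos th - x0)) ^ 2 + (y0 + t * (rho * sin th - y0)) ^ 2 =
  (1 - t) * (x0 ^ 2 + y0 ^ 2) + t * rho ^ 2 - t * (1 - t) * cauchy_den x0 y0 rho th).
{ unfold cauchy_den.
  replace (t * rho ^ 2) with (t * rho ^ 2 * (cos th ^ 2 + sin th ^ 2)) by (rewrite cos2_sin2; ring); ring. }
assert (Dd := cauchy_den_le x0 y0 rho th ltac:(lra) Hz0).
assert (P := cauchy_den_pos x0 y0 rho th Hz0).
assert (N0 : 0 <= x0 ^ 2 + y0 ^ 2) by (assert (S1 := pow2_ge_0 x0); assert (S2 := pow2_ge_0 y0); lra).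
rewrite E; set (d := (1 - rho ^ 2) / 20) in *; assert (Hd : 0 < d <= / 20) by (unfold d; lra).
assert (Hrd : rho ^ 2 = 1 - 20 * d) by (unfold d; field).
set (k := cauchy_den x0 y0 rho th) in *; set (z := x0 ^ 2 + y0 ^ 2) in *; set (r2 := rho ^ 2) in *.
clearbody k z r2 d; clear E Hrho.
destruct (Rle_dec 0 (t * (1 - t))) as [T|T].
- assert (0 <= t * (1 - t) * k) by (apply Rmult_le_pos; lra).
  assert (0 <= t <= 1) by nra.
  assert ((1 - t) * z <= (1 - t) * r2) by (apply Rmult_le_compat_l; lra).
  nra.
- assert (Q : - (t * (1 - t)) <= d * (1 + d)).
  { destruct (Rle_dec t 0); nra. }
  assert (- (t * (1 - t)) * k <= d * (1 + d) * 4) by (apply Rmult_le_compat; nra).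
  assert ((1 - t) * z + t * r2 <= r2 + d).
  { destruct (Rle_dec t 0).
    - assert ((1 - t) * z <= (1 - t) * r2) by (apply Rmult_le_compat_l; lra); nra.
    - assert ((1 - t) * z <= 0) by nra.
      assert (t * r2 <= (1 + d) * r2) by (apply Rmult_le_compat_r; lra); nra. }
  nra.
Qed.

Lemma continuous_cauchy_kernel x0 y0 rho th : x0 ^ 2 + y0 ^ 2 < rho ^ 2 ->
  continuous (cauchy_re x0 y0 rho) th /\ continuous (cauchy_im x0 y0 rho) th.
Proof.
intros H; assert (P := cauchy_den_pos x0 y0 rho th H); unfold cauchy_den in P.
split; apply (ex_derive_continuous (K := R_AbsRing) (V := R_NormedModule));
  unfold cauchy_re, cauchy_im, cauchy_den; auto_derive; simpl in *; lra.
Qed.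

(** Both components of the Cauchy kernel are integrated against [u] and [v]
    along the circles obtained by shrinking the given one towards [z0]; the
    derivative of the integral with respect to the shrinking parameter [t]
    vanishes, since [t] times the integrand of the derivative is, up to sign,
    the derivative of [v] along the curve. *)
Lemma cauchy_formula u v a b x0 y0 rho :
  cauchy_riemann u v a b -> 0 < rho < 1 -> x0 ^ 2 + y0 ^ 2 < rho ^ 2 ->
  RInt (fun th => cauchy_re x0 y0 rho th * u (rho * cos th) (rho * sin th) +
                  cauchy_im x0 y0 rho th * v (rho * cos th) (rho * sin th)) 0 (2 * PI) =
  RInt (fun th => cauchy_re x0 y0 rho th * u x0 y0 + cauchy_im x0 y0 rho th * v x0 y0) 0 (2 * PI).
Proof.
intros CR Hrho Hz0.
set (k1 := cauchy_re x0 y0 rho); set (k2 := cauchy_im x0 y0 rho).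
pose (px := fun t th => x0 + t * (rho * cos th - x0)).
pose (py := fun t th => y0 + t * (rho * sin th - y0)).
set (d := (1 - rho ^ 2) / 20).
assert (Hd : 0 < d) by (unfold d; simpl; nra).
assert (path_in : forall t th, - d < t < 1 + d -> px t th ^ 2 + py t th ^ 2 < 1)
  by (intros; now apply segment_in_disc).
assert (CRu : forall x y, x ^ 2 + y ^ 2 < 1 -> is_derive (fun s => u s y) x (a x y) /\
     is_derive (fun s => u x s) y (b x y) /\
     continuous (fun z : R * R => a (fst z) (snd z)) (x, y))
  by (intros x y H; destruct (CR x y H) as (H1 & H2 & H3 & H4 & H5 & H6); auto).
assert (CRv : forall x y, x ^ 2 + y ^ 2 < 1 -> is_derive (fun s => v s y) x (b x y) /\
     is_derive (fun s => v x s) y ((fun p q => - a p q) x y) /\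
     continuous (fun z : R * R => b (fst z) (snd z)) (x, y))
  by (intros x y H; destruct (CR x y H) as (H1 & H2 & H3 & H4 & H5 & H6); auto).
pose (D := fun t th => a (px t th) (py t th) * (rho * cos th) + b (px t th) (py t th) * (rho * sin th)).
pose (G := fun t th => k1 th * u (px t th) (py t th) + k2 th * v (px t th) (py t th)).
assert (path_cont : forall t th : R, continuous (fun z : R * R => px (fst z) (snd z)) (t, th) /\
   continuous (fun z : R * R => py (fst z) (snd z)) (t, th)).
{ intros t th; split; [unfold px | unfold py];
  apply (continuous_plus (fun _ : R * R => _) (fun z : R * R => fst z * _)); try apply continuous_const;
  apply (continuous_mult (K := R_AbsRing) (fun z : R * R => fst z)); try apply continuous_fst;
  apply (continuous_comp (fun z : R * R => snd z) (fun s => rho * _ s - _)); try apply continuous_snd;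
  apply (ex_derive_continuous (K := R_AbsRing) (V := R_NormedModule)); auto_derive; auto. }
assert (comp_cont : forall (w : R -> R -> R) (t th : R), - d < t < 1 + d ->
  continuous (fun z : R * R => w (fst z) (snd z)) (px t th, py t th) ->
  continuous (fun z : R * R => w (px (fst z) (snd z)) (py (fst z) (snd z))) (t, th)).
{ intros w t th Ht Hw; destruct (path_cont t th) as [C1 C2].
  exact (continuous_comp_2 (fun z : R * R => px (fst z) (snd z)) (fun z : R * R => py (fst z) (snd z))
     w (t, th) C1 C2 Hw). }
assert (section : forall (w : R -> R -> R) (t th : R), continuous (fun z : R * R => w (fst z) (snd z)) (t, th) ->
  continuous (fun s => w t s) th).
{ intros w t th Hw.
  exact (continuous_comp_2 (fun _ : R => t) (fun s : R => s) w th
    (continuous_const _ _) (continuous_id _) Hw). }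
assert (G_derive : forall t th, - d < t < 1 + d -> is_derive (fun s => G s th) t (D t th)).
{ intros t th Ht; assert (P := cauchy_den_pos x0 y0 rho th Hz0).
  assert (dpx : is_derive (fun s => px s th) t (rho * cos th - x0)) by (unfold px; auto_derive; auto; ring).
  assert (dpy : is_derive (fun s => py s th) t (rho * sin th - y0)) by (unfold py; auto_derive; auto; ring).
  assert (Du := is_derive_chain2 u a b (fun s => px s th) (fun s => py s th) t _ _ CRu
    (path_in t th Ht) dpx dpy).
  assert (Dv := is_derive_chain2 v b (fun p q => - a p q) (fun s => px s th) (fun s => py s th) t _ _ CRv
    (path_in t th Ht) dpx dpy).
  cbn beta in Du, Dv.
  assert (Hs := is_derive_plus _ _ _ _ _ (is_derive_scal _ _ (k1 th) _ Du) (is_derive_scal _ _ (k2 th) _ Dv)).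
  (* Components of [(k1 + I k2) * (zeta - z0) = zeta]. *)
  assert (E1 : k1 th * (rho * cos th - x0) - k2 th * (rho * sin th - y0) = rho * cos th).
  { unfold k1, k2, cauchy_re, cauchy_im; unfold cauchy_den in *; field; lra. }
  assert (E2 : k1 th * (rho * sin th - y0) + k2 th * (rho * cos th - x0) = rho * sin th).
  { unfold k1, k2, cauchy_re, cauchy_im; unfold cauchy_den in *; field; lra. }
  replace (D t th) with (plus (k1 th * (a (px t th) (py t th) * (rho * cos th - x0) +
     b (px t th) (py t th) * (rho * sin th - y0)))
   (k2 th * (b (px t th) (py t th) * (rho * cos th - x0) +
     - a (px t th) (py t th) * (rho * sin th - y0)))); [exact Hs|].
  transitivity (a (px t th) (py t th) * (k1 th * (rho * cos th - x0) - k2 th * (rho * sin th - y0)) +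
    b (px t th) (py t th) * (k1 th * (rho * sin th - y0) + k2 th * (rho * cos th - x0))).
  - unfold plus; simpl; ring.
  - now rewrite E1, E2. }
assert (D_cont : forall t th : R, - d < t < 1 + d ->
  continuous (fun z : R * R => D (fst z) (snd z)) (t, th)).
{ intros t th Ht; destruct (CR _ _ (path_in t th Ht)) as (_ & _ & _ & _ & Ca & Cb).
  assert (Ct : forall g : R -> R, (forall s, ex_derive g s) ->
    continuous (fun z : R * R => g (snd z)) (t, th)).
  { intros g Hg; apply (continuous_comp (fun z : R * R => snd z) g); [apply continuous_snd|].
    apply (ex_derive_continuous (K := R_AbsRing) (V := R_NormedModule)), Hg. }
  unfold D; apply (continuous_plus (fun z : R * R => a _ _ * _) (fun z : R * R => b _ _ * _)).
  - apply (continuous_mult (K := R_AbsRing) (fun z : R * R => a (px (fst z) (snd z)) (py (fst z) (snd z)))).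
    + now apply comp_cont.
    + apply (Ct (fun s => rho * cos s)); intros s; auto_derive; auto.
  - apply (continuous_mult (K := R_AbsRing) (fun z : R * R => b (px (fst z) (snd z)) (py (fst z) (snd z)))).
    + now apply comp_cont.
    + apply (Ct (fun s => rho * sin s)); intros s; auto_derive; auto. }
assert (near : forall t : R, 0 <= t <= 1 -> locally t (fun s => - d < s < 1 + d)).
{ intros t Ht; exists (mkposreal d Hd); intros s Hs.
  unfold ball in Hs; simpl in Hs; unfold AbsRing_ball, abs, minus, plus, opp in Hs; simpl in Hs.
  apply Rabs_def2 in Hs; lra. }
assert (G_cont : forall t th : R, - d < t < 1 + d -> continuous (fun s => G t s) th).
{ intros t th Ht; destruct (continuous_cauchy_kernel x0 y0 rho th Hz0) as [C1 C2].
  assert (Cu := section (fun p q => u (px p q) (py p q)) t th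
    (comp_cont u t th Ht (continuous_disc u a b _ _ CRu (path_in t th Ht)))).
  assert (Cv := section (fun p q => v (px p q) (py p q)) t th
    (comp_cont v t th Ht (continuous_disc v b _ _ _ CRv (path_in t th Ht)))).
  exact (continuous_plus _ _ _ (continuous_mult (K := R_AbsRing) _ _ _ C1 Cu)
     (continuous_mult (K := R_AbsRing) _ _ _ C2 Cv)). }
pose (J := fun t => RInt (fun th => G t th) 0 (2 * PI)).
assert (J_derive : forall t, 0 <= t <= 1 -> is_derive J t (RInt (fun th => D t th) 0 (2 * PI))).
{ intros t Ht; assert (Ht' : - d < t < 1 + d) by lra.
  assert (DD : forall s th, - d < s < 1 + d -> Derive (fun z => G z th) s = D s th)
    by (intros; now apply is_derive_unique, G_derive).
  replace (RInt (fun th => D t th) 0 (2 * PI)) with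
    (RInt (fun th => Derive (fun z => G z th) t) 0 (2 * PI))
    by (apply RInt_ext; intros; now apply DD).
  apply (is_derive_RInt_param G 0 (2 * PI) t).
  - apply filter_imp with (2 := near t Ht); intros s Hs th _; exists (D s th); now apply G_derive.
  - intros th _; apply continuity_2d_pt_ext_loc with D; [|now apply continuity_2d_pt_filterlim, D_cont].
    destruct (near t Ht) as [eps Heps]; exists eps; intros s s' Hs _; symmetry; apply DD, Heps, Hs.
  - apply filter_imp with (2 := near t Ht); intros s Hs.
    apply (ex_RInt_continuous (V := R_CompleteNormedModule)); intros; now apply G_cont. }
assert (D_zero : forall t, 0 <= t <= 1 -> RInt (fun th => D t th) 0 (2 * PI) = 0).
{ intros t Ht; assert (Ht' : - d < t < 1 + d) by lra.
  apply is_RInt_unique.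
  assert (prim : exists W : R -> R, W (2 * PI) = W 0 /\ forall th, is_derive W th (D t th)).
  { (* At [t = 0] the curve is a point and [D] a combination of cos and sin. *)
    destruct (Req_dec t 0) as [E|E].
    - exists (fun th => a x0 y0 * (rho * sin th) - b x0 y0 * (rho * cos th)); split.
      + rewrite sin_2PI, cos_2PI, sin_0, cos_0; ring.
      + intros th; unfold D, px, py; rewrite E, !Rmult_0_l, !Rplus_0_r; auto_derive; auto; ring.
    - exists (fun th => - / t * v (px t th) (py t th)); split.
      + unfold px, py; now rewrite sin_2PI, cos_2PI, sin_0, cos_0.
      + intros th.
        assert (Dv := is_derive_chain2 v b (fun p q => - a p q) (fun s => px t s) (fun s => py t s) th
          (- (t * (rho * sin th))) (t * (rho * cos th)) CRv (path_in t th Ht')).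
        assert (Hx : is_derive (fun s => px t s) th (- (t * (rho * sin th))))
          by (unfold px; auto_derive; auto; ring).
        assert (Hy : is_derive (fun s => py t s) th (t * (rho * cos th)))
          by (unfold py; auto_derive; auto; ring).
        assert (Hs := is_derive_scal _ _ (- / t) _ (Dv Hx Hy)).
        replace (D t th) with (- / t * (b (px t th) (py t th) * - (t * (rho * sin th)) +
            - a (px t th) (py t th) * (t * (rho * cos th)))) by (unfold D; field; auto).
        exact Hs. }
  destruct prim as (W & W0 & HW).
  replace 0 with (minus (W (2 * PI)) (W 0)) at 2 by (rewrite W0; unfold minus, plus, opp; simpl; ring).
  apply (is_RInt_derive (V := R_CompleteNormedModule)); intros th _; [apply HW|].
  exact (section D t th (D_cont t th Ht')). }
assert (EJ : J 1 = J 0).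
{ destruct (MVT_gen J 0 1 (fun t => RInt (fun th => D t th) 0 (2 * PI))) as (c & Hc & E).
  - rewrite Rmin_left, Rmax_right by lra; intros t Ht; apply J_derive; lra.
  - rewrite Rmin_left, Rmax_right by lra; intros t Ht.
    apply derivable_continuous_pt; eexists; apply is_derive_Reals, J_derive, Ht.
  - rewrite Rmin_left, Rmax_right in Hc by lra; rewrite D_zero in E by lra; lra. }
transitivity (J 1); [|rewrite EJ]; apply RInt_ext; intros th _; unfold G, px, py.
- now replace (x0 + 1 * (rho * cos th - x0)) with (rho * cos th) by ring;
   replace (y0 + 1 * (rho * sin th - y0)) with (rho * sin th) by ring.
- now rewrite !Rmult_0_l, !Rplus_0_r.
Qed.

Lemma imag_unit_spec I : imag_unit I -> cre I = 0 /\ nsq I = 1.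
Proof.
destruct I as [[[a b] c] d]; unfold imag_unit; intros H.
assert (H0 := f_equal cre H); assert (H1 := f_equal cim1 H); assert (H2 := f_equal cim2 H);
assert (H3 := f_equal cim3 H).
rewrite cre_opp in H0; rewrite cim1_opp in H1; rewrite cim2_opp in H2; rewrite cim3_opp in H3.
unfold nsq; unfold qmul, qreal, cre, cim1, cim2, cim3 in *; cbn [fst snd] in *.
assert (a = 0).
{ destruct (Req_dec a 0) as [|E]; auto.
  assert (b = 0) by (apply Rmult_eq_reg_l with a; lra).
  assert (c = 0) by (apply Rmult_eq_reg_l with a; lra).
  assert (d = 0) by (apply Rmult_eq_reg_l with a; lra); subst; nra. }
subst; split; [auto | simpl; lra].
Qed.

Lemma imag_unit_mul I p : imag_unit I -> (I * (I * p) = - p)%quat.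
Proof. intros H; rewrite qmulA, H; qring. Qed.

Lemma slice_ptE I x y p : (slice_pt I x y * p = qscal x p + qscal y (I * p))%quat.
Proof. unfold slice_pt; qring. Qed.

Lemma slice_pt_mul I x y x' y' : imag_unit I ->
  (slice_pt I x y * slice_pt I x' y')%quat = slice_pt I (x * x' - y * y') (x * y' + y * x').
Proof.
intros H; unfold slice_pt; rewrite qmulDl, !qmulDr, !qrealM.
replace (qreal y * I * (qreal y' * I))%quat with (qreal (y * y') * (I * I))%quat by qring.
rewrite H; qring.
Qed.

Lemma slice_pt_comm I x y x' y' : imag_unit I ->
  (slice_pt I x y * slice_pt I x' y' = slice_pt I x' y' * slice_pt I x y)%quat.
Proof. intros H; rewrite !slice_pt_mul by auto; f_equal; ring. Qed.

Lemma nsq_slice_pt I x y : imag_unit I -> nsq (slice_pt I x y) = x ^ 2 + y ^ 2.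
Proof.
intros H; apply imag_unit_spec in H; destruct H as [H0 H1].
destruct I as [[[a b] c] d]; unfold cre in H0; simpl in H0; subst.
transitivity (x ^ 2 + y ^ 2 * nsq (0, b, c, d)); [unfold slice_pt; qrring | rewrite H1; ring].
Qed.

Lemma slice_pt_real I x : slice_pt I x 0 = qreal x.
Proof. unfold slice_pt; qring. Qed.

Lemma slice_decomposition q : exists I x y, imag_unit I /\ q = slice_pt I x y.
Proof.
destruct q as [[[a b] c] d]; set (y := sqrt (b ^ 2 + c ^ 2 + d ^ 2)).
assert (P : 0 <= b ^ 2 + c ^ 2 + d ^ 2) by (repeat apply Rplus_le_le_0_compat; apply pow2_ge_0).
assert (Hy : y ^ 2 = b ^ 2 + c ^ 2 + d ^ 2) by (unfold y; rewrite <- Rsqr_pow2; now apply Rsqr_sqrt).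
destruct (Req_dec y 0) as [E|E].
- exists (0, 1, 0, 0), a, 0; split.
  { unfold imag_unit; apply quat_ext; rewrite ?cre_opp, ?cim1_opp, ?cim2_opp, ?cim3_opp;
     unfold qmul, qreal, cre, cim1, cim2, cim3; cbn [fst snd]; lra. }
  
  rewrite slice_pt_real; rewrite E in Hy.
  assert (S1 := pow2_ge_0 b); assert (S2 := pow2_ge_0 c); assert (S3 := pow2_ge_0 d).
  assert (Z : forall x, x ^ 2 <= 0 -> x = 0) by (intros x Hx; simpl in Hx; nra).
  unfold qreal; rewrite (Z b), (Z c), (Z d) by lra; reflexivity.
- exists (0, b / y, c / y, d / y), a, y.
  assert (Q : (b / y) * (b / y) + (c / y) * (c / y) + (d / y) * (d / y) = 1).
  { replace ((b / y) * (b / y) + (c / y) * (c / y) + (d / y) * (d / y)) with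
      ((b ^ 2 + c ^ 2 + d ^ 2) / y ^ 2) by (field; auto); rewrite <- Hy; field; auto. }
  split.
  + unfold imag_unit; apply quat_ext; rewrite ?cre_opp, ?cim1_opp, ?cim2_opp, ?cim3_opp;
     unfold qmul, qreal, cre, cim1, cim2, cim3; cbn [fst snd]; lra.
  + unfold slice_pt; apply quat_ext; rewrite ?cre_add, ?cim1_add, ?cim2_add, ?cim3_add;
     unfold qmul, qreal, cre, cim1, cim2, cim3; cbn [fst snd]; field; auto.
Qed.

(** Every real linear form on the quaternions is [q |-> cre (c * q)] for some [c]. *)
Lemma quat_eq_forms p q : (forall c, cre (c * p)%quat = cre (c * q)%quat) -> p = q.
Proof.
intros H; apply quat_ext; [specialize (H (qreal 1)) | specialize (H (0, -1, 0, 0)) |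
  specialize (H (0, 0, -1, 0)) | specialize (H (0, 0, 0, -1))];
  destruct p as [[[p0 p1] p2] p3], q as [[[q0 q1] q2] q3];
  unfold qmul, qreal, cre, cim1, cim2, cim3 in *; cbn [fst snd] in *; lra.
Qed.

Lemma is_linear_form c : is_linear (fun q : quat => cre (c * q)%quat : R).
Proof.
split.
- intros p q; change (cre (c * (p + q))%quat = cre (c * p)%quat + cre (c * q)%quat); now rewrite qmulDr.
- intros k p; change (cre (c * qscal k p)%quat = k * cre (c * p)%quat); qrring.
- exists (qnorm c + 1); split; [assert (H := qnorm_ge0 c); lra|].
  intros p; rewrite norm_qnorm; change (Rabs (cre (c * p)%quat) <= (qnorm c + 1) * qnorm p).
  destruct (components_le_qnorm (c * p)%quat) as [B _]; rewrite qnormM in B.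
  assert (H := qnorm_ge0 p); lra.
Qed.

Lemma is_derive_form c (g : R -> quat) x l :
  is_derive (g : R -> quat) x l -> is_derive (fun t => cre (c * g t)%quat) x (cre (c * l)%quat).
Proof.
intros H; unfold is_derive.
eapply filterdiff_ext_lin.
- apply (filterdiff_comp' g (fun q : quat => cre (c * q)%quat : R) x _ (fun q : quat => cre (c * q)%quat : R) H).
  apply filterdiff_linear, is_linear_form.
- intros y; simpl; change (cre (c * qscal y l)%quat = y * cre (c * l)%quat); qrring.
Qed.

Lemma continuous_form {U : UniformSpace} c (g : U -> quat) x :
  continuous (g : U -> quat) x -> continuous (fun t => cre (c * g t)%quat : R) x.
Proof.
intros H; apply (continuous_comp g (fun q : quat => cre (c * q)%quat : R)); [exact H|].
apply (filterdiff_continuous (K := R_AbsRing) (fun q : quat => cre (c * q)%quat : R)).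
eexists; apply filterdiff_linear, is_linear_form.
Qed.

Lemma slice_regular_cauchy_riemann f I : slice_regular f -> imag_unit I ->
  exists fx : R -> R -> quat, forall c, cauchy_riemann
    (fun x y => cre (c * f (slice_pt I x y))%quat) (fun x y => cre (c * (I * f (slice_pt I x y)))%quat)
    (fun x y => cre (c * fx x y)%quat) (fun x y => cre (c * (I * fx x y))%quat).
Proof.
intros Hf HI; destruct (Hf I HI) as (fx & fy & H); exists fx; intros c x y Hxy.
destruct (H x y) as (Dx & Dy & Cx & Cy & E).
{ unfold in_ball; rewrite qnorm_lt1, nsq_slice_pt by auto; exact Hxy. }
assert (Efy : fy x y = (I * fx x y)%quat).
{ assert (E2 : (fx x y + I * fy x y)%quat = qreal 0).
  { transitivity (qscal 2 (qscal (/ 2) (fx x y + I * fy x y)%quat)).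
    - rewrite !qscalE, qmulA, qrealM, Rinv_r, qmul1l by lra; reflexivity.
    - rewrite E; qring. }
  replace (fx x y) with ((fx x y + I * fy x y) - I * fy x y)%quat by qring.
  rewrite E2, qadd0l; replace (I * - (I * fy x y))%quat with (- (I * (I * fy x y)))%quat by qring.
  rewrite imag_unit_mul by auto; qring. }
assert (T : forall p, cre (c * (I * p))%quat = cre (c * I * p)%quat) by (intros; now rewrite qmulA).
rewrite Efy in Dy; refine (conj _ (conj _ (conj _ (conj _ (conj _ _))))).
- exact (is_derive_form c _ _ _ Dx).
- exact (is_derive_form c _ _ _ Dy).
- rewrite T; apply is_derive_ext with (fun t => cre (c * I * f (slice_pt I t y))%quat); [intros; now rewrite T|].
  exact (is_derive_form (c * I)%quat _ _ _ Dx).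
- replace (- cre (c * fx x y)%quat) with (cre (c * I * (I * fx x y))%quat).
  2:{ rewrite <- T, imag_unit_mul by auto; qrring. }
  apply is_derive_ext with (fun t => cre (c * I * f (slice_pt I x t))%quat); [intros; now rewrite T|].
  exact (is_derive_form (c * I)%quat _ _ _ Dy).
- exact (continuous_form c _ _ Cx).
- apply continuous_ext with (fun z : R * R => cre (c * I * fx (fst z) (snd z))%quat); [intros; now rewrite T|].
  exact (continuous_form (c * I)%quat _ _ Cx).
Qed.

Definition qRInt (G : R -> quat) : quat :=
  (RInt (fun t => cre (G t)) 0 (2 * PI), RInt (fun t => cim1 (G t)) 0 (2 * PI),
   RInt (fun t => cim2 (G t)) 0 (2 * PI), RInt (fun t => cim3 (G t)) 0 (2 * PI)).

(** Continuity as seen by the real linear forms through which integrals are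
    computed. *)
Definition qcont (G : R -> quat) : Prop :=
  forall c t, continuous (fun t => cre (c * G t)%quat) t.

Lemma qcont_components G : qcont G ->
  (forall t, continuous (fun t => cre (G t)) t) /\ (forall t, continuous (fun t => cim1 (G t)) t) /\
  (forall t, continuous (fun t => cim2 (G t)) t) /\ (forall t, continuous (fun t => cim3 (G t)) t).
Proof.
intros H; repeat split; intros t;
 [ apply continuous_ext with (2 := H (qreal 1) t) | apply continuous_ext with (2 := H (0, -1, 0, 0) t)
 | apply continuous_ext with (2 := H (0, 0, -1, 0) t) | apply continuous_ext with (2 := H (0, 0, 0, -1) t)];
 intros s; destruct (G s) as [[[g0 g1] g2] g3];
 match goal with |- ?a = ?b => change (@eq R a b) end;
 unfold qmul, qreal, cre, cim1, cim2, cim3; cbn [fst snd]; ring.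
Qed.

Lemma qRInt_form G c : qcont G ->
  cre (c * qRInt G)%quat = RInt (fun t => cre (c * G t)%quat) 0 (2 * PI).
Proof.
intros H; destruct (qcont_components G H) as (C0 & C1 & C2 & C3).
symmetry; apply is_RInt_unique.
assert (I : forall g : R -> R, (forall t, continuous g t) -> is_RInt g 0 (2 * PI) (RInt g 0 (2 * PI))).
{ intros g Hg; apply (RInt_correct g), (ex_RInt_continuous (V := R_CompleteNormedModule)); auto. }
assert (L := is_RInt_minus _ _ _ _ _ _
  (is_RInt_minus _ _ _ _ _ _
    (is_RInt_minus _ _ _ _ _ _ (is_RInt_scal _ _ _ (cre c) _ (I _ C0)) (is_RInt_scal _ _ _ (cim1 c) _ (I _ C1)))
    (is_RInt_scal _ _ _ (cim2 c) _ (I _ C2)))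
  (is_RInt_scal _ _ _ (cim3 c) _ (I _ C3))).
eapply is_RInt_ext; [|exact L]; intros t _; reflexivity.
Qed.

Lemma qRInt_mul_l w G : qcont G -> qRInt (fun t => w * G t)%quat = (w * qRInt G)%quat.
Proof.
intros H; apply quat_eq_forms; intros c; rewrite qRInt_form.
- rewrite qmulA, qRInt_form by auto; apply RInt_ext; intros t _; now rewrite qmulA.
- intros c' t; apply continuous_ext with (2 := H (c' * w)%quat t); intros s; now rewrite qmulA.
Qed.

Lemma qRInt_mul_r w G : qcont G -> qRInt (fun t => G t * w)%quat = (qRInt G * w)%quat.
Proof.
assert (E : forall c p, cre (c * (p * w))%quat = cre (w * c * p)%quat) by qrring.
intros H; apply quat_eq_forms; intros c; rewrite qRInt_form.
- rewrite E, qRInt_form by auto; apply RInt_ext; intros t _; now rewrite E.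
- intros c' t; apply continuous_ext with (2 := H (w * c')%quat t); intros s; now rewrite E.
Qed.

Lemma qcont_add G H : qcont G -> qcont H -> qcont (fun t => G t + H t)%quat.
Proof.
intros HG HH c t; apply continuous_ext with (fun t => plus (cre (c * G t)%quat) (cre (c * H t)%quat)).
- intros s; now rewrite qmulDr.
- apply (continuous_plus (V := R_NormedModule)); [apply HG | apply HH].
Qed.

Lemma qRInt_add G H : qcont G -> qcont H ->
  qRInt (fun t => G t + H t)%quat = (qRInt G + qRInt H)%quat.
Proof.
intros HG HH; apply quat_eq_forms; intros c; rewrite qRInt_form by now apply qcont_add.
rewrite qmulDr, cre_add, !qRInt_form by auto.
rewrite <- (RInt_plus (V := R_CompleteNormedModule)).
- apply RInt_ext; intros t _; now rewrite qmulDr.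
- apply (ex_RInt_continuous (V := R_CompleteNormedModule)); intros; apply HG.
- apply (ex_RInt_continuous (V := R_CompleteNormedModule)); intros; apply HH.
Qed.

Lemma qcont_slice I k1 k2 G : (forall t, continuous k1 t) -> (forall t, continuous k2 t) -> qcont G ->
  qcont (fun t => slice_pt I (k1 t) (k2 t) * G t)%quat.
Proof.
intros H1 H2 HG c t.
apply continuous_ext with (fun t => plus (mult (k1 t) (cre (c * G t)%quat)) (mult (k2 t) (cre (c * I * G t)%quat))).
- intros s; generalize (G s); intros g; rewrite slice_ptE, <- (qmulA c I), qmulDr.
  unfold plus, mult; simpl; rewrite cre_add; f_equal; qrring.
- apply (continuous_plus (V := R_NormedModule)); apply (continuous_mult (K := R_AbsRing)); auto; apply HG.
Qed.

Lemma qcont_const w : qcont (fun _ => w).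
Proof. intros c t; apply continuous_const. Qed.

Lemma qcont_nsq G : qcont G -> forall t, continuous (fun t => nsq (G t)) t.
Proof.
intros H; destruct (qcont_components G H) as (C0 & C1 & C2 & C3).
assert (S : forall g : R -> R, (forall t, continuous g t) -> forall t, continuous (fun t => g t ^ 2) t).
{ intros g Hg t; apply continuous_ext with (fun t => mult (g t) (g t));
    [intros; unfold mult; simpl; ring | now apply (continuous_mult (K := R_AbsRing))]. }
intros t; exact (continuous_plus (V := R_NormedModule) _ _ _ (continuous_plus (V := R_NormedModule) _ _ _
    (continuous_plus (V := R_NormedModule) _ _ _ (S _ C0 t) (S _ C1 t)) (S _ C2 t)) (S _ C3 t)).
Qed.

Lemma qcont_bounded G : qcont G -> exists M, forall t, 0 <= t <= 2 * PI -> nsq (G t) <= M.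
Proof.
intros H; destruct (continuity_ab_maj (fun t => nsq (G t)) 0 (2 * PI) two_PI_pos) as (m & Hm & _).
- intros t _; apply continuity_pt_filterlim, (qcont_nsq G H).
- exists (nsq (G m)); exact Hm.
Qed.

(** The factor four comes from estimating the components separately. *)
Lemma qRInt_bound G M : qcont G -> (forall t, 0 <= t <= 2 * PI -> qnorm (G t) <= M) ->
  qnorm (qRInt G) <= 4 * (2 * PI * M).
Proof.
intros H HM; destruct (qcont_components G H) as (C0 & C1 & C2 & C3).
assert (B : forall g : R -> R, (forall t, continuous g t) -> (forall t, Rabs (g t) <= qnorm (G t)) ->
   Rabs (RInt g 0 (2 * PI)) <= 2 * PI * M).
{ intros g Hg Hgb; replace (2 * PI * M) with ((2 * PI - 0) * M) by ring.
  apply abs_RInt_le_const; [apply two_PI_pos | |].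
  - apply (ex_RInt_continuous (V := R_CompleteNormedModule)); auto.
  - intros t Ht; eapply Rle_trans; [apply Hgb | now apply HM]. }
eapply Rle_trans; [apply qnorm_le_components|].
assert (B0 := B _ C0 (fun t => proj1 (components_le_qnorm (G t)))).
assert (B1 := B _ C1 (fun t => proj1 (proj2 (components_le_qnorm (G t))))).
assert (B2 := B _ C2 (fun t => proj1 (proj2 (proj2 (components_le_qnorm (G t)))))).
assert (B3 := B _ C3 (fun t => proj2 (proj2 (proj2 (components_le_qnorm (G t)))))).
change (Rabs (RInt (fun t => cre (G t)) 0 (2 * PI)) + Rabs (RInt (fun t => cim1 (G t)) 0 (2 * PI)) +
  Rabs (RInt (fun t => cim2 (G t)) 0 (2 * PI)) + Rabs (RInt (fun t => cim3 (G t)) 0 (2 * PI)) <=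
  4 * (2 * PI * M)).
replace (4 * (2 * PI * M)) with (2 * PI * M + 2 * PI * M + 2 * PI * M + 2 * PI * M) by ring.
repeat apply Rplus_le_compat; assumption.
Qed.

(** The inverse of [zeta = rho exp(I th)]. *)
Definition circle_inv (I : quat) (rho th : R) : quat := slice_pt I (cos th / rho) (- sin th / rho).

Definition cauchy_kernel (I : quat) (x0 y0 rho th : R) : quat :=
  slice_pt I (cauchy_re x0 y0 rho th) (cauchy_im x0 y0 rho th).

(** [zeta / (zeta - z0) = 1 + (z0 / zeta) * zeta / (zeta - z0)]. *)
Lemma cauchy_kernel_step I x0 y0 rho th : imag_unit I -> 0 < rho -> x0 ^ 2 + y0 ^ 2 < rho ^ 2 ->
  cauchy_kernel I x0 y0 rho th =
  (qreal 1 + slice_pt I x0 y0 * (circle_inv I rho th * cauchy_kernel I x0 y0 rho th))%quat.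
Proof.
intros HI Hr H0; assert (P := cauchy_den_pos x0 y0 rho th H0).
set (X := rho * cos th - x0); set (Y := rho * sin th - y0); set (d := cauchy_den x0 y0 rho th) in *.
assert (Ed : d = X ^ 2 + Y ^ 2) by reflexivity.
assert (E : (circle_inv I rho th * cauchy_kernel I x0 y0 rho th)%quat = slice_pt I (X / d) (- Y / d)).
{ unfold circle_inv, cauchy_kernel; rewrite slice_pt_mul by auto; unfold cauchy_re, cauchy_im.
  fold X; fold Y; fold d; assert (H := cos2_sin2 th); f_equal.
  - replace (X / d) with (X / d * (cos th ^ 2 + sin th ^ 2)) by (rewrite H; ring); field; repeat split; lra.
  - replace (- Y / d) with (- Y / d * (cos th ^ 2 + sin th ^ 2)) by (rewrite H; ring); field; repeat split; lra. }
rewrite E, slice_pt_mul by auto; unfold cauchy_kernel, cauchy_re, cauchy_im; fold X; fold Y; fold d.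
replace (rho * cos th) with (X + x0) by (unfold X; ring).
replace (rho * sin th) with (Y + y0) by (unfold Y; ring).
replace (((X + x0) * X + (Y + y0) * Y) / d) with (1 + (x0 * (X / d) - y0 * (- Y / d)))
  by (clearbody d; subst d; field; repeat split; lra).
replace (((Y + y0) * X - (X + x0) * Y) / d) with (x0 * (- Y / d) + y0 * (X / d)) by (field; repeat split; lra).
unfold slice_pt; qring.
Qed.

Lemma nsq_circle_inv I rho th : imag_unit I -> 0 < rho -> nsq (circle_inv I rho th) = / rho ^ 2.
Proof.
intros HI Hr; unfold circle_inv; rewrite nsq_slice_pt by auto.
replace (/ rho ^ 2) with ((cos th ^ 2 + sin th ^ 2) / rho ^ 2) by (rewrite cos2_sin2; field; repeat split; lra).
field; repeat split; lra.
Qed.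

Lemma qpow_circle_inv I rho th m : imag_unit I -> 0 < rho ->
  qpow (circle_inv I rho th) m =
  slice_pt I (cos (INR m * th) / rho ^ m) (- sin (INR m * th) / rho ^ m).
Proof.
intros HI Hr; induction m as [|m IH].
- simpl INR; rewrite Rmult_0_l, cos_0, sin_0; simpl; unfold slice_pt.
  replace (1 / 1) with 1 by field; replace (- 0 / 1) with 0 by field; qring.
- rewrite S_INR; simpl qpow; rewrite IH; unfold circle_inv; rewrite slice_pt_mul by auto.
  replace ((INR m + 1) * th) with (th + INR m * th) by ring; rewrite cos_plus, sin_plus.
  assert (0 < rho ^ m) by (apply pow_lt; auto); f_equal; simpl; field; repeat split; lra.
Qed.

Lemma qcont_circle_inv I rho G : 0 < rho -> qcont G -> qcont (fun th => circle_inv I rho th * G th)%quat.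
Proof.
intros Hr H; unfold circle_inv; apply qcont_slice; auto; intros t;
  apply (ex_derive_continuous (K := R_AbsRing) (V := R_NormedModule)); auto_derive; lra.
Qed.

Lemma qcont_pow_circle_inv I rho G m : 0 < rho -> qcont G ->
  qcont (fun th => qpow (circle_inv I rho th) m * G th)%quat.
Proof.
intros Hr H; induction m as [|m IH].
- intros c t; apply continuous_ext with (2 := H c t); intros s; simpl; now rewrite qmul1l.
- intros c t; apply continuous_ext with (2 := qcont_circle_inv I rho _ Hr IH c t).
  intros s; simpl; now rewrite <- (qmulA (circle_inv I rho s)).
Qed.

Lemma qcont_cauchy_kernel I x0 y0 rho G : x0 ^ 2 + y0 ^ 2 < rho ^ 2 -> qcont G ->
  qcont (fun th => cauchy_kernel I x0 y0 rho th * G th)%quat.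
Proof.
intros H HG; unfold cauchy_kernel; apply qcont_slice; auto; intros t; apply (continuous_cauchy_kernel x0 y0 rho t H).
Qed.

(** The coefficient of index [m] of the Cauchy transform of [G]. *)
Definition circle_coef (I : quat) (rho : R) (G : R -> quat) (m : nat) : quat :=
  qscal (/ (2 * PI)) (qRInt (fun th => qpow (circle_inv I rho th) m * G th)%quat).

(** Iterating [cauchy_kernel_step] develops the kernel into a geometric series;
    the remainder is of order [(|z0| / rho)^n]. *)
Lemma cauchy_transform_series I x0 y0 rho G : imag_unit I -> 0 < rho -> x0 ^ 2 + y0 ^ 2 < rho ^ 2 ->
  qcont G ->
  tends (psum (circle_coef I rho G) (slice_pt I x0 y0))
    (qscal (/ (2 * PI)) (qRInt (fun th => cauchy_kernel I x0 y0 rho th * G th)%quat)).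
Proof.
intros HI Hr H0 HG; set (z := slice_pt I x0 y0); set (K := cauchy_kernel I x0 y0 rho).
pose (KG := fun th => (K th * G th)%quat).
assert (HKG : qcont KG) by exact (qcont_cauchy_kernel I x0 y0 rho G H0 HG).
pose (B := circle_coef I rho KG); pose (A := circle_coef I rho G).
assert (step : forall n, B n = (A n + z * B (S n))%quat).
{ intros n; unfold B, A, circle_coef.
  replace (z * qscal (/ (2 * PI)) (qRInt (fun th => qpow (circle_inv I rho th) (S n) * KG th)%quat))%quat
   with (qscal (/ (2 * PI)) (z * qRInt (fun th => qpow (circle_inv I rho th) (S n) * KG th)%quat)%quat) by qring.
  assert (C : qcont (fun th => qpow (circle_inv I rho th) (S n) * KG th)%quat)
    by now apply qcont_pow_circle_inv.
  rewrite <- qRInt_mul_l by exact C.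
  replace (qscal (/ (2 * PI)) (qRInt (fun th => (qpow (circle_inv I rho th) n * G th)%quat)) +
    qscal (/ (2 * PI)) (qRInt (fun th => (z * (qpow (circle_inv I rho th) (S n) * KG th))%quat)))%quat
   with (qscal (/ (2 * PI)) (qRInt (fun th => (qpow (circle_inv I rho th) n * G th)%quat) +
     qRInt (fun th => (z * (qpow (circle_inv I rho th) (S n) * KG th))%quat)))%quat by qring.
  rewrite <- qRInt_add.
  - do 2 f_equal; apply functional_extensionality; intros th; unfold KG.
    unfold K at 1; rewrite cauchy_kernel_step by auto; fold z; fold K.
    rewrite qmulDl, qmul1l, qmulDr; f_equal.
    rewrite qpow_S_r, !qmulA; f_equal; f_equal; f_equal.
    rewrite qpow_circle_inv by auto; unfold z; now apply slice_pt_comm.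
  - now apply qcont_pow_circle_inv.
  - intros c t; apply continuous_ext with (2 := C (c * z)%quat t); intros s.
    rewrite (qmulA c z); reflexivity. }
assert (E : forall n, (B O - psum A z n = qpow z (S n) * B (S n))%quat).
{ induction n as [|n IH].
  - rewrite psum_0, (step O); simpl; qring.
  - rewrite psum_S.
    replace (B O - (psum A z n + qpow z (S n) * A (S n)))%quat with
      ((B O - psum A z n) - qpow z (S n) * A (S n))%quat by qring.
    rewrite IH, (step (S n)), (qpow_S_r z (S n)); qring. }
assert (EB : B O = qscal (/ (2 * PI)) (qRInt KG)).
{ unfold B, circle_coef; do 2 f_equal; apply functional_extensionality; intros th; apply qmul1l. }
fold KG; rewrite <- EB; fold A.
destruct (qcont_bounded KG HKG) as [M HM].
assert (HPI := PI_RGT_0).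
assert (HM0 : 0 <= M) by (eapply Rle_trans; [apply nsq_ge0 | apply (HM 0); lra]).
assert (HB : forall n, qnorm (B n) * rho ^ n <= 4 * sqrt M).
{ intros n; unfold B, circle_coef; rewrite qscalE, qnormM, qnorm_real, Rabs_pos_eq
    by (apply Rlt_le, Rinv_0_lt_compat; lra).
  assert (P : 0 < rho ^ n) by (apply pow_lt; auto).
  assert (Q : qnorm (qRInt (fun th => (qpow (circle_inv I rho th) n * KG th)%quat)) <=
     4 * (2 * PI * (sqrt M / rho ^ n))).
  { apply qRInt_bound; [now apply qcont_pow_circle_inv|]; intros t Ht.
    rewrite qnormM, qnorm_pow, (qnorm_nsq (circle_inv I rho t)), nsq_circle_inv by auto.
    replace (sqrt (/ rho ^ 2)) with (/ rho).
    2:{ symmetry; apply sqrt_lem_1; [apply Rlt_le, Rinv_0_lt_compat, pow_lt; auto |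
          apply Rlt_le, Rinv_0_lt_compat; auto | field; repeat split; lra]. }
    rewrite pow_inv, Rmult_comm; unfold Rdiv; apply Rmult_le_compat_r;
      [apply Rlt_le, Rinv_0_lt_compat; auto | apply sqrt_le_1_alt, HM, Ht]. }
  apply Rle_trans with (/ (2 * PI) * (4 * (2 * PI * (sqrt M / rho ^ n))) * rho ^ n).
  - apply Rmult_le_compat_r; [lra|]; apply Rmult_le_compat_l; [apply Rlt_le, Rinv_0_lt_compat; lra | exact Q].
  - right; field; split; lra. }
assert (Hz : qnorm z < rho).
{ assert (N := qnorm_ge0 z); assert (N2 := qnorm_sqr z); unfold z in N2 at 2.
  rewrite nsq_slice_pt in N2 by auto; nra. }
assert (N := qnorm_ge0 z).
apply tends_of_incr, tends_squeeze with (fun n => (4 * sqrt M) * ((qnorm z / rho) * (qnorm z / rho) * (qnorm z / rho) ^ n)).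
- intros n; rewrite qnorm_sub_sym, E, qnormM, qnorm_pow.
  assert (P : 0 < rho ^ S (S n)) by (apply pow_lt; auto).
  apply Rle_trans with ((qnorm z ^ S (S n) / rho ^ S (S n)) * (qnorm (B (S (S n))) * rho ^ S (S n))).
  + right; field; repeat split; lra.
  + replace (4 * sqrt M * (qnorm z / rho * (qnorm z / rho) * (qnorm z / rho) ^ n)) with
      ((qnorm z ^ S (S n) / rho ^ S (S n)) * (4 * sqrt M)).
    * apply Rmult_le_compat_l; [|apply HB].
      apply Rmult_le_pos; [apply pow_le; auto | apply Rlt_le, Rinv_0_lt_compat; auto].
    * unfold Rdiv at 1; rewrite <- pow_inv, <- Rpow_mult_distr; fold (qnorm z / rho); simpl; ring.
- apply is_lim_seq_ext with (fun n => (4 * sqrt M * (qnorm z / rho * (qnorm z / rho))) * (qnorm z / rho) ^ n);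
    [intros n; ring|].
  apply is_lim_seq_scal_geom; split; [apply Rmult_le_pos; [auto | apply Rlt_le, Rinv_0_lt_compat; auto]|].
  apply Rmult_lt_reg_r with rho; [auto|]; unfold Rdiv; rewrite Rmult_assoc, Rinv_l; lra.
Qed.

(** Orthogonality of the powers on a circle, read as the statement that the
    Cauchy transform of the constant 1 is the series 1. *)
Lemma circle_coef_1 I rho m : imag_unit I -> 0 < rho ->
  circle_coef I rho (fun _ => qreal 1) m = cst (qreal 1) m.
Proof.
intros HI Hr; assert (HPI := PI_RGT_0); unfold circle_coef.
assert (C := qcont_pow_circle_inv I rho _ m Hr (qcont_const (qreal 1))).
apply quat_eq_forms; intros c.
replace (cre (c * qscal (/ (2 * PI)) (qRInt (fun th => (qpow (circle_inv I rho th) m * qreal 1)%quat)))%quat)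
 with (/ (2 * PI) * cre (c * qRInt (fun th => (qpow (circle_inv I rho th) m * qreal 1)%quat))%quat)
 by (generalize (qRInt (fun th => (qpow (circle_inv I rho th) m * qreal 1)%quat)); intros w; generalize (/ (2 * PI)); qrring).
rewrite qRInt_form by exact C.
assert (E : forall th, cre (c * (qpow (circle_inv I rho th) m * qreal 1))%quat =
  cre c * (cos (INR m * th) / rho ^ m) + cre (c * I)%quat * (- sin (INR m * th) / rho ^ m)).
{ intros th; rewrite qpow_circle_inv, qmul1r by auto; unfold slice_pt.
  generalize (cos (INR m * th) / rho ^ m) (- sin (INR m * th) / rho ^ m); qrring. }
rewrite (RInt_ext _ _ _ _ (fun th _ => E th)).
assert (P : 0 < rho ^ m) by (apply pow_lt; auto).
destruct m as [|m].
- rewrite (RInt_ext _ (fun _ => cre c)).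
  + rewrite (RInt_const (V := R_CompleteNormedModule)); unfold scal; simpl; unfold mult; simpl.
    rewrite qmul1r; field; lra.
  + intros th _; simpl INR; rewrite Rmult_0_l, cos_0, sin_0; simpl; field.
- replace (cre (c * cst (qreal 1) (S m))%quat) with 0 by (simpl cst; qrring).
  apply Rmult_eq_0_compat_l, is_RInt_unique.
  assert (HN : INR (S m) <> 0) by (apply not_0_INR; lia).
  remember (INR (S m)) as N eqn:EN; remember (rho ^ S m) as r eqn:Er.
  set (W := fun th => cre c * (sin (N * th) / r / N) + cre (c * I)%quat * (cos (N * th) / r / N)).
  replace 0 with (minus (W (2 * PI)) (W 0)) at 2.
  + apply (is_RInt_derive (V := R_CompleteNormedModule)).
    * intros th _; unfold W; auto_derive; auto; field; split; [lra | auto].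
    * intros th _; apply (ex_derive_continuous (K := R_AbsRing) (V := R_NormedModule)); auto_derive; auto.
  + change (W (2 * PI) + - W 0 = 0); unfold W; rewrite !Rmult_0_r.
    replace (N * (2 * PI)) with (0 + 2 * INR (S m) * PI) by (rewrite <- EN; ring).
    rewrite sin_period, cos_period; ring.
Qed.

Lemma qRInt_cauchy_kernel I x0 y0 rho : imag_unit I -> 0 < rho -> x0 ^ 2 + y0 ^ 2 < rho ^ 2 ->
  qscal (/ (2 * PI)) (qRInt (cauchy_kernel I x0 y0 rho)) = qreal 1.
Proof.
intros HI Hr H0.
assert (T := cauchy_transform_series I x0 y0 rho _ HI Hr H0 (qcont_const (qreal 1))).
cbn beta in T; replace (fun th => (cauchy_kernel I x0 y0 rho th * qreal 1)%quat) with (cauchy_kernel I x0 y0 rho) in T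
  by (apply functional_extensionality; intros th; now rewrite qmul1r).
apply (tends_unique _ _ _ T); apply tends_ext with (fun _ => qreal 1); [|apply tends_const].
intros n; induction n as [|n IH].
- rewrite psum_0; now rewrite circle_coef_1.
- rewrite psum_S, <- IH, circle_coef_1 by auto; simpl; qring.
Qed.

(** On each slice the coefficients are those of the Cauchy integral formula
    and so may depend on the slice and on the circle. *)
Lemma slice_expansion f I rho : slice_regular f -> imag_unit I -> 0 < rho < 1 ->
  exists a, forall x y, x ^ 2 + y ^ 2 < rho ^ 2 -> tends (psum a (slice_pt I x y)) (f (slice_pt I x y)).
Proof.
intros Hf HI Hr; destruct (slice_regular_cauchy_riemann f I Hf HI) as [fx CR].
pose (G := fun th => f (slice_pt I (rho * cos th) (rho * sin th))).
assert (circ : forall th, (rho * cos th) ^ 2 + (rho * sin th) ^ 2 < 1).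
{ intros th; replace ((rho * cos th) ^ 2 + (rho * sin th) ^ 2) with (rho ^ 2 * (cos th ^ 2 + sin th ^ 2)) by ring.
  rewrite cos2_sin2; simpl; nra. }
assert (HG : qcont G).
{ intros c t; assert (Cd := continuous_disc (fun x y => cre (c * f (slice_pt I x y))%quat) _ _
    (rho * cos t) (rho * sin t)
    (fun x y H => let (D1, H1) := CR c x y H in let (D2, H2) := H1 in let (_, H3) := H2 in
       let (_, H4) := H3 in let (D5, _) := H4 in conj D1 (conj D2 D5)) (circ t)).
  apply (continuous_comp_2 (fun s => rho * cos s) (fun s => rho * sin s)
     (fun x y => cre (c * f (slice_pt I x y))%quat) t); [| |exact Cd];
   apply (ex_derive_continuous (K := R_AbsRing) (V := R_NormedModule)); auto_derive; auto. }
exists (circle_coef I rho G); intros x y Hxy.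
assert (T := cauchy_transform_series I x y rho G HI ltac:(lra) Hxy HG).
replace (f (slice_pt I x y)) with
  (qscal (/ (2 * PI)) (qRInt (fun th => (cauchy_kernel I x y rho th * G th)%quat))); [exact T|].
assert (HK : qcont (cauchy_kernel I x y rho)).
{ intros c t; apply continuous_ext with
   (2 := qcont_cauchy_kernel I x y rho _ Hxy (qcont_const (qreal 1)) c t); intros s; now rewrite qmul1r. }
replace (f (slice_pt I x y)) with (qreal 1 * f (slice_pt I x y))%quat by apply qmul1l.
rewrite <- (qRInt_cauchy_kernel I x y rho) by (auto; lra).
rewrite (qscalE _ (qRInt (cauchy_kernel I x y rho))), <- qmulA, <- qscalE; f_equal.
rewrite <- qRInt_mul_r by exact HK.
apply quat_eq_forms; intros c; rewrite !qRInt_form.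
- assert (F := cauchy_formula _ _ _ _ x y rho (CR c) Hr Hxy).
  assert (E : forall th p, cre (c * (cauchy_kernel I x y rho th * p))%quat =
    cauchy_re x y rho th * cre (c * p)%quat + cauchy_im x y rho th * cre (c * (I * p))%quat).
  { intros th p; unfold cauchy_kernel; rewrite slice_ptE, qmulDr, cre_add; f_equal; qrring. }
  transitivity (RInt (fun th => cauchy_re x y rho th * cre (c * f (slice_pt I (rho * cos th) (rho * sin th)))%quat +
      cauchy_im x y rho th * cre (c * (I * f (slice_pt I (rho * cos th) (rho * sin th))))%quat) 0 (2 * PI)).
  + apply RInt_ext; intros th _; apply E.
  + rewrite F; apply RInt_ext; intros th _; symmetry; apply E.
- now apply qcont_cauchy_kernel, qcont_const.
- now apply qcont_cauchy_kernel.
Qed.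

(** The expansions obtained on different slices and circles have the same values
    on a real interval, hence the same coefficients. *)
Theorem slice_regular_expansion f : slice_regular f -> exists a, has_expansion f a.
Proof.
intros Hf.
assert (HI0 : imag_unit (0, 1, 0, 0)).
{ unfold imag_unit; apply quat_ext; rewrite ?cre_opp, ?cim1_opp, ?cim2_opp, ?cim3_opp;
   unfold qmul, qreal, cre, cim1, cim2, cim3; cbn [fst snd]; lra. }
destruct (slice_expansion f _ (/ 2) Hf HI0 ltac:(lra)) as [a Ha].
exists a; intros q Hq; apply is_series_tends.
destruct (slice_decomposition q) as (I & x & y & HI & Eq).
(* The radius exceeds both [|q|] and the radius [/ 2] used for [a]. *)
set (rho := Rmax (/ 2) ((1 + qnorm q) / 2)).
assert (Hr : 0 < rho < 1).
{ unfold rho; split; [apply Rlt_le_trans with (/ 2); [lra | apply Rmax_l]|].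
  apply Rmax_lub_lt; [lra | unfold in_ball in Hq; lra]. }
assert (Hr2 : / 2 <= rho /\ qnorm q < rho).
{ unfold rho; split; [apply Rmax_l|]; apply Rlt_le_trans with ((1 + qnorm q) / 2); [unfold in_ball in Hq; lra | apply Rmax_r]. }
destruct (slice_expansion f I rho Hf HI Hr) as [b Hb].
replace a with b.
- rewrite Eq; apply Hb; rewrite <- (nsq_slice_pt I), <- Eq, <- qnorm_sqr by auto.
  assert (N := qnorm_ge0 q); nra.
- apply (series_inj_local b a (/ 2) ltac:(lra)); intros t Ht; exists (f (qreal t)).
  assert (T1 := Hb t 0 ltac:(nra)); assert (T2 := Ha t 0 ltac:(nra)).
  rewrite slice_pt_real in T1, T2; now split.
Qed.

(** * Sums of power series are slice regular *)

(** The coefficients of the derivative. *)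
Definition sderiv (a : nat -> quat) (m : nat) : quat := (qreal (INR (S m)) * a (S m))%quat.

(** Taylor's formula of first order for a power.  The two points are supposed to
    commute, as they do on a slice; the factors [r] avoid the exponent [m - 1]. *)
Lemma qpow_taylor z w r m : (w * z = z * w)%quat -> 0 < r -> qnorm z <= r -> qnorm w <= r ->
  qnorm (qpow w (S m) - qpow z (S m) - (w - z) * (qreal (INR (S m)) * qpow z m))%quat * r ^ 2 <=
  INR (S m) ^ 2 * r ^ S m * qnorm (w - z) ^ 2.
Proof.
intros C Hr Hz Hw; assert (D := qnorm_ge0 (w - z)).
assert (Cm : forall k, (w * qpow z k = qpow z k * w)%quat).
{ induction k as [|k IH]; simpl; [now rewrite qmul1l, qmul1r|].
  now rewrite qmulA, C, <- qmulA, IH, qmulA. }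
induction m as [|m IH].
- replace (qpow w 1 - qpow z 1 - (w - z) * (qreal (INR 1) * qpow z 0))%quat with (qreal 0)
    by (simpl; qring).
  rewrite qnorm_real, Rabs_R0; simpl; assert (0 <= r * r) by nra; nra.
- assert (E : (qpow w (S (S m)) - qpow z (S (S m)) - (w - z) * (qreal (INR (S (S m))) * qpow z (S m)) =
    w * (qpow w (S m) - qpow z (S m) - (w - z) * (qreal (INR (S m)) * qpow z m)) +
    qreal (INR (S m)) * ((w - z) * (w - z) * qpow z m))%quat).
  { rewrite (S_INR (S m)).
    change (qpow w (S (S m))) with (w * qpow w (S m))%quat.
    change (qpow z (S (S m))) with (z * qpow z (S m))%quat.
    assert (Ez : qpow z (S m) = (z * qpow z m)%quat) by reflexivity.
    set (d := (w - z)%quat); set (V := qpow z (S m)) in *; set (Y := (d * qpow z m)%quat).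
    assert (zd : (z * d = d * z)%quat).
    { unfold d; rewrite qmulDr, qmulDl; rewrite C; f_equal; qring. }
    assert (zY : (z * Y = d * V)%quat) by (unfold Y; now rewrite Ez, !qmulA, zd).
    assert (wE : w = (z + d)%quat) by (unfold d; qring).
    replace (d * (qreal (INR (S m)) * qpow z m))%quat with (qreal (INR (S m)) * Y)%quat
      by (unfold Y; clearbody d; qring).
    replace (d * d * qpow z m)%quat with (d * Y)%quat by (unfold Y; now rewrite qmulA).
    clearbody d V Y; generalize (qpow w (S m)) (INR (S m)); intros W k.
    replace (w * (W - V - qreal k * Y))%quat with (w * W - w * V - qreal k * (w * Y))%quat by qring.
    replace (w * V)%quat with (z * V + d * V)%quat by (rewrite wE; qring).
    replace (w * Y)%quat with (d * V + d * Y)%quat by (rewrite <- zY, wE; qring).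
    replace (d * (qreal (k + 1) * V))%quat with (qreal (k + 1) * (d * V))%quat by qring.
    generalize (w * W)%quat (z * V)%quat (d * V)%quat (d * Y)%quat; intros; qring. }
  rewrite E; eapply Rle_trans.
  { apply Rmult_le_compat_r; [apply pow2_ge_0 | apply qnorm_triangle]. }
  rewrite !qnormM, qnorm_real, qnorm_pow, Rabs_pos_eq by apply pos_INR.
  set (e := qnorm (qpow w (S m) - qpow z (S m) - (w - z) * (qreal (INR (S m)) * qpow z m))%quat) in *.
  set (d := qnorm (w - z)) in *; clearbody e d; clear E.
  assert (P : qnorm z ^ m <= r ^ m) by (apply pow_incr; split; [apply qnorm_ge0 | auto]).
  assert (P0 : 0 <= r ^ m) by (apply pow_le; lra).
  assert (N := pos_INR (S m)); rewrite (S_INR (S m)); set (k := INR (S m)) in *; clearbody k.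
  assert (Q := qnorm_ge0 w).
  replace ((qnorm w * e + k * (d * d * qnorm z ^ m)) * r ^ 2) with
    (qnorm w * (e * r ^ 2) + (k * (d * d) * r ^ 2) * qnorm z ^ m) by ring.
  apply Rle_trans with (r * (k ^ 2 * r ^ S m * d ^ 2) + (k * (d * d) * r ^ 2) * r ^ m).
  + apply Rplus_le_compat.
    * apply Rle_trans with (qnorm w * (k ^ 2 * r ^ S m * d ^ 2)); [apply Rmult_le_compat_l; auto|].
      apply Rmult_le_compat_r; auto; repeat apply Rmult_le_pos; try apply pow_le; try lra.
    * apply Rmult_le_compat_l; auto; repeat apply Rmult_le_pos; try lra; apply pow_le; lra.
  + replace (r * (k ^ 2 * r ^ S m * d ^ 2) + k * (d * d) * r ^ 2 * r ^ m) with
      ((k ^ 2 + k) * (r ^ S (S m) * d ^ 2)) by (simpl; ring).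
    replace ((k + 1) ^ 2 * r ^ S (S m) * d ^ 2) with ((k + 1) ^ 2 * (r ^ S (S m) * d ^ 2)) by ring.
    apply Rmult_le_compat_r; [|simpl; nra]; apply Rmult_le_pos; apply pow_le; lra.
Qed.

Lemma tame_quadratic a r : tame a -> 0 <= r < 1 ->
  exists C t, 0 <= C /\ 0 <= t < 1 /\ forall m, INR (S m) ^ 2 * (qnorm (a m) * r ^ m) <= C * t ^ m.
Proof.
intros Ha Hr; destruct (tame_geometric a r Ha Hr) as (C & t & HC & Ht & B).
destruct (linear_times_geom t Ht) as (K & s & HK & Hs & BK).
destruct (linear_times_geom s Hs) as (K' & s' & HK' & Hs' & BK').
exists (C * (K * K')), s'; split; [|split; [exact Hs'|]].
- repeat apply Rmult_le_pos; auto.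
- intros m; specialize (B m); specialize (BK m); specialize (BK' m).
  assert (N := pos_INR (S m)); set (k := INR (S m)) in *.
  apply Rle_trans with (k ^ 2 * (C * t ^ m)); [apply Rmult_le_compat_l; [apply pow2_ge_0 | auto]|].
  apply Rle_trans with (C * (k * (K * s ^ m))).
  + replace (k ^ 2 * (C * t ^ m)) with (C * (k * (k * t ^ m))) by ring.
    apply Rmult_le_compat_l; auto; apply Rmult_le_compat_l; auto.
  + replace (C * (k * (K * s ^ m))) with (C * (K * (k * s ^ m))) by ring.
    replace (C * (K * K') * s' ^ m) with (C * (K * (K' * s' ^ m))) by ring.
    apply Rmult_le_compat_l; auto; apply Rmult_le_compat_l; auto.
Qed.

Lemma tame_sderiv a : tame a -> tame (sderiv a).
Proof.
intros Ha r Hr; destruct (tame_quadratic (tail a) r (tame_tail a Ha) ltac:(lra)) as (C & t & HC & Ht & B).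
exists C; intros m; specialize (B m); unfold sderiv, tail in *.
rewrite qnormM, qnorm_real, Rabs_pos_eq by apply pos_INR.
assert (T : t ^ m <= 1) by (rewrite <- (pow1 m); apply pow_incr; lra).
assert (N : 1 <= INR (S m)) by (rewrite S_INR; assert (H := pos_INR m); lra).
assert (0 <= qnorm (a (S m)) * r ^ m) by (apply Rmult_le_pos; [apply qnorm_ge0 | apply pow_le; lra]).
assert (C * t ^ m <= C) by (rewrite <- (Rmult_1_r C) at 2; apply Rmult_le_compat_l; auto).
rewrite Rmult_assoc; set (X := qnorm (a (S m)) * r ^ m) in *; set (k := INR (S m)) in *.
assert (0 <= (k * (k - 1)) * X) by (apply Rmult_le_pos; auto; apply Rmult_le_pos; lra).
replace (k ^ 2 * X) with (k * X + k * (k - 1) * X) in B by ring; lra.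
Qed.

Lemma power_series_taylor a r : tame a -> 0 < r < 1 -> exists C, 0 <= C /\
  forall z w, (w * z = z * w)%quat -> qnorm z <= r -> qnorm w <= r ->
  qnorm (power_series a w - power_series a z - (w - z) * power_series (sderiv a) z)%quat <=
  C * qnorm (w - z) ^ 2.
Proof.
intros Ha Hr; destruct (tame_quadratic (tail a) r (tame_tail a Ha) ltac:(lra)) as (C & t & HC & Ht & B).
assert (P2 : 0 < r ^ 2) by (apply pow_lt; lra).
exists (C / r / (1 - t)); split.
{ repeat apply Rmult_le_pos; auto; apply Rlt_le, Rinv_0_lt_compat; lra. }
intros z w Hc Hz Hw; assert (Bz : in_ball z) by (unfold in_ball; lra).
assert (Bw : in_ball w) by (unfold in_ball; lra).
assert (T : tends (fun n => psum a w (S n) - psum a z (S n) - (w - z) * psum (sderiv a) z n)%quat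
   (power_series a w - power_series a z - (w - z) * power_series (sderiv a) z)%quat).
{ assert (T1 := tends_incr _ _ (psum_tends a w Ha Bw)).
  assert (T2 := tends_mul_l (- qreal 1)%quat _ _ (tends_incr _ _ (psum_tends a z Ha Bz))).
  assert (T3 := tends_mul_l (- (w - z))%quat _ _ (psum_tends (sderiv a) z (tame_sderiv a Ha) Bz)).
  assert (T4 := tends_add _ _ _ _ (tends_add _ _ _ _ T1 T2) T3).
  replace (power_series a w - power_series a z - (w - z) * power_series (sderiv a) z)%quat with
   (power_series a w + - qreal 1 * power_series a z + - (w - z) * power_series (sderiv a) z)%quat by qring.
  apply tends_ext with (2 := T4); intros n; qring. }
apply tends_le with (2 := T); intros n.
set (d := qnorm (w - z)); assert (Hd : 0 <= d) by apply qnorm_ge0.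
apply Rle_trans with (C / r / (1 - t) * (1 - t ^ S n) * d ^ 2).
- induction n as [|n IH].
  + replace (psum a w 1 - psum a z 1 - (w - z) * psum (sderiv a) z 0)%quat with (qreal 0).
    * rewrite qnorm_real, Rabs_R0; repeat apply Rmult_le_pos; auto; try (apply Rlt_le, Rinv_0_lt_compat; lra);
       simpl; nra.
    * rewrite !psum_S, !psum_0; unfold sderiv; simpl; qring.
  + rewrite (psum_S a w (S n)), (psum_S a z (S n)), (psum_S (sderiv a) z n).
    set (e := (qpow w (S (S n)) - qpow z (S (S n)) - (w - z) * (qreal (INR (S (S n))) * qpow z (S n)))%quat).
    replace (psum a w (S n) + qpow w (S (S n)) * a (S (S n)) -
      (psum a z (S n) + qpow z (S (S n)) * a (S (S n))) -
      (w - z) * (psum (sderiv a) z n + qpow z (S n) * sderiv a (S n)))%quat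
      with ((psum a w (S n) - psum a z (S n) - (w - z) * psum (sderiv a) z n) + e * a (S (S n)))%quat.
    2:{ unfold e, sderiv.
      replace (qpow z (S n) * (qreal (INR (S (S n))) * a (S (S n))))%quat with
        (qreal (INR (S (S n))) * qpow z (S n) * a (S (S n)))%quat by qring.
      generalize (w - z)%quat (qreal (INR (S (S n))) * qpow z (S n))%quat; intros; qring. }
    eapply Rle_trans; [apply qnorm_triangle|].
    replace (C / r / (1 - t) * (1 - t ^ S (S n)) * d ^ 2) with
      (C / r / (1 - t) * (1 - t ^ S n) * d ^ 2 + C / r * t ^ S n * d ^ 2) by (simpl; field; lra).
    apply Rplus_le_compat; [exact IH|]; rewrite qnormM.
    assert (Q := qpow_taylor z w r (S n) Hc ltac:(lra) Hz Hw); fold e d in Q.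
    assert (A0 := qnorm_ge0 (a (S (S n)))); specialize (B (S n)); unfold tail in B.
    apply Rmult_le_reg_r with (r ^ 2); [auto|].
    apply Rle_trans with (INR (S (S n)) ^ 2 * r ^ S (S n) * d ^ 2 * qnorm (a (S (S n)))).
    * replace (qnorm e * qnorm (a (S (S n))) * r ^ 2) with (qnorm e * r ^ 2 * qnorm (a (S (S n)))) by ring.
      apply Rmult_le_compat_r; auto.
    * replace (INR (S (S n)) ^ 2 * r ^ S (S n) * d ^ 2 * qnorm (a (S (S n)))) with
        ((INR (S (S n)) ^ 2 * (qnorm (a (S (S n))) * r ^ S n)) * (r * d ^ 2)) by (simpl; ring).
      replace (C / r * t ^ S n * d ^ 2 * r ^ 2) with (C * t ^ S n * (r * d ^ 2)) by (simpl; field; lra).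
      apply Rmult_le_compat_r; auto; apply Rmult_le_pos; [lra | apply pow2_ge_0].
- apply Rmult_le_compat_r; [apply pow2_ge_0|].
  assert (0 <= t ^ S n) by (apply pow_le; lra).
  rewrite <- (Rmult_1_r (C / r / (1 - t))) at 2; apply Rmult_le_compat_l; [|lra].
  repeat apply Rmult_le_pos; auto; apply Rlt_le, Rinv_0_lt_compat; lra.
Qed.

Lemma is_derive_of_quadratic (g : R -> quat) x l C d : 0 < d ->
  (forall t, Rabs (t - x) < d -> qnorm (g t - g x - qscal (t - x) l)%quat <= C * (t - x) ^ 2) ->
  is_derive (g : R -> quat) x l.
Proof.
intros Hd H; split; [apply is_linear_scal_l|].
intros y Hy; assert (E := is_filter_lim_locally_unique (V := R_NormedModule) x y Hy); subst y; clear Hy; intros eps.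
assert (HC : 0 <= Rabs C) by apply Rabs_pos.
assert (P : 0 < Rmin d (eps / (Rabs C + 1))).
{ apply Rmin_pos; auto; apply Rmult_lt_0_compat; [apply cond_pos | apply Rinv_0_lt_compat; lra]. }
exists (mkposreal _ P); intros t Ht.
unfold ball in Ht; simpl in Ht; unfold AbsRing_ball, abs, minus, plus, opp in Ht; simpl in Ht.
change (Rabs (t - x) < Rmin d (eps / (Rabs C + 1))) in Ht.
assert (H1 := Rlt_le_trans _ _ _ Ht (Rmin_l _ _)); assert (H2 := Rlt_le_trans _ _ _ Ht (Rmin_r _ _)).
rewrite norm_qnorm; change (qnorm (g t - g x - qscal (t - x) l)%quat <= eps * Rabs (t - x)).
eapply Rle_trans; [now apply H|]; rewrite <- (pow2_abs (t - x)).
assert (A := Rabs_pos (t - x)); assert (L := Rle_abs C).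
assert (E : Rabs (t - x) * (Rabs C + 1) <= eps).
{ apply Rmult_lt_compat_r with (r := Rabs C + 1) in H2; [|lra].
  unfold Rdiv in H2; rewrite Rmult_assoc, Rinv_l, Rmult_1_r in H2 by lra; lra. }
nra.
Qed.

Lemma slice_pt_sub I x y x' y' : (slice_pt I x y - slice_pt I x' y')%quat = slice_pt I (x - x') (y - y').
Proof. unfold slice_pt; qring. Qed.

Lemma qnorm_slice_pt_le I x y : imag_unit I -> qnorm (slice_pt I x y) <= Rabs x + Rabs y.
Proof.
intros HI; unfold slice_pt; eapply Rle_trans; [apply qnorm_triangle|].
rewrite qnormM, !qnorm_real; destruct (imag_unit_spec I HI) as [_ H].
apply qnorm_eq1 in H; rewrite H; lra.
Qed.

Lemma ball_margin q : in_ball q -> exists r d, 0 < r < 1 /\ 0 < d /\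
  qnorm q <= r /\ forall w, qnorm (w - q) < d -> qnorm w <= r.
Proof.
intros Hq; assert (Q := qnorm_ge0 q); unfold in_ball in Hq.
exists ((1 + qnorm q) / 2), ((1 - qnorm q) / 2); repeat split; try lra.
intros w Hw; assert (H := qsub_qnorm_le w q); lra.
Qed.

Lemma power_series_slice_derive a I x y : tame a -> imag_unit I -> in_ball (slice_pt I x y) ->
  is_derive (fun t => power_series a (slice_pt I t y)) x (power_series (sderiv a) (slice_pt I x y)) /\
  is_derive (fun t => power_series a (slice_pt I x t)) y (I * power_series (sderiv a) (slice_pt I x y))%quat.
Proof.
intros Ha HI Hb; destruct (ball_margin _ Hb) as (r & d & Hr & Hd & Hq & Hw).
destruct (power_series_taylor a r Ha Hr) as (C & HC & T).
assert (N : qnorm I = 1) by now apply qnorm_eq1, imag_unit_spec.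
split; apply is_derive_of_quadratic with C d; auto; intros t Ht.
- assert (E : (slice_pt I t y - slice_pt I x y = qreal (t - x))%quat)
    by (rewrite slice_pt_sub, <- (slice_pt_real I); f_equal; ring).
  specialize (T (slice_pt I x y) (slice_pt I t y) (slice_pt_comm _ _ _ _ _ HI) Hq).
  rewrite E, qnorm_real in T; rewrite <- (pow2_abs (t - x)), qscalE; apply T, Hw.
  now rewrite E, qnorm_real.
- assert (E : (slice_pt I x t - slice_pt I x y = qreal (t - y) * I)%quat)
    by (rewrite slice_pt_sub; unfold slice_pt; replace (x - x) with 0 by ring; qring).
  specialize (T (slice_pt I x y) (slice_pt I x t) (slice_pt_comm _ _ _ _ _ HI) Hq).
  rewrite E, qnormM, N, qnorm_real, Rmult_1_r in T; rewrite <- (pow2_abs (t - y)), qscalE, qmulA; apply T, Hw.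
  now rewrite E, qnormM, N, qnorm_real, Rmult_1_r.
Qed.

Lemma continuous_qnorm {U : UniformSpace} (g : U -> quat) (x : U) :
  (forall eps : posreal, locally x (fun y => qnorm (g y - g x)%quat < eps)) ->
  continuous (g : U -> quat) x.
Proof.
intros H.
refine (proj2 (filterlim_locally_ball_norm (K := R_AbsRing)
  (U := prod_NormedModule _ (prod_NormedModule _ (prod_NormedModule _ R_NormedModule R_NormedModule)
     R_NormedModule) R_NormedModule) g (g x)) _).
intros eps; apply filter_imp with (2 := H eps); intros y Hy.
unfold ball_norm; rewrite norm_qnorm; exact Hy.
Qed.

Lemma power_series_slice_continuous a I x y : tame a -> imag_unit I -> in_ball (slice_pt I x y) ->
  continuous (fun z : R * R => power_series a (slice_pt I (fst z) (snd z)) : quat) (x, y).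
Proof.
intros Ha HI Hb; destruct (ball_margin _ Hb) as (r & d & Hr & Hd & Hq & Hw).
destruct (power_series_taylor a r Ha Hr) as (C & HC & T).
set (z := slice_pt I x y) in *; set (L := qnorm (power_series (sderiv a) z) + 2 * C + 1).
assert (HL : 0 < L) by (unfold L; assert (H := qnorm_ge0 (power_series (sderiv a) z)); lra).
apply continuous_qnorm; intros eps; cbn [fst snd]; fold z.
assert (P : 0 < Rmin (d / 2) (eps / (2 * L))).
{ apply Rmin_pos; [lra|]; apply Rmult_lt_0_compat; [apply cond_pos | apply Rinv_0_lt_compat; lra]. }
exists (mkposreal _ P); intros [x' y'] [B1 B2]; simpl in B1, B2.
unfold ball in B1, B2; simpl in B1, B2; unfold AbsRing_ball, abs, minus, plus, opp in B1, B2; simpl in B1, B2.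
change (Rabs (x' - x) < Rmin (d / 2) (eps / (2 * L))) in B1.
change (Rabs (y' - y) < Rmin (d / 2) (eps / (2 * L))) in B2.
cbn [fst snd]; set (w := slice_pt I x' y').
assert (M1 := Rmin_l (d / 2) (eps / (2 * L))); assert (M2 := Rmin_r (d / 2) (eps / (2 * L))).
assert (D : qnorm (w - z) <= Rabs (x' - x) + Rabs (y' - y))
  by (unfold w, z; rewrite slice_pt_sub; now apply qnorm_slice_pt_le).
assert (D0 := qnorm_ge0 (w - z)).
assert (Hw' : qnorm w <= r) by (apply Hw; lra).
specialize (T z w (slice_pt_comm _ _ _ _ _ HI) Hq Hw').
assert (D2 : qnorm (w - z) <= 2).
{ unfold in_ball in Hb; assert (T2 := qnorm_triangle w (- z)%quat); rewrite qnormN in T2; lra. }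
replace (power_series a w - power_series a z)%quat with
  ((power_series a w - power_series a z - (w - z) * power_series (sderiv a) z) +
   (w - z) * power_series (sderiv a) z)%quat by qring.
eapply Rle_lt_trans; [apply qnorm_triangle|]; rewrite qnormM.
apply Rle_lt_trans with (L * qnorm (w - z)).
{ assert (0 <= C * qnorm (w - z) * (2 - qnorm (w - z))) by (repeat apply Rmult_le_pos; lra).
  unfold L; lra. }
apply Rle_lt_trans with (L * (Rabs (x' - x) + Rabs (y' - y))); [apply Rmult_le_compat_l; lra|].
apply Rlt_le_trans with (L * (eps / (2 * L) + eps / (2 * L))); [apply Rmult_lt_compat_l; lra|].
right; field; lra.
Qed.

Theorem power_series_slice_regular a : tame a -> slice_regular (power_series a).
Proof.
intros Ha I HI; pose (g := fun x y => power_series (sderiv a) (slice_pt I x y)).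
exists g, (fun x y => I * g x y)%quat; intros x y Hb.
destruct (power_series_slice_derive a I x y Ha HI Hb) as [D1 D2].
assert (Cg := power_series_slice_continuous (sderiv a) I x y (tame_sderiv a Ha) HI Hb).
refine (conj D1 (conj D2 (conj Cg (conj _ _)))).
- assert (K : tame (lscale I (sderiv a))) by now apply tame_lscale, tame_sderiv.
  apply continuous_ext_loc with (fun z : R * R => (power_series (lscale I (sderiv a)) (slice_pt I (fst z) (snd z)))).
  2:{ now apply power_series_slice_continuous. }
  assert (O : locally (x, y) (fun z : R * R => fst z ^ 2 + snd z ^ 2 < 1)).
  { apply open_disc; rewrite <- (nsq_slice_pt I) by auto; now apply qnorm_lt1. }
  apply filter_imp with (2 := O); intros [x' y'] H; cbn [fst snd] in *.
  assert (Hb' : in_ball (slice_pt I x' y')) by (apply qnorm_lt1; rewrite nsq_slice_pt; auto).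
  unfold g; apply power_series_tends.
  eapply tends_ext; [|apply tends_mul_l, (psum_tends (sderiv a) _ (tame_sderiv a Ha) Hb')].
  assert (CI : forall m, (I * qpow (slice_pt I x' y') m = qpow (slice_pt I x' y') m * I)%quat).
  { induction m as [|m IH]; simpl; [now rewrite qmul1l, qmul1r|].
    rewrite qmulA; replace (I * slice_pt I x' y')%quat with (slice_pt I x' y' * I)%quat
      by (unfold slice_pt; qring).
    now rewrite <- qmulA, IH, qmulA. }
  intros n; cbn beta; induction n as [|n IH]; [now rewrite !psum_0|].
  rewrite !psum_S, qmulDr, IH; unfold lscale; now rewrite qmulA, CI, <- qmulA.
- rewrite imag_unit_mul by auto; unfold g; qring.
Qed.

(** * Bounded functions belong to the Schur class *)

(** The inverse of a point of the circle of radius [/ rho] runs over the circle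
    of radius [rho], so that the orthogonality relations are those already
    used for the Cauchy kernel. *)
Lemma qRInt_pow_circle I rho m : imag_unit I -> 0 < rho ->
  qRInt (fun th => qpow (circle_inv I rho th) (S m)) = qreal 0.
Proof.
intros HI Hr; assert (HPI := PI_RGT_0); assert (H := circle_coef_1 I rho (S m) HI Hr).
unfold circle_coef in H; simpl cst in H.
replace (fun th => qpow (circle_inv I rho th) (S m)) with
  (fun th => (qpow (circle_inv I rho th) (S m) * qreal 1)%quat)
  by (apply functional_extensionality; intros th; apply qmul1r).
rewrite qscalE in H; apply qmul_eq0 in H; destruct H as [H|H]; [|exact H].
apply (f_equal cre) in H; unfold qreal, cre in H; simpl in H.
assert (P : 0 < / (2 * PI)) by (apply Rinv_0_lt_compat; lra); lra.
Qed.

Lemma qcont_psum I rho a n : 0 < rho -> qcont (fun th => psum a (circle_inv I rho th) n).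
Proof.
intros Hr; revert a; induction n as [|n IH]; intros a c t.
- apply continuous_ext with (fun _ => cre (c * a O)%quat); [intros s; now rewrite psum_0 | apply continuous_const].
- apply continuous_ext with (fun s => cre (c * (a O + circle_inv I rho s * psum (tail a) (circle_inv I rho s) n))%quat).
  + intros s; now rewrite psum_Sl.
  + apply (qcont_add _ _ (qcont_const (a O)) (qcont_circle_inv I rho _ Hr (IH (tail a)))).
Qed.

Lemma qRInt_circle_psum I rho b n : imag_unit I -> 0 < rho ->
  qRInt (fun th => circle_inv I rho th * psum b (circle_inv I rho th) n)%quat = qreal 0.
Proof.
intros HI Hr; assert (C1 : forall m, qcont (fun th => qpow (circle_inv I rho th) m)).
{ intros m c t; apply continuous_ext with
   (2 := qcont_pow_circle_inv I rho _ m Hr (qcont_const (qreal 1)) c t); intros s; now rewrite qmul1r. }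
assert (E : forall m, qRInt (fun th => qpow (circle_inv I rho th) (S m) * b m)%quat = qreal 0)
  by (intros m; rewrite qRInt_mul_r, qRInt_pow_circle, qmul0l; auto).
induction n as [|n IH].
- rewrite <- (E O); f_equal; apply functional_extensionality; intros th; rewrite psum_0; simpl; now rewrite qmul1r.
- replace (fun th => (circle_inv I rho th * psum b (circle_inv I rho th) (S n))%quat) with
    (fun th => (circle_inv I rho th * psum b (circle_inv I rho th) n + qpow (circle_inv I rho th) (S (S n)) * b (S n))%quat).
  + rewrite qRInt_add, IH, E; [apply qadd0l | apply qcont_circle_inv; auto; now apply qcont_psum |].
    intros c t; apply continuous_ext with (fun s => cre (b (S n) * c * qpow (circle_inv I rho s) (S (S n)))%quat);
      [intros s; generalize (qpow (circle_inv I rho s) (S (S n))); qrring | apply C1].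
  + apply functional_extensionality; intros th; rewrite psum_S, qmulDr; f_equal; simpl; now rewrite !qmulA.
Qed.

(** In [|a_0 + z p(z)|^2] the mixed term integrates to zero, which allows an
    induction on the number of coefficients. *)
Lemma parseval I rho a n : imag_unit I -> 0 < rho ->
  RInt (fun th => nsq (psum a (circle_inv I rho th) n)) 0 (2 * PI) =
  2 * PI * sum_n (fun m => (/ rho ^ 2) ^ m * nsq (a m)) n.
Proof.
intros HI Hr; revert a; induction n as [|n IH]; intros a.
- rewrite sum_O; simpl; rewrite Rmult_1_l.
  rewrite (RInt_ext _ (fun _ => nsq (a O))) by (intros; now rewrite psum_0).
  rewrite (RInt_const (V := R_CompleteNormedModule)); unfold scal; simpl; unfold mult; simpl; ring.
- set (P := fun th => psum (tail a) (circle_inv I rho th) n).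
  assert (CP : qcont P) by exact (qcont_psum I rho (tail a) n Hr).
  assert (CZ : qcont (fun th => circle_inv I rho th * P th)%quat) by exact (qcont_circle_inv I rho P Hr CP).
  rewrite (RInt_ext _ (fun th => plus (plus (nsq (a O)) (scal 2 (cre (qconj (a O) * (circle_inv I rho th * P th))%quat)))
      (scal (/ rho ^ 2) (nsq (P th))))).
  2:{ intros th _; rewrite psum_Sl, nsqD, nsqM, nsq_circle_inv by auto; fold (P th).
      unfold plus, scal; simpl; unfold mult; simpl; f_equal; f_equal; f_equal.
      generalize (circle_inv I rho th * P th)%quat (a O); qrring. }
  assert (X1 : ex_RInt (fun _ : R => nsq (a O)) 0 (2 * PI)) by apply ex_RInt_const.
  assert (X2 : ex_RInt (fun th => cre (qconj (a O) * (circle_inv I rho th * P th))%quat) 0 (2 * PI))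
    by (apply (ex_RInt_continuous (V := R_CompleteNormedModule)); intros; apply CZ).
  assert (X3 : ex_RInt (fun th => nsq (P th)) 0 (2 * PI))
    by (apply (ex_RInt_continuous (V := R_CompleteNormedModule)); intros; now apply qcont_nsq).
  assert (X2' : ex_RInt (fun th => scal 2 (cre (qconj (a O) * (circle_inv I rho th * P th))%quat)) 0 (2 * PI))
    by now apply (ex_RInt_scal (V := R_NormedModule)).
  assert (X3' : ex_RInt (fun th => scal (/ rho ^ 2) (nsq (P th))) 0 (2 * PI))
    by now apply (ex_RInt_scal (V := R_NormedModule)).
  rewrite (RInt_plus (V := R_CompleteNormedModule)); [|now apply (ex_RInt_plus (V := R_NormedModule)) | exact X3'].
  rewrite (RInt_plus (V := R_CompleteNormedModule)) by auto.
  rewrite !(RInt_scal (V := R_CompleteNormedModule)) by auto.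
  rewrite <- qRInt_form by auto; unfold P at 1; rewrite qRInt_circle_psum, qmul0r by auto.
  unfold P; rewrite IH, (RInt_const (V := R_CompleteNormedModule)).
  rewrite sum_SnlR.
  unfold plus, scal; simpl; unfold mult; simpl.
  change (cre (qreal 0)) with 0; rewrite !Rmult_0_r, Rplus_0_r, Rmult_1_l, Rminus_0_r.
  rewrite Rmult_plus_distr_l; f_equal.
  rewrite (Rmult_comm (/ _)), Rmult_assoc; f_equal; rewrite Rmult_comm, sum_scal_R.
  apply sum_n_ext; intros m; unfold tail.
  match goal with |- ?x = ?y => change (@eq R x y) end; simpl; ring.
Qed.

(** On each sphere [|q| = rho] the product [h * a] is dominated pointwise by
    [h]; Parseval turns this into an inequality between coefficients. *)
Lemma weighted_contraction a h n rho : tame a ->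
  (forall q, in_ball q -> nsq (power_series a q) <= 1) ->
  (forall m, (n < m)%nat -> h m = qreal 0) -> 0 < rho < 1 ->
  sum_n (fun m => (rho ^ 2) ^ m * nsq ((h ** a) m)) n <= sqsum h n.
Proof.
intros Ta Ha Hh Hrho; assert (HPI := PI_RGT_0).
assert (HI : imag_unit (0, 1, 0, 0)).
{ unfold imag_unit; apply quat_ext; rewrite ?cre_opp, ?cim1_opp, ?cim2_opp, ?cim3_opp;
   unfold qmul, qreal, cre, cim1, cim2, cim3; cbn [fst snd]; lra. }
set (I := (0, 1, 0, 0) : quat) in *; clearbody I.
assert (Hr : 0 < / rho) by (apply Rinv_0_lt_compat; lra).
assert (Er : / (/ rho) ^ 2 = rho ^ 2) by (field; lra).
pose (z := circle_inv I (/ rho)).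
assert (Nz : forall th, nsq (z th) = rho ^ 2) by (intros th; unfold z; now rewrite nsq_circle_inv).
assert (Qz : forall th, qnorm (z th) = rho).
{ intros th; rewrite qnorm_nsq, Nz; apply sqrt_lem_1; simpl; nra. }
assert (Bz : forall th, in_ball (z th)) by (intros th; unfold in_ball; rewrite Qz; lra).
set (c := h ** a).
assert (Th : tame h).
{ assert (X : exists C, forall m, qnorm (h m) <= C).
  { assert (Y : forall k, exists C, forall m, (m <= k)%nat -> qnorm (h m) <= C).
    { induction k as [|k [C HC]]; [exists (qnorm (h O)); intros m Hm; replace m with O by lia; lra|].
      exists (Rmax C (qnorm (h (S k)))); intros m Hm.
      destruct (Nat.eq_dec m (S k)) as [->|]; [apply Rmax_r|].
      eapply Rle_trans; [apply HC; lia | apply Rmax_l]. }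
    destruct (Y n) as [C HC]; exists C; intros m; destruct (le_lt_dec m n) as [L|L]; [now apply HC|].
    rewrite Hh, qnorm_real, Rabs_R0 by exact L; eapply Rle_trans; [apply qnorm_ge0 | apply (HC O); lia]. }
  destruct X as [C HC]; now apply tame_bounded with C. }
assert (Tc : tame c) by now apply tame_qconv.
assert (Ph : forall q, power_series h q = psum h q n).
{ intros q; apply power_series_tends.
  assert (X : forall k, psum h q (n + k) = psum h q n).
  { induction k as [|k IH]; [now rewrite Nat.add_0_r|].
    rewrite Nat.add_succ_r, psum_S, IH, Hh by lia; qring. }
  unfold tends; apply (is_lim_seq_incr_n _ n); apply is_lim_seq_ext with (fun _ => 0); [|apply is_lim_seq_const].
  intros k; now rewrite Nat.add_comm, X, qaddN, qnorm_real, Rabs_R0. }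
assert (pointwise : forall th, qnorm (power_series c (z th)) <= qnorm (psum h (z th) n)).
{ intros th; unfold c; rewrite power_series_qconv, qnormM, Ph by auto.
  set (w := psum h (z th) n); assert (Q := qnorm_ge0 w).
  destruct (classic (w = qreal 0)) as [E|E].
  - rewrite E, qnorm_real, Rabs_R0; lra.
  - assert (H1 : qnorm (power_series a (qinv w * z th * w)%quat) <= 1)
      by (apply qnorm_le1, Ha; now apply in_ball_conjugate).
    nra. }
destruct (tame_geometric c rho Tc ltac:(lra)) as (C & t & HC & Ht & Bc).
set (D := C / (1 - t)); assert (HD : 0 <= D)
  by (apply Rmult_le_pos; [auto | apply Rlt_le, Rinv_0_lt_compat; lra]).
destruct (qcont_bounded _ (qcont_psum I (/ rho) h n Hr)) as [M HM]; fold z in HM.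
set (H := sqrt M).
assert (near : forall N th, 0 <= th <= 2 * PI ->
  nsq (psum c (z th) N) <= nsq (psum h (z th) n) + (2 * H * D + D ^ 2) * t ^ N).
{ intros N th Hth.
  assert (R := psum_remainder c (z th) C t _ HC Ht (fun m => eq_ind_r (fun x => _ * x ^ m <= _) (Bc m) (Qz th))
     (psum_tends c (z th) Tc (Bz th)) N); fold D in R.
  assert (HH : qnorm (psum h (z th) n) <= H) by (apply sqrt_le_1_alt, HM, Hth).
  assert (T0 : 0 <= t ^ N <= 1) by (split; [apply pow_le; lra | rewrite <- (pow1 N); apply pow_incr; lra]).
  rewrite <- !qnorm_sqr; set (x := qnorm (psum h (z th) n)) in *.
  assert (x0 : 0 <= x) by apply qnorm_ge0.
  assert (B : qnorm (psum c (z th) N) <= x + D * t ^ N).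
  { eapply Rle_trans; [apply (qsub_qnorm_le _ (power_series c (z th)))|].
    apply Rplus_le_compat; [apply pointwise | rewrite qnorm_sub_sym; exact R]. }
  assert (y0 := qnorm_ge0 (psum c (z th) N)); set (y := qnorm (psum c (z th) N)) in *.
  assert (E0 : 0 <= D * t ^ N) by (apply Rmult_le_pos; lra).
  apply Rle_trans with ((x + D * t ^ N) ^ 2); [apply pow_incr; lra|].
  assert (0 <= (H - x) * (D * t ^ N)) by (apply Rmult_le_pos; lra).
  assert (0 <= (1 - t ^ N) * (D ^ 2 * t ^ N)) by (apply Rmult_le_pos; [lra | apply Rmult_le_pos; [apply pow2_ge_0 | lra]]).
  lra. }
assert (key : forall N, sum_n (fun m => (rho ^ 2) ^ m * nsq (c m)) n <=
   sqsum h n + (2 * H * D + D ^ 2) * t ^ (N + n)).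
{ intros N.
  assert (W : forall m u, 0 <= (rho ^ 2) ^ m * nsq (u m))
    by (intros; apply Rmult_le_pos; [apply pow_le, pow2_ge_0 | apply nsq_ge0]).
  apply Rle_trans with (sum_n (fun m => (rho ^ 2) ^ m * nsq (c m)) (N + n)).
  { apply sum_n_mono_R; [intros; apply W | lia]. }
  assert (P1 := parseval I (/ rho) c (N + n) HI Hr); assert (P2 := parseval I (/ rho) h n HI Hr).
  rewrite Er in P1, P2; fold z in P1, P2.
  apply Rle_trans with (sum_n (fun m => (rho ^ 2) ^ m * nsq (h m)) n + (2 * H * D + D ^ 2) * t ^ (N + n)).
  - apply Rmult_le_reg_l with (2 * PI); [lra|]; rewrite Rmult_plus_distr_l, <- P1, <- P2.
    replace (2 * PI * ((2 * H * D + D ^ 2) * t ^ (N + n))) with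
      (RInt (fun _ => (2 * H * D + D ^ 2) * t ^ (N + n)) 0 (2 * PI))
      by (rewrite (RInt_const (V := R_CompleteNormedModule)); unfold scal; simpl; unfold mult; simpl; ring).
    assert (X1 : ex_RInt (fun th => nsq (psum h (z th) n)) 0 (2 * PI)).
    { apply (ex_RInt_continuous (V := R_CompleteNormedModule)); intros; apply qcont_nsq, qcont_psum, Hr. }
    assert (X2 : ex_RInt (fun _ : R => (2 * H * D + D ^ 2) * t ^ (N + n)) 0 (2 * PI)) by apply ex_RInt_const.
    assert (X3 := RInt_plus (V := R_CompleteNormedModule) _ _ _ _ X1 X2).
    eapply Rle_trans; [|right; exact X3]; apply RInt_le.
    + apply two_PI_pos.
    + apply (ex_RInt_continuous (V := R_CompleteNormedModule)); intros; apply qcont_nsq, qcont_psum, Hr.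
    + now apply (ex_RInt_plus (V := R_NormedModule)).
    + intros th Hth; apply near; lra.
  - apply Rplus_le_compat_r, sum_n_le_R; intros m _.
    assert (0 <= (rho ^ 2) ^ m <= 1)
      by (split; [apply pow_le, pow2_ge_0 | rewrite <- (pow1 m); apply pow_incr; simpl; nra]).
    assert (N0 := nsq_ge0 (h m)); nra. }
assert (L : is_lim_seq (fun N => sqsum h n + (2 * H * D + D ^ 2) * t ^ (N + n)) (sqsum h n)).
{ apply is_lim_seq_plus_0; [apply is_lim_seq_const|].
  apply (is_lim_seq_incr_n (fun N => (2 * H * D + D ^ 2) * t ^ N) n); now apply is_lim_seq_scal_geom. }
exact (is_lim_seq_le _ _ _ _ key (is_lim_seq_const _) L).
Qed.

Lemma le_of_pow_scaled X Y n : 0 <= X ->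
  (forall r, 0 < r < 1 -> (r ^ 2) ^ n * X <= Y) -> X <= Y.
Proof.
intros HX H.
assert (L : is_lim_seq (fun k => ((1 - / INR (S (S k))) ^ 2) ^ n * X) X).
{ replace (Finite X) with (Finite (((1 - 0) ^ 2) ^ n * X)) by (f_equal; rewrite Rminus_0_r, pow1, pow1; ring).
  apply (is_lim_seq_continuous (fun s => ((1 - s) ^ 2) ^ n * X)).
  - apply derivable_continuous_pt; eexists; apply is_derive_Reals; auto_derive; auto.
  - apply is_lim_seq_ext with (fun k => / INR (k + 2)); [intros k; do 2 f_equal; lia|].
    apply (is_lim_seq_incr_n (fun k => / INR k) 2).
    replace (Finite 0) with (Rbar_inv p_infty) by reflexivity.
    apply is_lim_seq_inv; [apply is_lim_seq_INR | discriminate]. }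
refine (is_lim_seq_le _ _ _ _ (fun k => H (1 - / INR (S (S k))) _) L (is_lim_seq_const Y)).
assert (P : 1 < INR (S (S k))) by (rewrite !S_INR; assert (Q := pos_INR k); lra).
assert (0 < / INR (S (S k)) < 1); [|lra].
split; [apply Rinv_0_lt_compat; lra | rewrite <- Rinv_1; apply Rinv_lt_contravar; lra].
Qed.

(** Only the first [n] coefficients of [h] matter, so [h] may be cut off; then
    the radius in [weighted_contraction] tends to one. *)
Theorem schur_of_bounded a : tame a ->
  (forall q, in_ball q -> nsq (power_series a q) <= 1) -> schur a.
Proof.
intros Ta Ha h n.
pose (h' := fun m => if (m <=? n)%nat then h m else qreal 0).
assert (Hh : forall m, (m <= n)%nat -> h m = h' m)
  by (intros m Hm; unfold h'; now apply Nat.leb_le in Hm as ->).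
assert (Hh0 : forall m, (n < m)%nat -> h' m = qreal 0)
  by (intros m Hm; unfold h'; now apply Nat.leb_gt in Hm as ->).
rewrite (sqsum_ext h h') by auto.
rewrite (sqsum_ext (h ** a) (h' ** a)).
2:{ intros m Hm; apply qconv_ext; auto; intros k Hk; apply Hh; lia. }
apply (le_of_pow_scaled _ _ n); [apply sqsum_ge0|]; intros r Hr.
eapply Rle_trans; [|apply (weighted_contraction a h' n r); auto].
unfold sqsum; rewrite sum_scal_R; apply sum_n_le_R; intros m Hm.
apply Rmult_le_compat_r; [apply nsq_ge0|].
replace n with (m + (n - m))%nat at 1 by lia; rewrite pow_add.
assert (P : 0 <= (r ^ 2) ^ m) by (apply pow_le, pow2_ge_0).
assert (Q : (r ^ 2) ^ (n - m) <= 1) by (rewrite <- (pow1 (n - m)); apply pow_incr; simpl; nra).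
rewrite <- (Rmult_1_r ((r ^ 2) ^ m)) at 2; now apply Rmult_le_compat_l.
Qed.

(** * Inner series and their energy *)

(** Isometric Schur series; as functions they have boundary values of modulus
    one almost everywhere. *)
Definition inner (f : nat -> quat) : Prop := schur f /\ is_lim_seq (sqsum f) 1.

Lemma sqsum_parallelogram u v n :
  sqsum (u +: v) n + sqsum (u +: rscale v (- qreal 1)%quat) n = 2 * sqsum u n + 2 * sqsum v n.
Proof.
induction n as [|n IH]; rewrite ?sqsum_0, ?sqsum_S.
- unfold sadd, rscale; generalize (u O) (v O); qrring.
- assert (E : nsq ((u +: v) (S n)) + nsq ((u +: rscale v (- qreal 1)%quat) (S n)) =
    2 * nsq (u (S n)) + 2 * nsq (v (S n))) by (unfold sadd, rscale; generalize (u (S n)) (v (S n)); qrring).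
  lra.
Qed.

(** The defect [|h|^2 - |h g|^2] is a positive semidefinite quadratic form in
    [h], and the parallelogram law bounds it on sums. *)
Lemma defect_add g u v n : schur g ->
  sqsum (u +: v) n - sqsum ((u +: v) ** g) n <=
  2 * (sqsum u n - sqsum (u ** g) n) + 2 * (sqsum v n - sqsum (v ** g) n).
Proof.
intros Hg; assert (P1 := sqsum_parallelogram u v n).
assert (P2 := sqsum_parallelogram (u ** g) (v ** g) n).
assert (H := Hg (u +: rscale v (- qreal 1)%quat) n); rewrite qconvDl in H |- *.
replace (rscale v (- qreal 1)%quat ** g) with (rscale (v ** g) (- qreal 1)%quat) in H; [lra|].
replace (rscale v (- qreal 1)%quat) with (lscale (- qreal 1)%quat v)
  by (apply sext; intros m; unfold lscale, rscale; qring).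
rewrite lscale_qconv; apply sext; intros m; unfold lscale, rscale; qring.
Qed.

Lemma split_head h : h = cst (h O) +: shift (tail h).
Proof.
apply sext; intros [|m]; unfold sadd; simpl; unfold tail; [now rewrite qadd0r | now rewrite qadd0l].
Qed.

Lemma defect_finite_support g K h : inner g -> (forall m, (K < m)%nat -> h m = qreal 0) ->
  is_lim_seq (fun n => sqsum h n - sqsum (h ** g) n) 0.
Proof.
intros [Hg Lg]; revert h.
assert (C : forall c, is_lim_seq (fun n => sqsum (cst c) n - sqsum (cst c ** g) n) 0).
{ intros c; apply is_lim_seq_ext with (fun n => nsq c * (1 - sqsum g n)).
  - intros n; rewrite sqsum_cst, cst_qconv, sqsum_lscale; ring.
  - apply is_lim_seq_scal_0; replace (Finite 0) with (Finite (1 - 1)) by (f_equal; ring).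
    apply is_lim_seq_minus'; [apply is_lim_seq_const | exact Lg]. }
induction K as [|K IH]; intros h Hh.
- replace h with (cst (h O)); [apply C|]; apply sext; intros [|m]; [easy | symmetry; apply Hh; lia].
- apply is_lim_seq_incr_1.
  apply is_lim_seq_0_le with (fun n => 2 * (sqsum (cst (h O)) (S n) - sqsum (cst (h O) ** g) (S n)) +
     2 * (sqsum (tail h) n - sqsum (tail h ** g) n)).
  + intros n; split; [assert (H := Hg h (S n)); lra|].
    rewrite (split_head h) at 1 2; eapply Rle_trans; [now apply defect_add|].
    rewrite shift_qconv, !sqsum_shift; lra.
  + apply is_lim_seq_plus_0.
    * apply is_lim_seq_scal_0; exact (proj1 (is_lim_seq_incr_1 _ _) (C (h O))).
    * apply is_lim_seq_scal_0, IH; intros m Hm; apply Hh; lia.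
Qed.

(** Right multiplication by an inner series is isometric: the defect form
    vanishes on monomials, hence on their span, and is continuous. *)
Lemma inner_isometry g h l : inner g -> is_lim_seq (sqsum h) (Finite l) ->
  is_lim_seq (fun n => sqsum h n - sqsum (h ** g) n) 0.
Proof.
intros Hg Hl; apply is_lim_seq_spec; intros eps.
assert (Hl' := proj2 (is_lim_seq_spec _ _) Hl).
destruct (Hl' (mkposreal (eps / 8) ltac:(assert (H := cond_pos eps); lra))) as [K HK]; cbn [pos] in HK.
(* [u] is a polynomial and the norm of [v] is small. *)
pose (u := fun m => if (m <=? K)%nat then h m else qreal 0).
pose (v := fun m => if (m <=? K)%nat then qreal 0 else h m).
assert (E : h = u +: v).
{ apply sext; intros m; unfold sadd, u, v; destruct (m <=? K)%nat; [now rewrite qadd0r | now rewrite qadd0l]. }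
assert (Hu : forall m, (K < m)%nat -> u m = qreal 0)
  by (intros m Hm; unfold u; now apply Nat.leb_gt in Hm as ->).
assert (Hv : forall n, sqsum v (K + n) = sqsum h (K + n) - sqsum h K).
{ induction n as [|n IH].
  - rewrite Nat.add_0_r; assert (Z : sqsum v K = sqsum (cst (qreal 0)) K).
    { apply sqsum_ext; intros m Hm; unfold v; apply Nat.leb_le in Hm as ->; now destruct m. }
    rewrite Z, sqsum_cst, nsq_real; ring.
  - rewrite Nat.add_succ_r, !sqsum_S, IH; unfold v at 1.
    replace (S (K + n) <=? K)%nat with false by (symmetry; apply Nat.leb_gt; lia); ring. }
assert (Lu := proj2 (is_lim_seq_spec _ _) (defect_finite_support g K u Hg Hu)).
destruct (Lu (mkposreal (eps / 8) ltac:(assert (H := cond_pos eps); lra))) as [N HN]; cbn [pos] in HN.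
exists (N + K)%nat; intros n Hn; rewrite Rminus_0_r.
destruct Hg as [Hg _]; assert (D := Hg h n); rewrite Rabs_pos_eq by lra.
assert (A := defect_add g u v n Hg); rewrite <- E in A.
specialize (HN n ltac:(lia)); rewrite Rminus_0_r in HN; apply Rabs_def2 in HN.
assert (V : sqsum v n = sqsum h n - sqsum h K) by (replace n with (K + (n - K))%nat by lia; apply Hv).
assert (V0 := sqsum_ge0 (v ** g) n).
assert (B1 := HK K ltac:(lia)); assert (B2 := HK n ltac:(lia)); apply Rabs_def2 in B1, B2.
assert (H := cond_pos eps); lra.
Qed.

(** Summation by parts turns this into [sum_m m |f_m|^2] when [f] is inner.  For
    a Blaschke product on the complex disc that is the winding number along the
    circle, hence the number of zeros. *)
Definition energy (f : nat -> quat) (n : nat) : R := sum_n (fun m => 1 - sqsum f m) n.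

Lemma energy_S f n : energy f (S n) = energy f n + (1 - sqsum f (S n)).
Proof. apply (sum_SnR (fun m => 1 - sqsum f m)). Qed.

Lemma energy_0 f : energy f 0 = 1 - sqsum f 0.
Proof. apply (sum_O (fun m => 1 - sqsum f m)). Qed.

Lemma energy_mono f n m : schur f -> (n <= m)%nat -> energy f n <= energy f m.
Proof.
intros Hf; induction 1 as [|m Hm IH]; [lra|]; rewrite energy_S.
assert (H := schur_sqsum f (S m) Hf); lra.
Qed.

Lemma rM_sqsum p g n :
  sqsum g n = sqsum (rM p ** g) n + (1 - nsq p) * nsq ((geom (qconj p) ** g) n).
Proof.
assert (H := blaschke_defect_left p (geom (qconj p) ** g) n).
rewrite !qconvA, geom_inv_l, cst1_qconv in H; rewrite H, rM_alt; reflexivity.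
Qed.

Lemma rM_energy p g n :
  energy (rM p ** g) n = energy g n + (1 - nsq p) * sqsum (geom (qconj p) ** g) n.
Proof.
induction n as [|n IH].
- rewrite !energy_0, (rM_sqsum p g), (sqsum_0 (geom _ ** g)); ring.
- rewrite !energy_S, IH, (rM_sqsum p g), (sqsum_S (geom _ ** g)); ring.
Qed.

Lemma sqsum_geom w n : nsq w < 1 -> sqsum (geom w) n = (1 - nsq w ^ S n) / (1 - nsq w).
Proof.
intros Hw; rewrite <- sum_geom by (split; [apply nsq_ge0 | exact Hw]).
apply sum_n_ext; intros m; apply nsq_pow.
Qed.

Lemma sqsum_geom_cv w : nsq w < 1 -> is_lim_seq (sqsum (geom w)) (/ (1 - nsq w)).
Proof.
intros Hw; assert (P := nsq_ge0 w).
apply is_lim_seq_ext with (fun n => / (1 - nsq w) + (- (nsq w / (1 - nsq w))) * nsq w ^ n).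
- intros n; rewrite sqsum_geom by exact Hw; simpl; field; lra.
- apply is_lim_seq_plus_0; [apply is_lim_seq_const | now apply is_lim_seq_scal_geom].
Qed.

(** Normalized kernels have norm one, and multiplying them by an inner series
    does not change this. *)
Lemma rM_kernel_cv p g : in_ball p -> inner g ->
  is_lim_seq (fun n => (1 - nsq p) * sqsum (geom (qconj p) ** g) n) 1.
Proof.
intros Hp Hg; assert (Hp' : nsq p < 1) by now apply qnorm_lt1.
assert (Hc : nsq (qconj p) < 1) by now rewrite nsq_conj.
assert (L := sqsum_geom_cv _ Hc); assert (D := inner_isometry g _ _ Hg L); rewrite nsq_conj in L.
replace (Finite 1) with (Finite ((1 - nsq p) * (/ (1 - nsq p) - 0))) by (f_equal; field; lra).
apply is_lim_seq_mult'; [apply is_lim_seq_const|].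
apply is_lim_seq_ext with (fun n => sqsum (geom (qconj p)) n -
  (sqsum (geom (qconj p)) n - sqsum (geom (qconj p) ** g) n)); [intros; ring|].
now apply is_lim_seq_minus'.
Qed.

Lemma inner_of_rM p f g : in_ball p -> inner f -> schur g -> f = rM p ** g -> inner g.
Proof.
intros Hp [Hf Lf] Hg E; split; [exact Hg|].
apply is_lim_seq_le_le with (sqsum f) (fun _ => 1); [|exact Lf | apply is_lim_seq_const].
intros n; split; [|now apply schur_sqsum].
assert (Hp' : nsq p < 1) by now apply qnorm_lt1.
rewrite E; assert (H := rM_sqsum p g n); assert (P := nsq_ge0 ((geom (qconj p) ** g) n)); nra.
Qed.

(** The energy rises by the norm of a normalized kernel multiplied by [g]. *)
Lemma energy_rM p g l : in_ball p -> inner g -> is_lim_seq (energy g) (Finite l) ->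
  is_lim_seq (energy (rM p ** g)) (Finite (l + 1)).
Proof.
intros Hp Hg L; eapply is_lim_seq_ext; [intros n; symmetry; apply rM_energy|].
apply is_lim_seq_plus'; [exact L | now apply rM_kernel_cv].
Qed.

(** * Series of finite rank *)

Definition defect_sum (vs : list (nat -> quat)) (h : nat -> quat) (n : nat) : R :=
  fold_right (fun v s => nsq ((h ** v) n) + s) 0 vs.

(** The defect of [f] is a sum of [k] squares; in terms of kernels,
    [(1 - f(x) conj(f(y))) / (1 - x y)] is a sum of [k] products
    [v(x) conj(v(y))].  This is the bound on the degree that is visibly
    invariant under Moebius transformations. *)
Definition rank_le (k : nat) (f : nat -> quat) : Prop :=
  exists vs, length vs = k /\
    forall h n, sqsum h n = sqsum (h ** f) n + defect_sum vs h n.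

Lemma defect_sum_ge0 vs h n : 0 <= defect_sum vs h n.
Proof. induction vs as [|v vs IH]; simpl; [lra|]; assert (H := nsq_ge0 ((h ** v) n)); lra. Qed.

Lemma defect_sum_map (F : (nat -> quat) -> (nat -> quat)) c vs h h' n :
  (forall v, nsq ((h ** F v) n) = c * nsq ((h' ** v) n)) ->
  defect_sum (map F vs) h n = c * defect_sum vs h' n.
Proof. intros H; induction vs as [|v vs IH]; simpl; [ring | rewrite H, IH; ring]. Qed.

Lemma nsq_qconv_scaled h v c n : 0 <= c ->
  nsq ((h ** rscale v (qreal (sqrt c))) n) = c * nsq ((h ** v) n).
Proof.
intros Hc; rewrite <- qconv_cst, qconvA, qconv_cst; unfold rscale.
rewrite nsqM, nsq_real, <- Rsqr_pow2, Rsqr_sqrt by auto; ring.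
Qed.

Lemma rank_le_schur k f : rank_le k f -> schur f.
Proof.
intros (vs & _ & H) h n; rewrite (H h n); assert (P := defect_sum_ge0 vs h n); lra.
Qed.

Lemma rank_le_cst u : nsq u = 1 -> rank_le 0 (cst u).
Proof.
intros Hu; exists nil; split; [easy|]; intros h n; simpl.
rewrite qconv_cst, sqsum_rscale, Hu; ring.
Qed.

Lemma rank_le_rM k p g : in_ball p -> rank_le k g -> rank_le (S k) (rM p ** g).
Proof.
intros Hp (vs & Hk & H); assert (Hp' : nsq p < 1) by now apply qnorm_lt1.
exists (rscale (geom (qconj p)) (qreal (sqrt (1 - nsq p))) :: map (fun v => rM p ** v) vs); split.
- simpl; now rewrite length_map, Hk.
- intros h n; simpl; rewrite nsq_qconv_scaled by lra.
  rewrite (defect_sum_map _ 1 vs h (h ** rM p)) by (intros v; rewrite qconvA; ring).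
  rewrite (rM_defect p h n), (H (h ** rM p) n), qconvA; ring.
Qed.

(** The defect of the transform is [1 - |a|^2] times the defect of [f] composed
    with the inverse of the denominator, so the number of squares is the same. *)
Lemma rank_le_moebius k f a g : nsq a < 1 -> rank_le k f -> is_moebius f a g -> rank_le k g.
Proof.
intros Ha Hf Hg; assert (Sf := rank_le_schur k f Hf); destruct Hf as (vs & Hk & H).
destruct (inverse_exists (mden f a)) as (u & _ & Hu).
{ apply mden_0_neq0; auto; apply qnorm_le1, schur_coef, Sf. }
exists (map (fun v => rscale (u ** v) (qreal (sqrt (1 - nsq a)))) vs); split; [now rewrite length_map|].
intros h n; rewrite (defect_sum_map _ (1 - nsq a) vs h (h ** u)).
2:{ intros v; rewrite nsq_qconv_scaled by lra; now rewrite qconvA. }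
assert (D := is_moebius_defect f a g u Hg Hu h n); rewrite (H (h ** u) n) in D.
ring_simplify in D; ring_simplify; lra.
Qed.

(** The functional [h |-> (h ** v) n] has norm at most one; it is tested on its
    norming series. *)
Lemma rank_vector_le1 vs v n :
  (forall h n, defect_sum vs h n <= sqsum h n) -> In v vs -> sqsum v n <= 1.
Proof.
intros H Hv; destruct (norming_series v n) as (h & E1 & E2).
assert (B : nsq ((h ** v) n) <= defect_sum vs h n).
{ clear - Hv; induction vs as [|w vs IH]; [easy|]; simpl.
  assert (P := nsq_ge0 ((h ** w) n)); assert (Q := defect_sum_ge0 vs h n).
  destruct Hv as [->|Hv]; [lra | specialize (IH Hv); lra]. }
assert (C : sqsum v n ^ 2 <= nsq ((h ** v) n)).
{ rewrite <- E1; unfold nsq; assert (P1 := pow2_ge_0 (cim1 ((h ** v) n)));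
  assert (P2 := pow2_ge_0 (cim2 ((h ** v) n))); assert (P3 := pow2_ge_0 (cim3 ((h ** v) n))); lra. }
assert (D := H h n); rewrite E2 in D; assert (P := sqsum_ge0 v n).
destruct (Rle_lt_dec (sqsum v n) 1); [auto | simpl in C; nra].
Qed.

(** For [h = 1] the defect identity says that [1 - sqsum f m] is the sum of the
    [|v_m|^2], so the energy is the sum of [k] norms of vectors. *)
Lemma rank_le_energy k f n : rank_le k f -> energy f n <= INR k.
Proof.
intros (vs & Hk & H).
assert (B : forall h n, defect_sum vs h n <= sqsum h n)
  by (intros h m; rewrite (H h m); assert (P := sqsum_ge0 (h ** f) m); lra).
assert (D : forall m, 1 - sqsum f m = defect_sum vs (cst (qreal 1)) m).
{ intros m; assert (E := H (cst (qreal 1)) m); rewrite cst1_qconv, sqsum_cst, nsq_real in E; lra. }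
assert (V : forall v, In v vs -> sqsum v n <= 1) by (intros v Hv; now apply (rank_vector_le1 vs)).
assert (E : energy f n = sum_n (fun m => defect_sum vs (cst (qreal 1)) m) n)
  by (apply sum_n_ext; intros m; apply D).
rewrite E, <- Hk; clear - V; induction vs as [|v vs IH].
- simpl; induction n as [|n IHn]; [rewrite sum_O; lra | rewrite sum_SnR; specialize (IHn (fun v (F : In v nil) => False_ind _ F)); lra].
- change (length (v :: vs)) with (S (length vs)); rewrite S_INR.
  assert (E : sum_n (fun m => defect_sum (v :: vs) (cst (qreal 1)) m) n =
    sqsum v n + sum_n (fun m => defect_sum vs (cst (qreal 1)) m) n).
  { clear; induction n as [|n IHn].
    - rewrite !sum_O, sqsum_0; simpl; now rewrite cst1_qconv.
    - rewrite !sum_SnR, IHn, sqsum_S; simpl; rewrite cst1_qconv; ring. }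
  rewrite E; assert (V1 := V v (or_introl eq_refl)); assert (I := IH (fun w Hw => V w (or_intror Hw))); lra.
Qed.

(** A bounded sum of the terms [1 - sqsum f n] makes them tend to zero. *)
Lemma rank_le_inner k f : rank_le k f -> inner f.
Proof.
intros Hf; split; [now apply rank_le_schur with k|]; destruct Hf as (vs & _ & H).
assert (B : forall h n, defect_sum vs h n <= sqsum h n)
  by (intros h m; rewrite (H h m); assert (P := sqsum_ge0 (h ** f) m); lra).
assert (L : is_lim_seq (fun n => defect_sum vs (cst (qreal 1)) n) 0).
{ assert (V : forall v, In v vs -> is_lim_seq (fun n => nsq (v n)) 0).
  { intros v Hv; destruct (sqsum_bounded_cv v 1) as [l Hl]; [intros n; now apply (rank_vector_le1 vs)|].
    now apply sqsum_cv_term with l. }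
  clear - V; induction vs as [|v vs IH]; simpl; [apply is_lim_seq_const|].
  apply is_lim_seq_plus_0; [|apply IH; intros w Hw; apply V; now right].
  apply is_lim_seq_ext with (fun n => nsq (v n)); [intros n; now rewrite cst1_qconv | apply V; now left]. }
apply is_lim_seq_ext with (fun n => 1 + -1 * defect_sum vs (cst (qreal 1)) n).
- intros n; assert (E := H (cst (qreal 1)) n); rewrite cst1_qconv, sqsum_cst, nsq_real in E; lra.
- apply is_lim_seq_plus_0; [apply is_lim_seq_const | now apply is_lim_seq_scal_0].
Qed.

(** * Series converging beyond the closed ball *)

Definition decays (f : nat -> quat) : Prop :=
  exists rho C, 1 < rho /\ 0 <= C /\ forall m, qnorm (f m) * rho ^ m <= C.

Lemma decays_cst u : decays (cst u).
Proof.
exists 2, (qnorm u); split; [lra|]; split; [apply qnorm_ge0|]; intros [|m]; simpl; [lra|].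
rewrite qnorm_real, Rabs_R0; assert (H := qnorm_ge0 u); lra.
Qed.

Lemma decays_rM p g : in_ball p -> decays g -> decays (rM p ** g).
Proof.
intros Hp (rho & C & Hr & HC & H); unfold in_ball in Hp; assert (P := qnorm_ge0 p).
set (q := qnorm p) in *; set (r := Rmin rho (2 / (1 + q))); set (t := 2 * q / (1 + q)).
assert (X : 1 < 2 / (1 + q)) by (apply Rmult_lt_reg_r with (1 + q); [lra|]; field_simplify; lra).
assert (Hr1 : 1 < r) by (now apply Rmin_glb_lt).
assert (Ht : 0 <= t < 1).
{ unfold t; split; [apply Rmult_le_pos; [lra | apply Rlt_le, Rinv_0_lt_compat; lra]|].
  apply Rmult_lt_reg_r with (1 + q); [lra|]; field_simplify; lra. }
assert (Hqr : q * r <= t).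
{ apply Rle_trans with (q * (2 / (1 + q))); [apply Rmult_le_compat_l; [auto | apply Rmin_r] | right; unfold t; field; lra]. }
set (e := geom (qconj p) ** g); set (D := C / (1 - t)).
assert (HD : 0 <= D) by (apply Rmult_le_pos; [auto | apply Rlt_le, Rinv_0_lt_compat; lra]).
assert (ED : C + t * D = D) by (unfold D; field; lra).
assert (Bg : forall m, qnorm (g m) * r ^ m <= C).
{ intros m; eapply Rle_trans; [|apply (H m)]; apply Rmult_le_compat_l; [apply qnorm_ge0|].
  apply pow_incr; split; [lra | apply Rmin_l]. }
assert (Be : forall m, qnorm (e m) * r ^ m <= D).
{ induction m as [|m IH].
  - unfold e; rewrite qconv_0; simpl; rewrite Rmult_1_r.
    unfold geom; simpl; rewrite qmul1l; specialize (Bg O); simpl in Bg; nra.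
  - assert (R : e (S m) = (g (S m) + qconj p * e m)%quat).
    { unfold e; rewrite qconv_S; unfold geom at 1; simpl; rewrite qmul1l; f_equal.
      change (tail (geom (qconj p))) with (lscale (qconj p) (geom (qconj p))); now rewrite lscale_qconv. }
    rewrite R; apply Rle_trans with ((qnorm (g (S m)) + q * qnorm (e m)) * r ^ S m).
    + apply Rmult_le_compat_r; [apply pow_le; lra|]; eapply Rle_trans; [apply qnorm_triangle|].
      rewrite qnormM, qnorm_conj; apply Rle_refl.
    + rewrite Rmult_plus_distr_r; specialize (Bg (S m)).
      assert (q * qnorm (e m) * r ^ S m <= t * D).
      { replace (q * qnorm (e m) * r ^ S m) with ((q * r) * (qnorm (e m) * r ^ m)) by (simpl; ring).
        apply Rmult_le_compat; auto; [nra|].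
        apply Rmult_le_pos; [apply qnorm_ge0 | apply pow_le; lra]. }
      lra. }
exists r, ((1 + r) * D); split; [auto|]; split; [nra|]; intros m.
replace (rM p ** g) with (lin (- p)%quat (qreal 1) ** e) by (unfold e; now rewrite rM_alt, qconvA).
rewrite lin_qconv; unfold sadd, lscale.
apply Rle_trans with ((q * qnorm (e m) + qnorm (shift (fun k => (qreal 1 * e k)%quat) m)) * r ^ m).
- apply Rmult_le_compat_r; [apply pow_le; lra|]; eapply Rle_trans; [apply qnorm_triangle|].
  rewrite qnormM, qnormN; apply Rle_refl.
- rewrite Rmult_plus_distr_r, Rmult_plus_distr_r, Rmult_1_l; apply Rplus_le_compat.
  + specialize (Be m); assert (0 <= qnorm (e m) * r ^ m)
      by (apply Rmult_le_pos; [apply qnorm_ge0 | apply pow_le; lra]); nra.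
  + destruct m as [|m]; simpl; [rewrite qnorm_real, Rabs_R0; nra|].
    rewrite qmul1l; specialize (Be m).
    replace (qnorm (e m) * (r * r ^ m)) with (r * (qnorm (e m) * r ^ m)) by ring.
    apply Rmult_le_compat_l; lra.
Qed.

Lemma decays_lin c d e : decays e -> decays (lin c d ** e).
Proof.
intros (r & D & Hr & HD & Be); exists r, (qnorm c * D + qnorm d * (r * D)).
assert (C0 := qnorm_ge0 c); assert (D0 := qnorm_ge0 d).
split; [auto|]; split.
{ apply Rplus_le_le_0_compat; repeat apply Rmult_le_pos; lra. }
intros m; rewrite lin_qconv; unfold sadd.
apply Rle_trans with ((qnorm c * qnorm (e m) + qnorm (shift (lscale d e) m)) * r ^ m).
- apply Rmult_le_compat_r; [apply pow_le; lra|]; eapply Rle_trans; [apply qnorm_triangle|].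
  unfold lscale at 1; rewrite qnormM; apply Rle_refl.
- rewrite Rmult_plus_distr_r, Rmult_assoc; apply Rplus_le_compat.
  + apply Rmult_le_compat_l; auto.
  + destruct m as [|m]; simpl.
    * rewrite qnorm_real, Rabs_R0, Rmult_0_l; repeat apply Rmult_le_pos; lra.
    * unfold lscale; rewrite qnormM.
      replace (qnorm d * qnorm (e m) * (r * r ^ m)) with (qnorm d * (r * (qnorm (e m) * r ^ m))) by ring.
      apply Rmult_le_compat_l; auto; apply Rmult_le_compat_l; [lra | auto].
Qed.

Lemma decays_tails f p e : in_ball p -> decays f ->
  (forall m, e m = power_series (fun j => f (S m + j)%nat) p) -> decays e.
Proof.
intros Hp (rho & C & Hr & HC & H) He; assert (P := qnorm_ge0 p); unfold in_ball in Hp.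
exists rho, (C / (1 - qnorm p)); split; [auto|]; split.
{ apply Rmult_le_pos; [auto | apply Rlt_le, Rinv_0_lt_compat; lra]. }
intros m; assert (R0 : 0 < rho ^ m) by (apply pow_lt; lra).
apply Rmult_le_reg_r with (/ rho ^ m); [now apply Rinv_0_lt_compat|].
rewrite Rmult_assoc, Rinv_r, Rmult_1_r, He by lra.
replace (C / (1 - qnorm p) * / rho ^ m) with (C / rho ^ m / (1 - qnorm p)) by (field; lra).
apply power_series_bound; auto; intros j.
apply Rmult_le_reg_r with (rho ^ m); [auto|].
replace (C / rho ^ m * rho ^ m) with C by (field; lra).
eapply Rle_trans; [|apply (H (S m + j)%nat)]; apply Rmult_le_compat_l; [apply qnorm_ge0|].
apply Rle_pow; [lra | lia].
Qed.

(** * Perturbation of the radius *)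

Definition dilate (r : R) (f : nat -> quat) (m : nat) : quat := (qreal (r ^ m) * f m)%quat.

Lemma dilate_qconv r a b : dilate r (a ** b) = dilate r a ** dilate r b.
Proof.
apply sext; intros n; unfold dilate at 1; revert a; induction n as [|n IH]; intros a.
- rewrite !qconv_0; unfold dilate; simpl; qring.
- rewrite !qconv_S.
  replace (tail (dilate r a)) with (lscale (qreal r) (dilate r (tail a)))
    by (apply sext; intros m; unfold lscale, dilate, tail; simpl; rewrite <- qrealM; now rewrite qmulA).
  rewrite lscale_qconv; unfold lscale; rewrite <- IH, qmulDr; f_equal.
  + unfold dilate; generalize (r ^ S n) (a O) (b (S n)); intros; simpl; qring.
  + simpl; rewrite <- qrealM; now rewrite qmulA.
Qed.

Lemma dilate_cst r c : dilate r (cst c) = cst c.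
Proof. apply sext; intros [|m]; unfold dilate; simpl; qring. Qed.

Lemma sqsum_add_le s u v n : 0 < s -> sqsum (u +: v) n <= (1 + / s) * sqsum u n + (1 + s) * sqsum v n.
Proof.
intros Hs; assert (E : forall p q, nsq (p + q)%quat <= (1 + / s) * nsq p + (1 + s) * nsq q).
{ intros p q; assert (H := nsq_ge0 (p - qreal s * q)%quat).
  assert (I : nsq (p - qreal s * q)%quat = nsq p - 2 * s * qdot p q + s ^ 2 * nsq q) by (generalize s; qrring).
  rewrite nsqD; rewrite I in H; apply Rmult_le_reg_l with s; [auto|].
  replace (s * ((1 + / s) * nsq p + (1 + s) * nsq q)) with (s * nsq p + nsq p + s * (1 + s) * nsq q) by (field; lra).
  nra. }
induction n as [|n IH]; rewrite ?sqsum_0, ?sqsum_S; [apply E|].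
assert (E1 := E (u (S n)) (v (S n))); unfold sadd in *; lra.
Qed.

(** The inequality of Young for convolutions, by induction on the degree of [d].
    The bounds [w] are taken positive because their ratios serve as weights in
    [sqsum_add_le]; with these weights the squares add up to the square of the
    sum. *)
Lemma young d w h n : (forall m, qnorm (d m) <= w m) -> (forall m, 0 < w m) ->
  sqsum (h ** d) n <= (sum_n w n) ^ 2 * sqsum h n.
Proof.
revert d w; induction n as [|n IH]; intros d w Hd Hw.
- rewrite sum_O, !sqsum_0, qconv_0, nsqM, Rmult_comm; apply Rmult_le_compat_r; [apply nsq_ge0|].
  rewrite <- qnorm_sqr; apply pow_incr; split; [apply qnorm_ge0 | apply Hd].
- rewrite sum_SnlR.
  set (W := sum_n (fun m => w (S m)) n).
  assert (HW : 0 < W).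
  { unfold W; clear - Hw; induction n as [|n IH]; [rewrite sum_O; apply Hw|].
    rewrite sum_SnR; assert (H := Hw (S (S n))); lra. }
  assert (H0 := Hw O).
  assert (E : h ** d = rscale h (d O) +: shift (h ** tail d))
    by (rewrite (split_head d) at 1; now rewrite qconvDr, qconv_cst, qconv_shift).
  rewrite E; eapply Rle_trans; [apply (sqsum_add_le (w O / W)); now apply Rdiv_lt_0_compat|].
  rewrite sqsum_rscale, sqsum_shift.
  assert (B0 : nsq (d O) <= w O ^ 2)
    by (rewrite <- qnorm_sqr; apply pow_incr; split; [apply qnorm_ge0 | apply Hd]).
  assert (B1 := IH (tail d) (fun m => w (S m)) (fun m => Hd (S m)) (fun m => Hw (S m))); fold W in B1.
  assert (P := sqsum_mono h n (S n) (Nat.le_succ_diag_r n)); assert (P0 := sqsum_ge0 h n).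
  set (X := sqsum h (S n)) in *.
  assert (B2 : sqsum (h ** tail d) n <= W ^ 2 * X)
    by (eapply Rle_trans; [exact B1|]; apply Rmult_le_compat_l; [apply pow2_ge_0 | auto]).
  apply Rle_trans with ((1 + / (w O / W)) * (X * w O ^ 2) + (1 + w O / W) * (W ^ 2 * X)).
  + apply Rplus_le_compat; apply Rmult_le_compat_l; auto.
    * assert (0 < / (w O / W)) by (apply Rinv_0_lt_compat, Rdiv_lt_0_compat; auto); lra.
    * apply Rmult_le_compat_l; lra.
    * assert (0 < w O / W) by (apply Rdiv_lt_0_compat; auto); lra.
  + right; field; lra.
Qed.

Lemma pow_sub_le s r m : 0 <= r <= s -> 1 <= s -> Rabs (r ^ m - 1) <= INR m * Rabs (r - 1) * s ^ m.
Proof.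
intros Hr Hs; induction m as [|m IH]; [simpl; rewrite Rminus_diag, Rabs_R0; lra|].
replace (r ^ S m - 1) with (r * (r ^ m - 1) + (r - 1)) by (simpl; ring).
eapply Rle_trans; [apply Rabs_triang|]; rewrite Rabs_mult, (Rabs_pos_eq r) by lra.
assert (S1 : 1 <= s ^ S m) by (apply pow_R1_Rle; auto).
assert (A := Rabs_pos (r - 1)); assert (B := Rabs_pos (r ^ m - 1)); assert (N := pos_INR m).
rewrite S_INR; replace ((INR m + 1) * Rabs (r - 1) * s ^ S m) with
  (s * (INR m * Rabs (r - 1) * s ^ m) + Rabs (r - 1) * s ^ S m) by (simpl; ring).
apply Rplus_le_compat; [apply Rmult_le_compat; lra | nra].
Qed.

(** The coefficients of the perturbation are at most [m |r - 1| s^m |f_m|] for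
    some [s] between one and the radius of convergence; their sum is finite and
    small with [|r - 1|], and [young] applies. *)
Lemma dilate_perturbation f eta : decays f -> 0 < eta ->
  exists d, 0 < d < 1 /\ forall r, Rabs (r - 1) <= d -> forall h n,
    sqsum (h ** (dilate r f +: rscale f (- qreal 1)%quat)) n <= eta ^ 2 * sqsum h n.
Proof.
intros (rho & C & Hrho & HC & H) Heta.
set (s := (1 + rho) / 2); set (t := s / rho).
assert (Hs : 1 < s < rho) by (unfold s; lra).
assert (Ht : 0 < t < 1).
{ unfold t; split; [apply Rdiv_lt_0_compat; lra|].
  apply Rmult_lt_reg_r with rho; [lra|]; unfold Rdiv; rewrite Rmult_assoc, Rinv_l; lra. }
destruct (linear_times_geom t ltac:(lra)) as (K & g & HK & Hg & BK).
set (M := (C + 1) * (K + 1) / (1 - g)).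
assert (HM : 0 < M) by (apply Rdiv_lt_0_compat; [apply Rmult_lt_0_compat|]; lra).
exists (Rmin (s - 1) (Rmin (/ 2) (eta / M))); split.
{ split; [repeat apply Rmin_glb_lt; try lra; now apply Rdiv_lt_0_compat|].
  eapply Rle_lt_trans; [apply Rmin_r|]; eapply Rle_lt_trans; [apply Rmin_l|]; lra. }
set (dl := Rmin (s - 1) (Rmin (/ 2) (eta / M))).
assert (D1 : dl <= s - 1) by apply Rmin_l.
assert (D2 : dl <= / 2) by (eapply Rle_trans; [apply Rmin_r | apply Rmin_l]).
assert (D3 : dl <= eta / M) by (eapply Rle_trans; [apply Rmin_r | apply Rmin_r]).
assert (D0 : 0 < dl) by (unfold dl; repeat apply Rmin_glb_lt; try lra; now apply Rdiv_lt_0_compat).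
intros r Hr h n.
pose (w := fun m => (C + 1) * dl * (INR (S m) * t ^ m)).
assert (Hw : forall m, 0 < w m).
{ intros m; unfold w; repeat apply Rmult_lt_0_compat; try lra; [apply lt_0_INR; lia | apply pow_lt; lra]. }
assert (Hd : forall m, qnorm ((dilate r f +: rscale f (- qreal 1)%quat) m) <= w m).
{ intros m; unfold sadd, dilate, rscale.
  replace (qreal (r ^ m) * f m + f m * - qreal 1)%quat with (qreal (r ^ m - 1) * f m)%quat
    by (generalize (r ^ m); intros; qring).
  rewrite qnormM, qnorm_real; assert (R0 : 0 < rho ^ m) by (apply pow_lt; lra).
  assert (Ar : 0 <= r <= s) by (apply Rabs_le_between in Hr; lra).
  assert (E1 := pow_sub_le s r m Ar ltac:(lra)); specialize (H m).
  assert (Q := qnorm_ge0 (f m)); assert (N : INR m <= INR (S m)) by (rewrite S_INR; lra).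
  assert (N0 := pos_INR m); assert (s0 : 0 <= s ^ m) by (apply pow_le; lra).
  apply Rle_trans with (INR (S m) * dl * s ^ m * (C / rho ^ m)).
  - apply Rmult_le_compat; auto; [apply Rabs_pos | |].
    + eapply Rle_trans; [exact E1|]; apply Rmult_le_compat_r; auto.
      apply Rmult_le_compat; auto; apply Rabs_pos.
    + apply Rmult_le_reg_r with (rho ^ m); [auto|]; unfold Rdiv; rewrite Rmult_assoc, Rinv_l; lra.
  - unfold w, t; unfold Rdiv at 2; rewrite Rpow_mult_distr, pow_inv.
    replace (INR (S m) * dl * s ^ m * (C / rho ^ m)) with
      (C * (dl * (INR (S m) * (s ^ m * / rho ^ m)))) by (field; lra).
    replace ((C + 1) * dl * (INR (S m) * (s ^ m * / rho ^ m))) with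
      ((C + 1) * (dl * (INR (S m) * (s ^ m * / rho ^ m)))) by ring.
    apply Rmult_le_compat_r; [|lra]; repeat apply Rmult_le_pos; try lra;
      apply Rlt_le, Rinv_0_lt_compat; auto. }
eapply Rle_trans; [apply (young _ w h n Hd Hw)|].
apply Rmult_le_compat_r; [apply sqsum_ge0|]; apply pow_incr; split.
- clear - Hw; induction n as [|n IH]; [rewrite sum_O; apply Rlt_le, Hw|].
  rewrite sum_SnR; specialize (Hw (S n)); lra.
- apply Rle_trans with ((C + 1) * dl * ((K + 1) * sum_n (fun m => g ^ m) n)).
  + rewrite sum_scal_R, sum_scal_R; apply sum_n_le_R; intros m _; unfold w.
    apply Rmult_le_compat_l; [apply Rmult_le_pos; lra|]; eapply Rle_trans; [apply BK|].
    apply Rmult_le_compat_r; [apply pow_le; lra | lra].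
  + rewrite sum_geom by auto; assert (0 <= g ^ S n) by (apply pow_le; lra).
    apply Rle_trans with (dl * M).
    * unfold M; replace ((C + 1) * dl * ((K + 1) * ((1 - g ^ S n) / (1 - g)))) with
        (dl * ((C + 1) * (K + 1)) / (1 - g) * (1 - g ^ S n)) by (field; lra).
      replace (dl * ((C + 1) * (K + 1) / (1 - g))) with (dl * ((C + 1) * (K + 1)) / (1 - g) * 1) by (field; lra).
      apply Rmult_le_compat_l; [|lra]; apply Rmult_le_pos;
        [repeat apply Rmult_le_pos; lra | apply Rlt_le, Rinv_0_lt_compat; lra].
    * apply Rle_trans with (eta / M * M); [apply Rmult_le_compat_r; lra | right; field; lra].
Qed.

Lemma decays_of_sqsum r g B : 1 < r -> (forall n, sqsum (dilate r g) n <= B) -> decays g.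
Proof.
intros Hr H; exists r, (sqrt B); split; [auto|]; split; [apply sqrt_pos|]; intros m.
assert (P : 0 < r ^ m) by (apply pow_lt; lra).
replace (qnorm (g m) * r ^ m) with (qnorm (dilate r g m)).
- rewrite qnorm_nsq; apply sqrt_le_1_alt; eapply Rle_trans; [|apply (H m)]; now apply sqsum_term.
- unfold dilate; rewrite qnormM, qnorm_real, Rabs_pos_eq by lra; ring.
Qed.

Lemma dilate_mden r f a : dilate r (mden f a) = mden (dilate r f) a.
Proof. apply sext; intros [|m]; unfold dilate, mden, sadd, rscale, cst; [simpl; qring | generalize (r ^ S m); intros; qring]. Qed.

Lemma dilate_mnum r f a : dilate r (mnum f a) = mnum (dilate r f) a.
Proof. apply sext; intros [|m]; unfold dilate, mnum, sadd, cst; [simpl; qring | generalize (r ^ S m); intros; qring]. Qed.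

(** On a slightly larger ball [f] is still bounded by a constant smaller than
    [1 / |a|], so that the denominator remains invertible there. *)
Lemma decays_moebius f a g : schur f -> nsq a < 1 -> decays f -> is_moebius f a g -> decays g.
Proof.
intros Sf Ha Df Hg; assert (Qa : qnorm a < 1) by now apply qnorm_lt1.
assert (A0 := qnorm_ge0 a); set (q := qnorm a) in *.
(* With this [eta] the dilated [f] times [a] still has norm less than one. *)
set (eta := (1 - q) / 2); assert (He : 0 < eta <= / 2) by (unfold eta; lra).
destruct (dilate_perturbation f eta Df ltac:(lra)) as (d & Hd & P).
set (r := 1 + d); assert (Hr : Rabs (r - 1) <= d) by (unfold r; rewrite Rabs_pos_eq; lra).
specialize (P r Hr); set (F := dilate r f) in *.
assert (BF : forall h n, sqsum (h ** F) n <= (1 + eta) ^ 2 * sqsum h n).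
{ intros h n.
  assert (E : h ** F = h ** f +: h ** (F +: rscale f (- qreal 1)%quat)).
  { rewrite <- qconvDr; f_equal; apply sext; intros m; unfold sadd, rscale; qring. }
  rewrite E; eapply Rle_trans; [apply (sqsum_add_le (/ eta)), Rinv_0_lt_compat; lra|].
  specialize (P h n); specialize (Sf h n); assert (S0 := sqsum_ge0 h n).
  assert (I : 0 < / eta) by (apply Rinv_0_lt_compat; lra); rewrite Rinv_inv.
  apply Rle_trans with ((1 + eta) * sqsum h n + (1 + / eta) * (eta ^ 2 * sqsum h n)); [|right; field; lra].
  apply Rplus_le_compat; apply Rmult_le_compat_l; lra. }
destruct (inverse_exists (mden f a)) as (u & Hu & Hu').
{ apply mden_0_neq0; auto; apply qnorm_le1, schur_coef, Sf. }
set (k := dilate r u).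
assert (Hk : k ** mden F a = cst (qreal 1))
  by (unfold k, F; now rewrite <- dilate_mden, <- dilate_qconv, Hu', dilate_cst).
assert (Ek : k = cst (qreal 1) +: rscale (k ** F) (qconj a)).
{ rewrite <- Hk; unfold mden; rewrite qconvDr, qconv_cst1.
  replace (k ** rscale F (- qconj a)%quat) with (rscale (k ** F) (- qconj a)%quat)
    by now rewrite <- !qconv_cst, qconvA.
  apply sext; intros m; unfold sadd, rscale; qring. }
set (x := (1 + q) / 2); assert (Hx : 0 < x < 1) by (unfold x; lra).
assert (Hqx : ((1 + eta) * q) ^ 2 <= x ^ 2) by (apply pow_incr; unfold eta, x; nra).
assert (BX : forall n, sqsum k n <= / (1 - x) ^ 2).
{ intros n; set (X := sqsum k n).
  assert (B : X <= / (1 - x) + x * X).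
  { unfold X at 1; rewrite Ek.
    eapply Rle_trans; [apply (sqsum_add_le (/ x - 1))|].
    { apply Rlt_0_minus; rewrite <- Rinv_1; apply Rinv_lt_contravar; lra. }
    rewrite sqsum_cst, nsq_real, sqsum_rscale, nsq_conj, <- (qnorm_sqr a); fold q.
    assert (B2 := BF k n); fold X in B2; assert (X0 : 0 <= X) by apply sqsum_ge0.
    replace (1 + / (/ x - 1)) with (/ (1 - x)) by (field; lra).
    replace (1 + (/ x - 1)) with (/ x) by ring.
    assert (B3 : sqsum (k ** F) n * q ^ 2 <= x ^ 2 * X).
    { apply Rle_trans with ((1 + eta) ^ 2 * X * q ^ 2); [apply Rmult_le_compat_r; [apply pow2_ge_0 | exact B2]|].
      replace ((1 + eta) ^ 2 * X * q ^ 2) with (((1 + eta) * q) ^ 2 * X) by ring; now apply Rmult_le_compat_r. }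
    apply Rle_trans with (/ (1 - x) * 1 ^ 2 + / x * (x ^ 2 * X)).
    - apply Rplus_le_compat_l, Rmult_le_compat_l; [apply Rlt_le, Rinv_0_lt_compat; lra | exact B3].
    - right; field; lra. }
  apply Rmult_le_reg_r with (1 - x); [lra|].
  replace (/ (1 - x) ^ 2 * (1 - x)) with (/ (1 - x)) by (field; lra); lra. }
assert (Eg : g = u ** mnum f a) by (now rewrite <- Hg, qconvA, Hu', cst1_qconv).
apply (decays_of_sqsum r g ((1 + / 1) * ((1 + eta) ^ 2 * / (1 - x) ^ 2) + (1 + 1) * (/ (1 - x) ^ 2 * nsq a)));
  [unfold r; lra|].
intros n; rewrite Eg, dilate_qconv, dilate_mnum; fold k F; unfold mnum.
rewrite qconvDr, qconv_cst; eapply Rle_trans; [apply (sqsum_add_le 1); lra|].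
rewrite sqsum_rscale, nsqN; apply Rplus_le_compat; (apply Rmult_le_compat_l; [lra|]).
- eapply Rle_trans; [apply BF|]; apply Rmult_le_compat_l; [apply pow2_ge_0 | apply BX].
- apply Rmult_le_compat_r; [apply nsq_ge0 | apply BX].
Qed.

(** * Reciprocals of series with real coefficients *)

Definition real_coefs (h : nat -> quat) : Prop := forall m, exists x, h m = qreal x.

(** The series [f ** sconj f] is its own conjugate. *)
Lemma symmetrization_real f : real_coefs (f ** sconj f).
Proof.
intros m; exists (cre ((f ** sconj f) m)).
assert (E : sconj (f ** sconj f) = f ** sconj f) by now rewrite sconj_qconv, sconjK.
apply (f_equal (fun u => u m)) in E; unfold sconj at 1 in E.
generalize dependent ((f ** sconj f) m); intros [[[p0 p1] p2] p3] E.
assert (E1 := f_equal cim1 E); assert (E2 := f_equal cim2 E); assert (E3 := f_equal cim3 E).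
unfold qconj, cre, cim1, cim2, cim3 in *; cbn [fst snd] in *; unfold qreal.
replace p1 with 0 by lra; replace p2 with 0 by lra; replace p3 with 0 by lra; reflexivity.
Qed.

(** The centralizer of [I] is its slice. *)
Lemma commuting_slice I p : imag_unit I -> (p * I = I * p)%quat ->
  p = slice_pt I (cre p) (cre (- I * p)%quat).
Proof.
intros HI H; destruct (imag_unit_spec I HI) as [I0 I1].
destruct I as [[[i0 i1] i2] i3]; unfold cre in I0; simpl in I0; subst i0.
destruct p as [[[p0 p1] p2] p3].
assert (H1 := f_equal cim1 H); assert (H2 := f_equal cim2 H); assert (H3 := f_equal cim3 H).
unfold nsq in I1; unfold qmul, cre, cim1, cim2, cim3 in I1, H1, H2, H3; cbn [fst snd] in I1, H1, H2, H3.
assert (N : i1 * i1 + i2 * i2 + i3 * i3 = 1) by lra.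
assert (E1 : p2 * i3 = p3 * i2) by lra; assert (E2 : p3 * i1 = p1 * i3) by lra;
assert (E3 : p1 * i2 = p2 * i1) by lra.
assert (S : cre (- (0, i1, i2, i3) * (p0, p1, p2, p3))%quat = i1 * p1 + i2 * p2 + i3 * p3).
{ unfold qmul; rewrite ?cre_opp, ?cim1_opp, ?cim2_opp, ?cim3_opp; unfold cre, cim1, cim2, cim3; cbn [fst snd]; ring. }
unfold slice_pt; rewrite S; apply quat_ext; rewrite ?cre_add, ?cim1_add, ?cim2_add, ?cim3_add;
  unfold qmul, qreal, cre, cim1, cim2, cim3; cbn [fst snd].
- ring.
- transitivity (p1 * (i1 * i1 + i2 * i2 + i3 * i3)); [rewrite N; ring|].
  transitivity (p1 * i1 * i1 + i2 * (p1 * i2) + i3 * (p1 * i3)); [ring | rewrite E3, <- E2; ring].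
- transitivity (p2 * (i1 * i1 + i2 * i2 + i3 * i3)); [rewrite N; ring|].
  transitivity (i1 * (p2 * i1) + p2 * i2 * i2 + i3 * (p2 * i3)); [ring | rewrite <- E3, E1; ring].
- transitivity (p3 * (i1 * i1 + i2 * i2 + i3 * i3)); [rewrite N; ring|].
  transitivity (i1 * (p3 * i1) + i2 * (p3 * i2) + p3 * i3 * i3); [ring | rewrite E2, <- E1; ring].
Qed.

Lemma real_series_commutes h q w : real_coefs h -> tame h -> in_ball q -> (q * w = w * q)%quat ->
  (power_series h q * w = w * power_series h q)%quat.
Proof.
intros Hh Th Hb C; assert (T := psum_tends h _ Th Hb).
apply (tends_unique (fun n => w * psum h q n)%quat); [|now apply tends_mul_l].
apply tends_ext with (2 := tends_mul_r w _ _ T); intros n.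
assert (Cp : forall m, (qpow q m * w = w * qpow q m)%quat).
{ induction m as [|m IH]; simpl; [now rewrite qmul1l, qmul1r | now rewrite <- qmulA, IH, !qmulA, C]. }
induction n as [|n IH]; destruct (Hh O) as [t Et]; [rewrite psum_0, Et; apply qreal_comm|].
destruct (Hh (S n)) as [s Es].
rewrite psum_S, qmulDl, qmulDr, IH, Es; f_equal; rewrite <- qmulA, qreal_comm, qmulA, Cp; now rewrite qmulA.
Qed.

Lemma real_series_slice h I x y : real_coefs h -> tame h -> imag_unit I -> in_ball (slice_pt I x y) ->
  power_series h (slice_pt I x y) =
  slice_pt I (cre (power_series h (slice_pt I x y))) (cre (- I * power_series h (slice_pt I x y))%quat).
Proof.
intros Hh Th HI Hb; apply commuting_slice; auto.
apply real_series_commutes; auto; unfold slice_pt; qring.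
Qed.

Lemma is_derive_slice_pt I (al be : R -> R) x al' be' : is_derive al x al' -> is_derive be x be' ->
  is_derive (fun t => slice_pt I (al t) (be t) : quat) x (slice_pt I al' be' : quat).
Proof.
intros Ha Hb.
assert (D := is_derive_plus _ _ _ _ _ (is_derive_scal_l al x al' (qreal 1 : quat) Ha)
  (is_derive_scal_l be x be' (I : quat) Hb)).
assert (E : forall s t, plus (scal s (qreal 1 : quat)) (scal t (I : quat)) = slice_pt I s t)
  by (intros s t; change (qscal s (qreal 1) + qscal t I = slice_pt I s t)%quat; unfold slice_pt; qring).
rewrite <- E; apply is_derive_ext with (2 := D); intros t; apply E.
Qed.

Lemma continuous_slice_pt {U : UniformSpace} I (al be : U -> R) x :
  continuous al x -> continuous be x -> continuous (fun t => slice_pt I (al t) (be t) : quat) x.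
Proof.
intros Ha Hb.
assert (D := continuous_plus _ _ _ (continuous_scal_l al (qreal 1 : quat) x Ha)
  (continuous_scal_l be (I : quat) x Hb)).
apply continuous_ext with (2 := D); intros t.
change (qscal (al t) (qreal 1) + qscal (be t) I = slice_pt I (al t) (be t))%quat; unfold slice_pt; qring.
Qed.

Lemma qinv_slice_pt I x y : imag_unit I ->
  qinv (slice_pt I x y) = slice_pt I (x / (x ^ 2 + y ^ 2)) (- y / (x ^ 2 + y ^ 2)).
Proof.
intros HI; rewrite qinvE, nsq_slice_pt by auto; destruct (imag_unit_spec I HI) as [I0 _].
destruct I as [[[i0 i1] i2] i3]; unfold cre in I0; simpl in I0; subst i0.
unfold slice_pt, Rdiv; generalize (/ (x ^ 2 + y ^ 2)); intros k.
apply quat_ext; rewrite ?cre_add, ?cim1_add, ?cim2_add, ?cim3_add;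
 unfold qmul, qconj, qreal; rewrite ?cre_add, ?cim1_add, ?cim2_add, ?cim3_add;
 unfold cre, cim1, cim2, cim3; cbn [fst snd]; unfold plus; simpl; ring.
Qed.

(** Real and imaginary part of the derivative of [1 / (U + I V)] when the
    derivative of [U + I V] is [p + I q]. *)
Definition recip_re (U V p q : R) : R := (p * (V * V - U * U) - 2 * (U * V * q)) / ((U * U + V * V) * (U * U + V * V)).
Definition recip_im (U V p q : R) : R := - (q * (U * U - V * V) - 2 * (U * V * p)) / ((U * U + V * V) * (U * U + V * V)).

Lemma is_derive_recip (U V : R -> R) x p q : is_derive U x p -> is_derive V x q ->
  U x * U x + V x * V x <> 0 ->
  is_derive (fun t => U t / (U t ^ 2 + V t ^ 2)) x (recip_re (U x) (V x) p q) /\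
  is_derive (fun t => - V t / (U t ^ 2 + V t ^ 2)) x (recip_im (U x) (V x) p q).
Proof.
intros HU HV HN; unfold recip_re, recip_im.
assert (EU : Derive (fun t => U t) x = p) by exact (is_derive_unique U x p HU).
assert (EV : Derive (fun t => V t) x = q) by exact (is_derive_unique V x q HV).
assert (XU : ex_derive (fun t => U t) x) by now exists p.
assert (XV : ex_derive (fun t => V t) x) by now exists q.
assert (HN' : U x * (U x * 1) + V x * (V x * 1) <> 0) by now rewrite !Rmult_1_r.
split; auto_derive; auto; rewrite EU, EV; field; auto.
Qed.

Lemma continuous_Rmult {U : UniformSpace} (f g : U -> R) z :
  continuous f z -> continuous g z -> continuous (fun t => f t * g t) z.
Proof. apply (continuous_mult (K := R_AbsRing)). Qed.
Lemma continuous_Rplus {U : UniformSpace} (f g : U -> R) z :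
  continuous f z -> continuous g z -> continuous (fun t => f t + g t) z.
Proof. apply (continuous_plus (V := R_NormedModule)). Qed.
Lemma continuous_Rminus {U : UniformSpace} (f g : U -> R) z :
  continuous f z -> continuous g z -> continuous (fun t => f t - g t) z.
Proof. apply (continuous_minus (V := R_NormedModule)). Qed.
Lemma continuous_Ropp {U : UniformSpace} (f : U -> R) z :
  continuous f z -> continuous (fun t => - f t) z.
Proof. apply (continuous_opp (V := R_NormedModule)). Qed.
Lemma continuous_Rdiv {U : UniformSpace} (f g : U -> R) z :
  continuous f z -> continuous g z -> g z <> 0 -> continuous (fun t => f t / g t) z.
Proof.
intros Hf Hg H; apply continuous_Rmult; auto.
apply (continuous_comp g Rinv); auto.
apply (ex_derive_continuous (K := R_AbsRing) (V := R_NormedModule)); auto_derive; auto.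
Qed.

Lemma locally_in_ball_line (g : R -> quat) x : (forall t, qnorm (g t - g x)%quat <= Rabs (t - x)) ->
  in_ball (g x) -> locally x (fun t => in_ball (g t)).
Proof.
intros Hg Hb; destruct (ball_margin _ Hb) as (r & d & Hr & Hd & _ & Hw).
exists (mkposreal d Hd); intros t Ht.
unfold ball in Ht; simpl in Ht; unfold AbsRing_ball, abs, minus, plus, opp in Ht; simpl in Ht.
assert (qnorm (g t) <= r) by (apply Hw; eapply Rle_lt_trans; [apply Hg | exact Ht]).
unfold in_ball; lra.
Qed.

(** A series with real coefficients maps every slice into itself, so on a slice
    it is a holomorphic function [U + I V] with [U] and [V] real, and the
    reciprocal can be differentiated in real terms. *)
Lemma reciprocal_slice_regular h : real_coefs h -> tame h ->
  (forall q, in_ball q -> power_series h q <> qreal 0) ->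
  slice_regular (fun q => qinv (power_series h q)).
Proof.
intros Hh Th Hnz I HI.
pose (z := slice_pt I); pose (dh := sderiv h).
assert (Td : tame dh) by now apply tame_sderiv.
assert (Hd : real_coefs dh).
{ intros m; destruct (Hh (S m)) as [x Hx]; exists (INR (S m) * x); unfold dh, sderiv; rewrite Hx; apply qrealM. }
pose (U := fun x y => cre (power_series h (z x y))); pose (V := fun x y => cre (- I * power_series h (z x y))%quat).
pose (A := fun x y => cre (power_series dh (z x y))); pose (B := fun x y => cre (- I * power_series dh (z x y))%quat).
assert (EI : qnorm I = 1) by now apply qnorm_eq1, imag_unit_spec.
assert (val : forall x y, in_ball (z x y) ->
  qinv (power_series h (z x y)) = slice_pt I (U x y / (U x y ^ 2 + V x y ^ 2)) (- V x y / (U x y ^ 2 + V x y ^ 2))).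
{ intros x y Hb; unfold z at 1; rewrite (real_series_slice h I x y Hh Th HI Hb) at 1; now apply qinv_slice_pt. }
assert (N : forall x y, in_ball (z x y) -> U x y * U x y + V x y * V x y <> 0).
{ intros x y Hb E; apply (Hnz _ Hb), nsq_eq0; unfold z; rewrite (real_series_slice h I x y Hh Th HI Hb).
  rewrite nsq_slice_pt by auto; unfold U, V, z in E; simpl; lra. }
pose (fx := fun x y => slice_pt I (recip_re (U x y) (V x y) (A x y) (B x y)) (recip_im (U x y) (V x y) (A x y) (B x y))).
exists fx, (fun x y => I * fx x y)%quat; intros x y Hb; fold (z x y) in Hb.
destruct (power_series_slice_derive h I x y Th HI Hb) as [Dx Dy]; fold dh in Dx, Dy.
assert (one : forall p, cre (qreal 1 * p)%quat = cre p) by (intros; now rewrite qmul1l).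
assert (Ux : is_derive (fun t => U t y) x (A x y)).
{ assert (D := is_derive_form (qreal 1) _ _ _ Dx); rewrite one in D; apply is_derive_ext with (2 := D); intros; apply one. }
assert (Vx : is_derive (fun t => V t y) x (B x y)) by exact (is_derive_form (- I)%quat _ _ _ Dx).
assert (Ed := real_series_slice dh I x y Hd Td HI Hb); fold (z x y) in Ed; fold (A x y) (B x y) in Ed.
assert (Uy : is_derive (fun t => U x t) y (- B x y)).
{ assert (D := is_derive_form (qreal 1) _ _ _ Dy); rewrite one in D.
  replace (- B x y) with (cre (I * power_series dh (slice_pt I x y))%quat)
    by (unfold B, z; generalize (power_series dh (slice_pt I x y)); qrring).
  apply is_derive_ext with (2 := D); intros; apply one. }
assert (Vy : is_derive (fun t => V x t) y (A x y)).
{ assert (D := is_derive_form (- I)%quat _ _ _ Dy).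
  replace (A x y) with (cre (- I * (I * power_series dh (slice_pt I x y)))%quat); [exact D|].
  unfold A, z; replace (- I * (I * power_series dh (slice_pt I x y)))%quat with
    (- (I * (I * power_series dh (slice_pt I x y))))%quat by qring.
  rewrite imag_unit_mul by auto; f_equal; qring. }
assert (Ifx : (I * fx x y)%quat = slice_pt I (recip_re (U x y) (V x y) (- B x y) (A x y)) (recip_im (U x y) (V x y) (- B x y) (A x y))).
{ unfold fx; replace (I * slice_pt I (recip_re (U x y) (V x y) (A x y) (B x y)) (recip_im (U x y) (V x y) (A x y) (B x y)))%quat
    with (slice_pt I 0 1 * slice_pt I (recip_re (U x y) (V x y) (A x y) (B x y)) (recip_im (U x y) (V x y) (A x y) (B x y)))%quat
    by (f_equal; unfold slice_pt; qring).
  rewrite slice_pt_mul by auto; unfold recip_re, recip_im; f_equal; field; now apply N. }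
assert (Cu : continuous (fun w : R * R => U (fst w) (snd w)) (x, y) /\ continuous (fun w : R * R => V (fst w) (snd w)) (x, y) /\
  continuous (fun w : R * R => A (fst w) (snd w)) (x, y) /\ continuous (fun w : R * R => B (fst w) (snd w)) (x, y)).
{ assert (Ch := power_series_slice_continuous h I x y Th HI Hb).
  assert (Cd := power_series_slice_continuous dh I x y Td HI Hb).
  repeat split.
  - apply continuous_ext with (2 := continuous_form (qreal 1) _ _ Ch); intros; apply one.
  - exact (continuous_form (- I)%quat _ _ Ch).
  - apply continuous_ext with (2 := continuous_form (qreal 1) _ _ Cd); intros; apply one.
  - exact (continuous_form (- I)%quat _ _ Cd). }
destruct Cu as (CU & CV & CA & CB).
assert (Cre : forall f g : R * R -> R, continuous f (x, y) -> continuous g (x, y) ->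
  continuous (fun w => recip_re (U (fst w) (snd w)) (V (fst w) (snd w)) (f w) (g w)) (x, y) /\
  continuous (fun w => recip_im (U (fst w) (snd w)) (V (fst w) (snd w)) (f w) (g w)) (x, y)).
{ intros f g Cf Cg; assert (NN := N x y Hb).
  assert (DD : continuous (fun w => (U (fst w) (snd w) * U (fst w) (snd w) + V (fst w) (snd w) * V (fst w) (snd w)) *
     (U (fst w) (snd w) * U (fst w) (snd w) + V (fst w) (snd w) * V (fst w) (snd w))) (x, y)).
  { apply continuous_Rmult; apply continuous_Rplus; apply continuous_Rmult; assumption. }
  assert (UV : continuous (fun w => U (fst w) (snd w) * V (fst w) (snd w)) (x, y)) by now apply continuous_Rmult.
  assert (UU : continuous (fun w => U (fst w) (snd w) * U (fst w) (snd w)) (x, y)) by now apply continuous_Rmult.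
  assert (VV : continuous (fun w => V (fst w) (snd w) * V (fst w) (snd w)) (x, y)) by now apply continuous_Rmult.
  assert (C2 : continuous (fun _ : R * R => 2) (x, y)) by apply continuous_const.
  assert (ND : (U x y * U x y + V x y * V x y) * (U x y * U x y + V x y * V x y) <> 0)
    by now apply Rmult_integral_contrapositive.
  unfold recip_re, recip_im; split.
  - refine (continuous_Rdiv _ _ _ _ DD ND).
    refine (continuous_Rminus _ _ _ (continuous_Rmult _ _ _ Cf (continuous_Rminus _ _ _ VV UU)) _).
    exact (continuous_Rmult _ _ _ C2 (continuous_Rmult _ _ _ UV Cg)).
  - refine (continuous_Rdiv _ _ _ (continuous_Ropp _ _ _) DD ND).
    refine (continuous_Rminus _ _ _ (continuous_Rmult _ _ _ Cg (continuous_Rminus _ _ _ UU VV)) _).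
    exact (continuous_Rmult _ _ _ C2 (continuous_Rmult _ _ _ UV Cf)). }
assert (rot : forall s t, slice_pt I (- s) t = (I * slice_pt I t s)%quat).
{ intros s t; replace (slice_pt I (- s) t) with (qreal s * - qreal 1 + qreal t * I)%quat by (unfold slice_pt; qring).
  rewrite <- HI; unfold slice_pt; qring. }
refine (conj _ (conj _ (conj _ (conj _ _)))).
- destruct (is_derive_recip (fun t => U t y) (fun t => V t y) x _ _ Ux Vx (N x y Hb)) as [R1 R2].
  apply is_derive_ext_loc with (2 := is_derive_slice_pt I _ _ _ _ _ R1 R2).
  apply filter_imp with (P := fun t => in_ball (z t y)).
  + intros t Ht; symmetry; now apply val.
  + apply (locally_in_ball_line (fun t => z t y)); auto; intros t; unfold z; rewrite slice_pt_sub.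
    eapply Rle_trans; [now apply qnorm_slice_pt_le|]; rewrite (Rminus_diag y), Rabs_R0; lra.
- rewrite Ifx; destruct (is_derive_recip (fun t => U x t) (fun t => V x t) y _ _ Uy Vy (N x y Hb)) as [R1 R2].
  apply is_derive_ext_loc with (2 := is_derive_slice_pt I _ _ _ _ _ R1 R2).
  apply filter_imp with (P := fun t => in_ball (z x t)).
  + intros t Ht; symmetry; now apply val.
  + apply (locally_in_ball_line (fun t => z x t)); auto; intros t; unfold z; rewrite slice_pt_sub.
    eapply Rle_trans; [now apply qnorm_slice_pt_le|]; rewrite (Rminus_diag x), Rabs_R0; lra.
- destruct (Cre _ _ CA CB) as [C1 C2]; exact (continuous_slice_pt I _ _ _ C1 C2).
- apply continuous_ext with (fun w : R * R => slice_pt I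
    (- recip_im (U (fst w) (snd w)) (V (fst w) (snd w)) (A (fst w) (snd w)) (B (fst w) (snd w)))
    (recip_re (U (fst w) (snd w)) (V (fst w) (snd w)) (A (fst w) (snd w)) (B (fst w) (snd w)))).
  + intros w; unfold fx.
    apply rot.
  + destruct (Cre _ _ CA CB) as [C1 C2]; apply continuous_slice_pt; [now apply continuous_Ropp | exact C1].
- rewrite imag_unit_mul by auto; generalize (fx x y); intros w; qring.
Qed.

(** The formal inverse converges on the whole ball, because the reciprocal is
    slice regular and so has an expansion there. *)
Lemma real_series_inverse h : real_coefs h -> tame h ->
  (forall q, in_ball q -> power_series h q <> qreal 0) ->
  exists c, tame c /\ h ** c = cst (qreal 1).
Proof.
intros Hh Th Hnz.
destruct (slice_regular_expansion _ (reciprocal_slice_regular h Hh Th Hnz)) as [c Hc].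
assert (Tc := has_expansion_tame _ _ Hc); exists c; split; [exact Tc|].
apply power_series_inj_real; [now apply tame_qconv | apply tame_cst |]; intros x Hx.
assert (Hb := in_ball_real x Hx); rewrite power_series_qconv_real, power_series_cst by auto.
rewrite <- (has_expansion_eq _ c _ Hc Hb); apply qmulVr, Hnz, Hb.
Qed.

(** * Zeros of inner series *)

(** The coordinates of the powers of [x + J y] do not depend on [J], so a series
    is of the form [al + J be] on the sphere [x + S y]. *)
Lemma slice_pow_coordinates x y : exists c d : nat -> R,
  forall J m, imag_unit J -> qpow (slice_pt J x y) m = slice_pt J (c m) (d m).
Proof.
exists (fun m => fst (Nat.iter m (fun p => (x * fst p - y * snd p, x * snd p + y * fst p)) (1, 0))),
  (fun m => snd (Nat.iter m (fun p => (x * fst p - y * snd p, x * snd p + y * fst p)) (1, 0))).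
intros J m HJ; induction m as [|m IH]; simpl; [now rewrite slice_pt_real|].
rewrite IH; now apply slice_pt_mul.
Qed.

(** If [f] does not vanish at [z], its conjugate vanishes at some [x + I y] of the
    same sphere.  On the sphere [f] is [al + J be]; the zero of the conjugate
    means [al = be I], and then [f] vanishes for [J = - be I be^-1]. *)
Lemma zero_of_symmetrization f z : tame f -> in_ball z ->
  power_series (f ** sconj f) z = qreal 0 -> exists q, in_ball q /\ power_series f q = qreal 0.
Proof.
intros Tf Hz H0; assert (Tc := tame_sconj f Tf).
destruct (classic (power_series f z = qreal 0)) as [E|E]; [now exists z|].
rewrite power_series_qconv in H0 by auto.
apply qmul_eq0 in H0; destruct H0 as [H0|H0]; [easy|].
assert (Hz' := in_ball_conjugate _ z E Hz).
set (z' := (qinv (power_series f z) * z * power_series f z)%quat) in *; clearbody z'.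
destruct (slice_decomposition z') as (I & x & y & HI & ->).
destruct (slice_pow_coordinates x y) as (c & d & Hcd).
assert (ball : forall J, imag_unit J -> in_ball (slice_pt J x y)).
{ intros J HJ; apply qnorm_lt1; rewrite nsq_slice_pt, <- (nsq_slice_pt I) by auto; now apply qnorm_lt1. }
pose (al := fun n => sum_n (fun m => (qreal (c m) * f m)%quat : quat) n).
pose (be := fun n => sum_n (fun m => (qreal (d m) * f m)%quat : quat) n).
assert (alS : forall n, al (S n) = (al n + qreal (c (S n)) * f (S n))%quat)
  by (intros n; exact (qsum_S (fun m => qreal (c m) * f m)%quat n)).
assert (beS : forall n, be (S n) = (be n + qreal (d (S n)) * f (S n))%quat)
  by (intros n; exact (qsum_S (fun m => qreal (d m) * f m)%quat n)).
assert (al0 : al O = (qreal (c O) * f O)%quat) by exact (qsum_0 (fun m => qreal (c m) * f m)%quat).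
assert (be0 : be O = (qreal (d O) * f O)%quat) by exact (qsum_0 (fun m => qreal (d m) * f m)%quat).
assert (P0 : forall J, imag_unit J -> f O = (slice_pt J (c O) (d O) * f O)%quat)
  by (intros J HJ; rewrite <- (Hcd J O HJ); simpl; now rewrite qmul1l).
assert (repr : forall J n, imag_unit J -> psum f (slice_pt J x y) n = (al n + J * be n)%quat).
{ intros J n HJ; induction n as [|n IH].
  - rewrite psum_0, al0, be0, (P0 J HJ) at 1; unfold slice_pt; qring.
  - rewrite psum_S, IH, alS, beS, Hcd by auto; unfold slice_pt; qring. }
assert (reprc : forall n, psum (sconj f) (slice_pt I x y) n = qconj (al n - be n * I)%quat).
{ destruct (imag_unit_spec I HI) as [I0 _].
  assert (CI : qconj I = (- I)%quat).
  { apply quat_ext; rewrite ?cre_opp, ?cim1_opp, ?cim2_opp, ?cim3_opp; try reflexivity.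
    change (cre (qconj I)) with (cre I); lra. }
  assert (Cs : forall s t p, (slice_pt I s t * qconj p)%quat = qconj (qreal s * p - qreal t * p * I)%quat).
  { intros s t p; replace (qconj (qreal s * p - qreal t * p * I))%quat with
      (qconj p * qreal s + - (qconj I * (qconj p * qreal t)))%quat by qring.
    rewrite CI; unfold slice_pt; qring. }
  induction n as [|n IH].
  - rewrite psum_0, al0, be0, <- Cs; unfold sconj; rewrite <- (Hcd I O HI); simpl; now rewrite qmul1l.
  - rewrite psum_S, IH, alS, beS, Hcd by auto; unfold sconj; rewrite Cs, <- qconjD; f_equal; qring. }
assert (HmI : imag_unit (- I)%quat) by (unfold imag_unit; rewrite <- HI; qring).
assert (T1 := psum_tends f _ Tf (ball I HI)); assert (T2 := psum_tends f _ Tf (ball _ HmI)).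
set (w1 := power_series f (slice_pt I x y)) in *; set (w2 := power_series f (slice_pt (- I)%quat x y)) in *.
set (a := (qreal (/ 2) * (w1 + w2))%quat); set (b := (qreal (/ 2) * (- I * (w1 + - qreal 1 * w2)))%quat).
assert (Ta : tends al a).
{ eapply tends_ext; [|apply (tends_mul_l (qreal (/ 2))), (tends_add _ _ _ _ T1 T2)].
  intros n; cbn beta; rewrite !repr by auto.
  replace (al n + I * be n + (al n + - I * be n))%quat with (qreal 2 * al n)%quat by qring.
  rewrite qmulA, qrealM, Rinv_l by lra; apply qmul1l. }
assert (Tb : tends be b).
{ eapply tends_ext; [|apply (tends_mul_l (qreal (/ 2))), (tends_mul_l (- I)%quat), (tends_add _ _ _ _ T1 (tends_mul_l (- qreal 1)%quat _ _ T2))].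
  intros n; cbn beta; rewrite !repr by auto.
  replace (- I * (al n + I * be n + - qreal 1 * (al n + - I * be n)))%quat with
    (qreal 2 * - (I * (I * be n)))%quat by (replace (- I * be n)%quat with (- (I * be n))%quat by qring;
      generalize (al n) (I * be n)%quat; intros; qring).
  rewrite imag_unit_mul, qmulA, qrealM, Rinv_l by (auto; lra); qring. }
assert (val : forall J, imag_unit J -> power_series f (slice_pt J x y) = (a + J * b)%quat).
{ intros J HJ; apply power_series_tends.
  eapply tends_ext; [|apply (tends_add _ _ _ _ Ta (tends_mul_l J _ _ Tb))].
  intros n; cbn beta; now rewrite repr. }
assert (Eab : a = (b * I)%quat).
{ apply qsub_eq0; rewrite <- (qconjK (a - b * I)%quat).
  replace (qconj (a - b * I)) with (power_series (sconj f) (slice_pt I x y)); [rewrite H0; qring|].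
  apply power_series_tends; eapply tends_ext; [intros n; symmetry; apply reprc|].
  apply tends_conj.
  replace (a - b * I)%quat with (a + - qreal 1 * (b * I))%quat by qring.
  eapply tends_ext; [|apply (tends_add _ _ _ _ Ta (tends_mul_l (- qreal 1)%quat _ _ (tends_mul_r I _ _ Tb)))].
  intros n; cbn beta; generalize (al n) (be n * I)%quat; intros; qring. }
clearbody a b w1 w2.
destruct (classic (b = qreal 0)) as [Z|Z].
- exists (slice_pt I x y); split; [now apply ball|]; rewrite val, Eab, Z by auto; qring.
- assert (HJ : imag_unit (- (b * I * qinv b))%quat).
  { unfold imag_unit; replace (- (b * I * qinv b) * - (b * I * qinv b))%quat with
      (b * I * (qinv b * b) * (I * qinv b))%quat by (transitivity (b * I * qinv b * (b * I * qinv b))%quat;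
        [rewrite !qmulA; reflexivity | generalize (b * I * qinv b)%quat; intros; qring]).
    rewrite qmulVl, qmul1r by auto.
    replace (b * I * (I * qinv b))%quat with (b * (I * I) * qinv b)%quat by (rewrite !qmulA; reflexivity).
    rewrite HI; replace (b * - qreal 1)%quat with (- b)%quat by qring.
    replace (- b * qinv b)%quat with (- (b * qinv b))%quat by (generalize (qinv b); intros; qring); now rewrite qmulVr. }
  exists (slice_pt (- (b * I * qinv b))%quat x y); split; [now apply ball|].
  rewrite val, Eab by auto.
  replace (- (b * I * qinv b) * b)%quat with (- (b * I * (qinv b * b)))%quat
    by (rewrite (qmulA (b * I)%quat); generalize (b * I * qinv b)%quat; intros; qring).
  rewrite qmulVl, qmul1r, qaddN by auto; reflexivity.
Qed.

(** If [f] had no zero it would have a regular reciprocal [b]; as [f] is inner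
    and extends beyond the ball, multiplication by [f] nearly preserves the norm
    of the dilated [b], whence [|b(0)| <= 1]. *)
Lemma inner_without_zeros f : inner f -> decays f ->
  (forall q, in_ball q -> power_series f q <> qreal 0) -> nsq (f O) = 1.
Proof.
intros Hi Df Hnz; assert (Sf := proj1 Hi); assert (Tf := schur_tame f Sf).
destruct (real_series_inverse (f ** sconj f) (symmetrization_real f)) as (c & Tc & Hc).
{ apply tame_qconv; [auto | now apply tame_sconj]. }
{ intros q Hq E; destruct (zero_of_symmetrization f q Tf Hq E) as (q' & Hq' & E'); now apply (Hnz q'). }
set (b := sconj f ** c); rewrite <- qconvA in Hc; fold b in Hc.
assert (f0 : f O <> qreal 0).
{ rewrite <- power_series_at_0; apply Hnz, in_ball_real; lra. }
assert (Hb : b ** f = cst (qreal 1)) by now apply right_inverse_left.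
assert (Tb : tame b) by (apply tame_qconv; [now apply tame_sconj | exact Tc]).
assert (B : forall eta, 0 < eta < 1 -> nsq (b O) * (1 - eta) ^ 2 <= 1).
{ intros eta He; destruct (dilate_perturbation f eta Df ltac:(lra)) as (d & Hd & P).
  set (r := 1 - d); specialize (P r ltac:(unfold r; rewrite Rabs_left; lra)).
  (* [k ** f] differs from 1 by [k ** D], which is small compared with [k]. *)
  set (k := dilate r b); set (D := dilate r f +: rscale f (- qreal 1)%quat) in *.
  assert (Hk : k ** f = cst (qreal 1) +: rscale (k ** D) (- qreal 1)%quat).
  { assert (E : k ** dilate r f = cst (qreal 1)) by (unfold k; now rewrite <- dilate_qconv, Hb, dilate_cst).
    unfold D; rewrite qconvDr, E.
    replace (k ** rscale f (- qreal 1)%quat) with (rscale (k ** f) (- qreal 1)%quat)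
      by now rewrite <- !qconv_cst, qconvA.
    apply sext; intros m; unfold sadd, rscale; qring. }
  destruct (tame_geometric b r Tb ltac:(unfold r; lra)) as (C & t & HC & Ht & Bb).
  assert (Bk : forall n, sqsum k n <= C ^ 2 / (1 - t ^ 2)).
  { intros n; apply Rle_trans with (C ^ 2 * sum_n (fun m => (t ^ 2) ^ m) n).
    - unfold sqsum; rewrite sum_scal_R; apply sum_n_le_R; intros m _.
      rewrite <- qnorm_sqr; unfold k, dilate; rewrite qnormM, qnorm_real, Rabs_pos_eq
        by (apply pow_le; unfold r; lra).
      replace (C ^ 2 * (t ^ 2) ^ m) with ((C * t ^ m) ^ 2) by (rewrite <- pow_mult, Nat.mul_comm, pow_mult; ring).
      apply pow_incr; split; [apply Rmult_le_pos; [apply pow_le; unfold r; lra | apply qnorm_ge0]|].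
      rewrite Rmult_comm; apply Bb.
    - assert (T2 : 0 <= t ^ 2 < 1) by (simpl; nra).
      rewrite sum_geom by auto; assert (0 <= (t ^ 2) ^ S n) by (apply pow_le; lra).
      unfold Rdiv; rewrite <- Rmult_assoc; apply Rmult_le_compat_r; [apply Rlt_le, Rinv_0_lt_compat; lra|].
      rewrite <- (Rmult_1_r (C ^ 2)) at 2; apply Rmult_le_compat_l; [apply pow2_ge_0 | lra]. }
  destruct (sqsum_bounded_cv k _ Bk) as [l Hl].
  assert (Lk := inner_isometry f k l Hi Hl).
  assert (L : is_lim_seq (fun n => sqsum (k ** f) n) l).
  { apply is_lim_seq_ext with (fun n => sqsum k n + -1 * (sqsum k n - sqsum (k ** f) n)); [intros; ring|].
    apply is_lim_seq_plus_0; [exact Hl | now apply is_lim_seq_scal_0]. }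
  assert (U : forall n, sqsum (k ** f) n <= / (1 - eta) + eta * sqsum k n).
  { intros n; rewrite Hk; eapply Rle_trans; [apply (sqsum_add_le (/ eta - 1))|].
    { apply Rlt_0_minus; rewrite <- Rinv_1; apply Rinv_lt_contravar; lra. }
    rewrite sqsum_cst, nsq_real, sqsum_rscale, nsqN, nsq_real.
    specialize (P k n).
    replace (1 + / (/ eta - 1)) with (/ (1 - eta)) by (field; lra).
    replace (1 + (/ eta - 1)) with (/ eta) by ring.
    apply Rle_trans with (/ (1 - eta) * 1 ^ 2 + / eta * (eta ^ 2 * sqsum k n)).
    - apply Rplus_le_compat_l, Rmult_le_compat_l; [apply Rlt_le, Rinv_0_lt_compat; lra | lra].
    - right; field; lra. }
  assert (V : l <= / (1 - eta) + eta * l).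
  { apply (is_lim_seq_le _ _ (Finite l) (Finite (/ (1 - eta) + eta * l)) U L).
    apply is_lim_seq_plus'; [apply is_lim_seq_const | exact (is_lim_seq_scal_l _ eta l Hl)]. }
  assert (W : nsq (b O) <= l).
  { refine (is_lim_seq_le _ _ (Finite (nsq (b O))) (Finite l) _ (is_lim_seq_const (nsq (b O))) Hl); intros n.
    replace (nsq (b O)) with (nsq (k O)); [apply sqsum_term; lia|].
    unfold k, dilate; simpl; f_equal; apply qmul1l. }
  assert (X : l * (1 - eta) ^ 2 <= 1).
  { apply Rmult_le_compat_r with (r := 1 - eta) in V; [|lra].
    replace ((/ (1 - eta) + eta * l) * (1 - eta)) with (1 + eta * l * (1 - eta)) in V by (field; lra).
    simpl; nra. }
  assert (0 <= (1 - eta) ^ 2) by apply pow2_ge_0; nra. }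
assert (B1 : nsq (b O) <= 1).
{ destruct (Rle_lt_dec (nsq (b O)) 1) as [|G]; auto; exfalso.
  set (X := nsq (b O)) in *; specialize (B ((X - 1) / (4 * X)) ).
  assert (HX : 0 < (X - 1) / (4 * X) < 1).
  { split; [apply Rdiv_lt_0_compat; lra|]; apply Rmult_lt_reg_r with (4 * X); [lra|].
    unfold Rdiv; rewrite Rmult_assoc, Rinv_l by lra; lra. }
  specialize (B HX).
  replace (X * (1 - (X - 1) / (4 * X)) ^ 2) with (X - (X - 1) / 2 + (X - 1) ^ 2 / (16 * X)) in B by (field; lra).
  assert (0 <= (X - 1) ^ 2 / (16 * X)) by (apply Rmult_le_pos; [apply pow2_ge_0 | apply Rlt_le, Rinv_0_lt_compat; lra]).
  lra. }
assert (E : nsq (b O) * nsq (f O) = 1).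
{ rewrite <- nsqM, <- qconv_0, Hb; simpl; rewrite nsq_real; ring. }
assert (F1 : nsq (f O) <= 1) by apply qnorm_le1, schur_coef, Sf.
assert (N1 := nsq_ge0 (b O)); assert (N2 := nsq_ge0 (f O)); nra.
Qed.

(** * Blaschke products *)

Inductive blaschke : nat -> (nat -> quat) -> Prop :=
| blaschke_const u : nsq u = 1 -> blaschke 0 (cst u)
| blaschke_factor k p g : in_ball p -> blaschke k g -> blaschke (S k) (rM p ** g).

Lemma blaschke_rank k f : blaschke k f -> rank_le k f.
Proof. induction 1; [now apply rank_le_cst | now apply rank_le_rM]. Qed.

Lemma blaschke_decays k f : blaschke k f -> decays f.
Proof. induction 1; [apply decays_cst | now apply decays_rM]. Qed.

Lemma blaschke_energy k f : blaschke k f -> is_lim_seq (energy f) (INR k).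
Proof.
induction 1 as [u Hu | k p g Hp Hg IH].
- apply is_lim_seq_ext with (fun _ => 0); [|apply is_lim_seq_const].
  intros n; induction n as [|n IHn]; rewrite ?energy_0, ?energy_S, <- ?IHn, sqsum_cst; lra.
- rewrite S_INR; apply energy_rM; auto; now apply (rank_le_inner k), blaschke_rank.
Qed.

(** The energy recovers the degree. *)
Lemma blaschke_degree_unique j k f : blaschke j f -> blaschke k f -> j = k.
Proof.
intros Hj Hk; apply INR_eq.
assert (Lj := is_lim_seq_unique _ _ (blaschke_energy j f Hj)).
assert (Lk := is_lim_seq_unique _ _ (blaschke_energy k f Hk)).
rewrite Lj in Lk; now injection Lk.
Qed.

(** Each zero splits off one Blaschke factor and lowers the energy by one; a
    series without zeros is constant. *)
Lemma blaschke_of_energy k f : inner f -> decays f -> (forall n, energy f n <= INR k) ->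
  exists j, (j <= k)%nat /\ blaschke j f.
Proof.
revert f; induction k as [|k IH]; intros f Hi Df He.
all: destruct (classic (nsq (f O) = 1)) as [E0|E0];
  [exists O; split; [lia|]; rewrite (schur_unimodular_const f (proj1 Hi) E0); now constructor|].
- exfalso; specialize (He O); rewrite energy_0, sqsum_0 in He; simpl in He.
  assert (H := schur_coef f 0 (proj1 Hi)); apply qnorm_le1 in H; lra.
- destruct (classic (exists p, in_ball p /\ power_series f p = qreal 0)) as [(p & Hp & Zp)|N].
  2:{ exfalso; apply E0, inner_without_zeros; auto; intros q Hq Z; apply N; now exists q. }
  destruct (blaschke_division f p (proj1 Hi) Hp Zp) as (e & He' & Sg & Ef).
  set (g := lin (qreal 1) (- qconj p)%quat ** e) in *.
  assert (Dg : decays g) by (apply decays_lin, (decays_tails f p); auto).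
  assert (Ig : inner g) by now apply (inner_of_rM p f).
  destruct (IH g Ig Dg) as (j & Hj & Bj).
  + intros n; assert (L := rM_kernel_cv p g Hp Ig).
    apply (is_lim_seq_incr_n _ n) in L.
    assert (U : forall m, energy g n + (1 - nsq p) * sqsum (geom (qconj p) ** g) (m + n) <= INR k + 1).
    { intros m; rewrite <- S_INR; eapply Rle_trans; [|apply (He (m + n)%nat)].
      rewrite Ef, rM_energy; apply Rplus_le_compat_r, energy_mono; [exact Sg | lia]. }
    assert (V := is_lim_seq_le _ _ _ _ U (is_lim_seq_plus' _ _ _ _ (is_lim_seq_const (energy g n)) L) (is_lim_seq_const _)).
    simpl in V; lra.
  + exists (S j); split; [lia|]; rewrite Ef; now constructor.
Qed.

Lemma is_moebius_sym f a g : schur f -> schur g -> nsq a < 1 -> is_moebius f a g -> is_moebius g (- a)%quat f.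
Proof.
intros Sf Sg Ha H; assert (Tf := schur_tame f Sf); assert (Tg := schur_tame g Sg).
apply power_series_inj_real; [apply tame_qconv; [now apply tame_mden | auto] | now apply tame_mnum |].
intros x Hx; assert (Hb := in_ball_real x Hx).
assert (Bf := schur_ball f _ Sf Hb); assert (Bg := schur_ball g _ Sg Hb).
rewrite power_series_qconv_real, power_series_mden, power_series_mnum by (auto; now apply tame_mden).
assert (E := is_moebius_real f a g x Sf Sg Ha Hx Bf H).
rewrite <- (moebius_inv a (power_series f (qreal x)) Ha Bf), <- E.
apply moebius_mul; [now rewrite nsqN | exact Bg].
Qed.

(** The bound on the rank bounds the energy of the transform, so its degree does
    not exceed [k].  The inverse transform gives the opposite inequality. *)
Lemma blaschke_moebius k f a g : nsq a < 1 -> schur g -> blaschke k f -> is_moebius f a g -> blaschke k g.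
Proof.
assert (main : forall k f a g, nsq a < 1 -> blaschke k f -> is_moebius f a g ->
  exists j, (j <= k)%nat /\ blaschke j g).
{ clear; intros k f a g Ha Hf Hg; assert (Rg := rank_le_moebius k f a g Ha (blaschke_rank k f Hf) Hg).
  apply blaschke_of_energy.
  - now apply rank_le_inner with k.
  - apply (decays_moebius f a g); auto; [|now apply blaschke_decays with k].
    now apply rank_le_schur with k, blaschke_rank.
  - intros n; now apply rank_le_energy. }
intros Ha Sg Hf Hg; destruct (main k f a g Ha Hf Hg) as (j & Hj & Bj).
assert (Sf := rank_le_schur k f (blaschke_rank k f Hf)).
destruct (main j g (- a)%quat f) as (i & Hij & Bi); [now rewrite nsqN | exact Bj | now apply is_moebius_sym |].
assert (i = k) by now apply (blaschke_degree_unique i k f).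
now replace k with j by lia.
Qed.

(** * Regular Blaschke products and their coefficients *)

Lemma lin_coeffs_denominator p :
  has_expansion (fun q => qreal 1 - q * qconj p)%quat (lin (qreal 1) (- qconj p)%quat).
Proof.
intros q Hq; replace (qreal 1 - q * qconj p)%quat with (power_series (lin (qreal 1) (- qconj p)%quat) q).
- apply has_expansion_power_series; [apply tame_lin | exact Hq].
- rewrite power_series_lin by auto; generalize (qconj p); intros; qring.
Qed.

Lemma lin_coeffs_numerator p : has_expansion (fun q => q - p)%quat (lin (- p)%quat (qreal 1)).
Proof.
intros q Hq; replace (q - p)%quat with (power_series (lin (- p)%quat (qreal 1)) q).
- apply has_expansion_power_series; [apply tame_lin | exact Hq].
- rewrite power_series_lin by auto; qring.
Qed.

(** The reciprocal of [1 - q conj p] is its conjugate divided by its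
    symmetrization. *)
Lemma symmetrized_geom p :
  (lin (qreal 1) (- qconj p)%quat ** sconj (lin (qreal 1) (- qconj p)%quat)) ** geom (qconj p) =
  sconj (lin (qreal 1) (- qconj p)%quat).
Proof.
assert (E : sconj (lin (qreal 1) (- qconj p)%quat) = lin (qreal 1) (- p)%quat).
{ apply sext; intros m; unfold sconj, lin, sadd, shift, cst; destruct m as [|[|m]]; qring. }
rewrite E.
assert (C : lin (qreal 1) (- p)%quat ** geom (qconj p) = geom (qconj p) ** lin (qreal 1) (- p)%quat).
{ rewrite lin_qconv, qconv_lin; apply sext; intros m; unfold sadd, shift, lscale, rscale, geom.
  rewrite qmul1l, qmul1r; destruct m as [|m]; [reflexivity|]; f_equal.
  assert (P : (p * qpow (qconj p) m = qpow (qconj p) m * p)%quat).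
  { induction m as [|m IH]; simpl; [now rewrite qmul1l, qmul1r|].
    rewrite <- qmulA, <- IH, !qmulA; f_equal; qring. }
  replace (- p * qpow (qconj p) m)%quat with (- (p * qpow (qconj p) m))%quat
    by (generalize (qpow (qconj p) m); intros; qring).
  rewrite P; generalize (qpow (qconj p) m); intros; qring. }
now rewrite <- qconvA, C, qconvA, geom_inv_l, cst1_qconv.
Qed.

(** The symmetrization has real coefficients; its value at [q] commutes with [q],
    so dividing the value of the conjugate by it amounts to dividing the series. *)
Lemma rinv_denominator p : in_ball p ->
  has_expansion (rinv (fun q => qreal 1 - q * qconj p)%quat) (geom (qconj p)).
Proof.
intros Hp; set (L := lin (qreal 1) (- qconj p)%quat).
assert (Hp' := qconj_in_ball p Hp).
assert (TL : tame L) by apply tame_lin; assert (TcL := tame_sconj L TL).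
assert (TG := tame_geom _ Hp'); assert (TS : tame (L ** sconj L)) by now apply tame_qconv.
assert (EL : coeffs (fun q => qreal 1 - q * qconj p)%quat = L) by apply coeffs_expansion, lin_coeffs_denominator.
assert (Ec : rconj (fun q => qreal 1 - q * qconj p)%quat = power_series (sconj L)) by (unfold rconj; now rewrite EL).
assert (Es : rsym (fun q => qreal 1 - q * qconj p)%quat = power_series (L ** sconj L)).
{ unfold rsym, rstar; rewrite EL, Ec; f_equal; f_equal; now apply coeffs_expansion, has_expansion_power_series. }
intros q Hq; unfold rinv; rewrite Es, Ec.
assert (nz : power_series (L ** sconj L) q <> qreal 0).
{ intros E; destruct (zero_of_symmetrization L q TL Hq E) as (z & Hz & Z).
  unfold L in Z; rewrite power_series_lin in Z by auto.
  apply (moebius_den_neq0 p z); [now apply qnorm_lt1 | now apply Rlt_le, qnorm_lt1 |].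
  rewrite <- Z; generalize (qconj p); intros; qring. }
replace (power_series (sconj L) q) with (power_series (L ** sconj L) q * power_series (geom (qconj p)) q)%quat.
- rewrite qmulA, qmulVl, qmul1l by auto; now apply has_expansion_power_series.
- assert (G : (L ** sconj L) ** geom (qconj p) = sconj L) by exact (symmetrized_geom p).
  assert (C := real_series_commutes _ q q (symmetrization_real L) TS Hq eq_refl).
  set (h := L ** sconj L) in *; clearbody h.
  rewrite <- G, power_series_qconv by auto.
  now rewrite <- qmulA, <- C, qmulA, qmulVl, qmul1l.
Qed.

Lemma rmoebius_expansion p : in_ball p -> has_expansion (rmoebius p) (rM p).
Proof.
intros Hp; unfold rmoebius, rstar.
rewrite (coeffs_expansion _ _ (rinv_denominator p Hp)), (coeffs_expansion _ _ (lin_coeffs_numerator p)).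
apply has_expansion_power_series, schur_tame, (schur_rM p Hp).
Qed.

Definition factors (ts : list quat) (u : quat) : nat -> quat :=
  fold_right (fun p g => rM p ** g) (cst u) ts.

Lemma tame_factors ts u : List.Forall in_ball ts -> tame (factors ts u).
Proof.
induction 1 as [|p ts Hp _ IH]; simpl; [apply tame_cst | apply tame_qconv; auto; now apply schur_tame, schur_rM].
Qed.

Lemma rstar_prod_expansion ts : List.Forall in_ball ts ->
  has_expansion (rstar_prod (map rmoebius ts)) (factors ts (qreal 1)).
Proof.
induction 1 as [|p ts Hp Hts IH].
- intros q Hq; assert (E := has_expansion_power_series _ (tame_cst (qreal 1)) q Hq).
  now rewrite power_series_cst in E.
- simpl; unfold rstar at 1; fold (rstar_prod (map rmoebius ts)).
  rewrite (coeffs_expansion _ _ IH), (coeffs_expansion _ _ (rmoebius_expansion p Hp)).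
  apply has_expansion_power_series, (tame_factors (p :: ts)); now constructor.
Qed.

Lemma factors_unit ts u : rscale (factors ts (qreal 1)) u = factors ts u.
Proof.
induction ts as [|p ts IH]; simpl.
- apply sext; intros [|m]; unfold rscale, cst; [apply qmul1l | apply qmul0l].
- now rewrite <- IH, <- !qconv_cst, qconvA.
Qed.

Lemma rstar_prod_value ts u q : List.Forall in_ball ts -> in_ball q ->
  (rstar_prod (map rmoebius ts) q * u)%quat = power_series (factors ts u) q.
Proof.
intros Hts Hq; rewrite (has_expansion_eq _ _ _ (rstar_prod_expansion ts Hts) Hq).
rewrite <- (factors_unit ts u), power_series_rscale; auto; now apply tame_factors.
Qed.

Lemma blaschke_factors k a : blaschke k a <->
  exists ts u, length ts = k /\ List.Forall in_ball ts /\ nsq u = 1 /\ a = factors ts u.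
Proof.
split.
- induction 1 as [u Hu | k p g Hp _ (ts & u & <- & Hts & Hu & ->)].
  + exists nil, u; auto.
  + exists (p :: ts), u; auto.
- intros (ts & u & <- & Hts & Hu & ->); induction Hts; simpl; now constructor.
Qed.

Lemma power_series_inj_ball a b : tame a -> tame b ->
  eq_on_ball (power_series a) (power_series b) -> a = b.
Proof. intros Ta Tb E; apply power_series_inj_real; auto; intros x Hx; now apply E, in_ball_real. Qed.

Lemma blaschke_of_degree_series k a : tame a ->
  (blaschke_of_degree k (power_series a) <-> (1 <= k)%nat /\ blaschke k a).
Proof.
intros Ta; split; intros [Hk H]; split; auto.
- destruct H as (ts & u & Hl & Hts & Hu & E); apply blaschke_factors; exists ts, u.
  repeat split; auto; [now apply qnorm_eq1|].
  apply power_series_inj_ball; auto; [now apply tame_factors|].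
  intros q Hq; rewrite (E q Hq); now apply rstar_prod_value.
- apply blaschke_factors in H; destruct H as (ts & u & Hl & Hts & Hu & ->); exists ts, u.
  repeat split; auto; [now apply qnorm_eq1|].
  intros q Hq; symmetry; now apply rstar_prod_value.
Qed.

(** * The Schur algorithm at real nodes *)

Definition at_real (a : nat -> quat) (x : R) : quat := power_series a (qreal x).

(** A unimodular constant is its own successor, just as the table repeats a
    constant row on the sphere. *)
Definition schur_next (x : R) (f g : nat -> quat) : Prop :=
  (nsq (f O) < 1 /\ is_moebius f (at_real f x) (rM (qreal x) ** g)) \/ (nsq (f O) = 1 /\ g = f).

Lemma schur_head f : schur f -> nsq (f O) < 1 \/ nsq (f O) = 1.
Proof. intros H; apply (schur_coef f 0), qnorm_le1 in H; lra. Qed.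

Lemma at_real_le1 f x : schur f -> -1 < x < 1 -> nsq (at_real f x) <= 1.
Proof. intros H Hx; apply schur_ball; auto; now apply in_ball_real. Qed.

Lemma at_real_lt1 f x : schur f -> nsq (f O) < 1 -> -1 < x < 1 -> nsq (at_real f x) < 1.
Proof. intros H H0 Hx; apply schur_ball_strict; auto; now apply in_ball_real. Qed.

Lemma at_real_const f x : schur f -> nsq (f O) = 1 -> at_real f x = f O.
Proof. intros H H0; unfold at_real; rewrite (schur_unimodular_const f H H0) at 1; apply power_series_cst. Qed.

Lemma schur_maximum f x : schur f -> -1 < x < 1 -> nsq (at_real f x) = 1 -> f = cst (at_real f x).
Proof.
intros H Hx E; destruct (schur_head f H) as [L|L].
- assert (A := at_real_lt1 f x H L Hx); lra.
- now rewrite at_real_const, <- schur_unimodular_const.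
Qed.

Lemma real_in_ball x : -1 < x < 1 -> nsq (qreal x) < 1.
Proof. intros H; now apply qnorm_lt1, in_ball_real. Qed.

Lemma schur_next_exists x f : schur f -> -1 < x < 1 -> exists g, schur g /\ schur_next x f g.
Proof.
intros Sf Hx; destruct (schur_head f Sf) as [L|L]; [|exists f; split; auto; now right].
assert (A := at_real_lt1 f x Sf L Hx).
destruct (moebius_exists f _ Sf A) as (h & Mh & Sh).
destruct (blaschke_division h (qreal x) Sh (in_ball_real x Hx)) as (e & _ & Sg & E).
- rewrite (is_moebius_real f (at_real f x) h x Sf Sh A Hx (at_real_le1 f x Sf Hx) Mh).
  now apply moebius_self.
- eexists; split; [exact Sg|]; left; split; auto; now rewrite <- E.
Qed.

Lemma at_real_rM x g y : schur g -> -1 < x < 1 -> -1 < y < 1 ->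
  at_real (rM (qreal x) ** g) y = (moebius (qreal x) (qreal y) * at_real g y)%quat.
Proof.
intros Sg Hx Hy; unfold at_real.
rewrite power_series_qconv_real, rM_real; auto; apply schur_tame; auto; now apply schur_rM, in_ball_real.
Qed.

(** The rule by which the entries of the table are computed. *)
Lemma schur_next_relation x f g y : schur f -> schur g -> -1 < x < 1 -> -1 < y < 1 ->
  nsq (at_real f x) < 1 -> is_moebius f (at_real f x) (rM (qreal x) ** g) ->
  moebius (at_real f x) (at_real f y) = (moebius (qreal x) (qreal y) * at_real g y)%quat.
Proof.
intros Sf Sg Hx Hy A M; rewrite <- at_real_rM by auto; symmetry.
assert (Sh : schur (rM (qreal x) ** g)) by (apply schur_qconv; auto; now apply schur_rM, in_ball_real).
exact (is_moebius_real f (at_real f x) _ y Sf Sh A Hy (at_real_le1 f y Sf Hy) M).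
Qed.

Lemma moebius_real_neq0 x y : -1 < x < 1 -> -1 < y < 1 -> x <> y -> moebius (qreal x) (qreal y) <> qreal 0.
Proof.
intros Hx Hy N E.
assert (M := moebius_mul (qreal x) (qreal y) (real_in_ball x Hx) (Rlt_le _ _ (real_in_ball y Hy))).
rewrite E, qmul0r in M; apply (f_equal cre) in M; rewrite cre_add, cre_opp in M.
unfold qreal, cre in M; simpl in M; lra.
Qed.

Lemma in_ball_nsq q : in_ball q <-> nsq q < 1.
Proof. apply qnorm_lt1. Qed.

Lemma in_sphere_nsq q : in_sphere q <-> nsq q = 1.
Proof. apply qnorm_eq1. Qed.

Lemma Q_step_ball x y p q : nsq p < 1 -> nsq q < 1 ->
  Q_step x y (Some p) (Some q) = Some (qinv (moebius (qreal x) (qreal y)) * moebius p q)%quat.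
Proof.
intros Hp Hq; unfold Q_step.
destruct (ball_dec p) as [_|N]; [|now destruct N; apply in_ball_nsq].
destruct (ball_dec q) as [_|N]; [reflexivity | now destruct N; apply in_ball_nsq].
Qed.

Lemma Q_step_sphere x y w : nsq w = 1 -> Q_step x y (Some w) (Some w) = Some w.
Proof.
intros H; unfold Q_step.
destruct (ball_dec w) as [B|_]; [apply in_ball_nsq in B; lra|].
destruct (quat_eq_dec w w) as [_|N]; [|easy].
destruct (sphere_dec w) as [_|N]; [reflexivity | now destruct N; apply in_sphere_nsq].
Qed.

Lemma Q_step_value x y f g : schur f -> schur g -> -1 < x < 1 -> -1 < y < 1 -> x <> y ->
  schur_next x f g -> Q_step x y (Some (at_real f x)) (Some (at_real f y)) = Some (at_real g y).
Proof.
intros Sf Sg Hx Hy N [[L M]|[L ->]].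
- assert (A := at_real_lt1 f x Sf L Hx).
  rewrite Q_step_ball by (auto; now apply at_real_lt1).
  rewrite (schur_next_relation x f g y), qmulA, qmulVl, qmul1l; auto; now apply moebius_real_neq0.
- now rewrite !at_real_const, Q_step_sphere.
Qed.

(** The value at the node is the parameter of the Moebius map, so once it is
    known the step can be undone. *)
Lemma schur_next_injective x f f' g : schur f -> schur f' -> schur g -> -1 < x < 1 ->
  schur_next x f g -> schur_next x f' g -> at_real f x = at_real f' x -> f = f'.
Proof.
intros Sf Sf' Sg Hx H H' E.
destruct H as [[L M]|[L ->]]; destruct H' as [[L' M']|[L' G]]; auto.
- apply power_series_inj_real; try now apply schur_tame.
  intros y Hy; fold (at_real f y) (at_real f' y).
  assert (A := at_real_lt1 f x Sf L Hx); assert (A' := at_real_lt1 f' x Sf' L' Hx).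
  rewrite <- (moebius_inv (at_real f x) (at_real f y)), (schur_next_relation x f g y) by (auto; now apply at_real_le1).
  rewrite <- (schur_next_relation x f' g y) by auto; rewrite E.
  apply moebius_inv; auto; now apply at_real_le1.
- assert (A := at_real_lt1 f x Sf L Hx); rewrite E, at_real_const in A by auto; lra.
- assert (A := at_real_lt1 f' x Sf' L' Hx); rewrite <- E, at_real_const in A by auto; lra.
Qed.

(** The Blaschke factor vanishes at the node, and the inverse Moebius map sends
    zero to [s]. *)
Lemma schur_previous x s g : schur g -> -1 < x < 1 -> nsq s < 1 ->
  exists f, schur f /\ nsq (f O) < 1 /\ at_real f x = s /\ schur_next x f g.
Proof.
intros Sg Hx Hs; set (h := rM (qreal x) ** g).
assert (Sh : schur h) by (apply schur_qconv; auto; now apply schur_rM, in_ball_real).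
assert (Hs' : nsq (- s)%quat < 1) by now rewrite nsqN.
destruct (moebius_exists h (- s)%quat Sh Hs') as (f & Mf & Sf).
assert (val : forall y, -1 < y < 1 -> at_real f y = moebius (- s) (at_real h y)).
{ intros y Hy; exact (is_moebius_real h (- s)%quat f y Sh Sf Hs' Hy (at_real_le1 h y Sh Hy) Mf). }
assert (fx : at_real f x = s).
{ rewrite val by auto; unfold h; rewrite at_real_rM, moebius_self, qmul0l by (auto; now apply real_in_ball).
  rewrite <- (moebius_self s Hs); apply moebius_inv; auto; lra. }
assert (L : nsq (f O) < 1).
{ destruct (schur_head f Sf) as [L|L]; auto; rewrite <- (at_real_const f x Sf L), fx; exact Hs. }
exists f; repeat split; auto; left; split; auto; rewrite fx; fold h.
assert (M := is_moebius_sym h (- s)%quat f Sh Sf Hs' Mf).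
now replace (- - s)%quat with s in M by qring.
Qed.

Lemma blaschke_previous k x f g : schur f -> -1 < x < 1 -> nsq (f O) < 1 -> schur_next x f g ->
  blaschke k g -> blaschke (S k) f.
Proof.
intros Sf Hx L [[_ M]|[E _]] Hg; [|lra].
assert (A := at_real_lt1 f x Sf L Hx).
assert (Hh : blaschke (S k) (rM (qreal x) ** g)) by (constructor; auto; now apply in_ball_real).
apply (blaschke_moebius (S k) (rM (qreal x) ** g) (- at_real f x)%quat f); auto; [now rewrite nsqN|].
apply is_moebius_sym; auto; apply rank_le_schur with (S k); now apply blaschke_rank.
Qed.

(** * The algorithm and the table *)

Inductive descends (r : nat -> R) : nat -> (nat -> quat) -> (nat -> quat) -> Prop :=
| descends_none f : schur f -> descends r 0 f f
| descends_one k f g h : descends r k f g -> schur h -> schur_next (r (S k)) g h -> descends r (S k) f h.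

Lemma descends_schur r k f g : descends r k f g -> schur f /\ schur g.
Proof. induction 1; intuition. Qed.

Lemma descends_exists r k f : schur f -> (forall m, (1 <= m <= k)%nat -> -1 < r m < 1) ->
  exists g, descends r k f g.
Proof.
intros Sf; induction k as [|k IH]; intros Hr; [exists f; now constructor|].
destruct IH as [g Dg]; [intros; apply Hr; lia|].
destruct (schur_next_exists (r (S k)) g) as (h & Sh & Nh).
- apply (descends_schur _ _ _ _ Dg).
- apply Hr; lia.
- exists h; now apply descends_one with g.
Qed.

Lemma descends_pred r k f h : descends r (S k) f h ->
  exists g, descends r k f g /\ schur g /\ schur h /\ schur_next (r (S k)) g h.
Proof.
intros D; inversion D; subst; exists g; repeat split; auto; now apply (descends_schur r k f g).
Qed.

(** The formula for the first row is the general rule, since the data lie in the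
    ball. *)
Lemma Qtab_S r s k l : in_ball (s 1%nat) -> in_ball (s l) ->
  Qtab r s (S k) l = Q_step (r (S k)) (r l) (Qtab r s k (S k)) (Qtab r s k l).
Proof.
intros H1 Hl; destruct k as [|k]; [|reflexivity].
symmetry; apply Q_step_ball; now apply in_ball_nsq.
Qed.

Definition admissible (n : nat) (r : nat -> R) (s : nat -> quat) : Prop :=
  (forall m, (1 <= m <= n)%nat -> -1 < r m < 1) /\
  (forall i j, (1 <= i <= n)%nat -> (1 <= j <= n)%nat -> i <> j -> r i <> r j) /\
  (forall m, (1 <= m <= n)%nat -> in_ball (s m)).

Definition matches (n : nat) (r : nat -> R) (s : nat -> quat) (f : nat -> quat) : Prop :=
  forall m, (1 <= m <= n)%nat -> at_real f (r m) = s m.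

(** The [k]-th row of the table consists of the values of the [k]-th series
    produced by the algorithm; in particular it contains no infinite entry. *)
Lemma Qtab_descends n r s k f g : admissible n r s -> matches n r s f -> descends r k f g ->
  (k < n)%nat -> forall l, (k < l <= n)%nat -> Qtab r s k l = Some (at_real g (r l)).
Proof.
intros (Hr & Hd & Hs) Hf; revert g; induction k as [|k IH]; intros g D Hk l Hl.
- inversion D; subst; simpl; now rewrite Hf by lia.
- destruct (descends_pred _ _ _ _ D) as (g0 & D0 & S0 & Sg & N).
  rewrite Qtab_S, !(IH g0) by (auto; try lia; apply Hs; lia).
  apply Q_step_value; auto; try (apply Hr; lia); apply Hd; lia.
Qed.

Lemma descends_injective n r s k f f' g : admissible n r s -> matches n r s f -> matches n r s f' ->
  (k < n)%nat -> descends r k f g -> descends r k f' g -> f = f'.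
Proof.
intros A Hf Hf'; revert g; induction k as [|k IH]; intros g Hk D D'.
- inversion D; inversion D'; congruence.
- destruct (descends_pred _ _ _ _ D) as (g0 & D0 & S0 & Sg & N).
  destruct (descends_pred _ _ _ _ D') as (g0' & D0' & S0' & _ & N').
  assert (E : g0 = g0').
  { apply (schur_next_injective (r (S k)) g0 g0' g); auto; [apply A; lia|].
    assert (Q := Qtab_descends n r s k f g0 A Hf D0 ltac:(lia) (S k) ltac:(lia)).
    rewrite (Qtab_descends n r s k f' g0' A Hf' D0') in Q by lia; congruence. }
  subst g0'; apply (IH g0); auto; lia.
Qed.

(** At a point that is not a node each step determines the new value from the
    old ones. *)
Lemma descends_determines r k f g g' x : (forall m, (1 <= m <= k)%nat -> -1 < r m < 1) -> -1 < x < 1 ->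
  (forall i j, (1 <= i <= k)%nat -> (1 <= j <= k)%nat -> i <> j -> r i <> r j) ->
  (forall m, (1 <= m <= k)%nat -> r m <> x) ->
  descends r k f g -> descends r k f g' -> at_real g x = at_real g' x.
Proof.
revert g g' x; induction k as [|k IH]; intros g g' x Hr Hx Hd Hn D D'.
- inversion D; inversion D'; congruence.
- destruct (descends_pred _ _ _ _ D) as (g0 & D0 & S0 & Sg & N).
  destruct (descends_pred _ _ _ _ D') as (g0' & D0' & S0' & Sg' & N').
  assert (V : forall y, -1 < y < 1 -> (forall m, (1 <= m <= k)%nat -> r m <> y) -> at_real g0 y = at_real g0' y).
  { intros y Hy Hny; apply IH; auto; intros; [apply Hr | apply Hd]; auto; lia. }
  assert (H := Hr (S k) ltac:(lia)); assert (Nx := Hn (S k) ltac:(lia)).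
  assert (Q := Q_step_value (r (S k)) x g0 g S0 Sg H Hx Nx N).
  assert (Q' := Q_step_value (r (S k)) x g0' g' S0' Sg' H Hx Nx N').
  rewrite <- (V x), <- (V (r (S k))), Q in Q'; auto; [congruence | |].
  + intros m Hm; apply Hd; lia.
  + intros m Hm; apply Hn; lia.
Qed.

(** When the first entry of row [k] lies in the ball the step is undone by
    [schur_previous].  Otherwise row [k] is constant, equal to a unimodular [p];
    by the maximum principle [g] is the constant [p], and it is its own
    predecessor. *)
Lemma ascend n r s k g : admissible n r s -> (S k < n)%nat -> schur g ->
  (forall l, (S k < l <= n)%nat -> Qtab r s (S k) l = Some (at_real g (r l))) ->
  exists f, schur f /\ schur_next (r (S k)) f g /\
    forall l, (k < l <= n)%nat -> Qtab r s k l = Some (at_real f (r l)).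
Proof.
intros (Hr & Hd & Hs) Hk Sg HQ.
assert (HR := Hr (S k) ltac:(lia)).
assert (st : forall l, (S k < l <= n)%nat ->
  Q_step (r (S k)) (r l) (Qtab r s k (S k)) (Qtab r s k l) = Some (at_real g (r l))).
{ intros l Hl; rewrite <- Qtab_S by (apply Hs; lia); auto. }
destruct (Qtab r s k (S k)) as [p|] eqn:Ep; [|now specialize (st n ltac:(lia))].
destruct (ball_dec p) as [B|NB].
- assert (Hp : nsq p < 1) by now apply in_ball_nsq.
  destruct (schur_previous (r (S k)) p g Sg HR Hp) as (f & Sf & L & Ef & N).
  exists f; repeat split; auto; intros l Hl.
  destruct (Nat.eq_dec l (S k)) as [->|Hne]; [now rewrite Ep, Ef|].
  assert (Hl' := Hr l ltac:(lia)); assert (Hnode : r (S k) <> r l) by (apply Hd; lia).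
  specialize (st l ltac:(lia)).
  destruct (Qtab r s k l) as [q|]; [|discriminate st].
  assert (Hq : nsq q < 1).
  { unfold Q_step in st; destruct (ball_dec p) as [_|]; [|easy].
    destruct (ball_dec q) as [Bq|]; [now apply in_ball_nsq | discriminate st]. }
  rewrite <- (Q_step_value (r (S k)) (r l) f g), Ef in st; auto.
  assert (Hfl := at_real_lt1 f (r l) Sf L Hl').
  rewrite !Q_step_ball in st by auto; apply (f_equal (fun o => match o with Some z => z | None => p end)) in st.
  cbv beta iota in st; f_equal.
  assert (nz := moebius_real_neq0 (r (S k)) (r l) HR Hl' Hnode).
  assert (E : moebius p q = moebius p (at_real f (r l))).
  { rewrite <- (qmul1l (moebius p q)), <- (qmulVr _ nz), <- qmulA, st, qmulA, qmulVr, qmul1l; auto. }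
  rewrite <- (moebius_inv p q), E by (auto; lra); apply moebius_inv; auto; lra.
- assert (st' : forall l, (S k < l <= n)%nat -> Qtab r s k l = Some p /\ nsq p = 1 /\ at_real g (r l) = p).
  { intros l Hl; specialize (st l Hl); unfold Q_step in st.
    destruct (Qtab r s k l) as [q|]; [|discriminate].
    destruct (ball_dec p) as [|_]; [easy|].
    destruct (quat_eq_dec p q) as [<-|]; [|discriminate].
    destruct (sphere_dec p) as [Sp|]; [|discriminate].
    injection st as st; repeat split; auto; now apply in_sphere_nsq. }
  destruct (st' n ltac:(lia)) as (_ & Hp & Eg).
  assert (G : g = cst p) by (rewrite <- Eg; apply schur_maximum; auto; [apply Hr; lia | now rewrite Eg]).
  exists g; repeat split; auto; [right; split; auto; now rewrite G|].
  intros l Hl; rewrite G; unfold at_real; rewrite power_series_cst.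
  destruct (Nat.eq_dec l (S k)) as [->|Hne]; [exact Ep | now apply st'; lia].
Qed.

Lemma descends_to n r s k g : admissible n r s -> (k < n)%nat -> schur g ->
  (forall l, (k < l <= n)%nat -> Qtab r s k l = Some (at_real g (r l))) ->
  exists f, matches n r s f /\ descends r k f g.
Proof.
intros A; revert g; induction k as [|k IH]; intros g Hk Sg HQ.
- exists g; split; [|now constructor]; intros m Hm.
  assert (E := HQ m ltac:(lia)); simpl in E; now injection E.
- destruct (ascend n r s k g A Hk Sg HQ) as (g0 & S0 & N & HQ0).
  destruct (IH g0 ltac:(lia) S0 HQ0) as (f & Mf & D).
  exists f; split; auto; now apply descends_one with g0.
Qed.

Lemma blaschke_descends r k j f g : (forall m, (1 <= m <= k)%nat -> -1 < r m < 1) ->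
  descends r k f g -> nsq (g O) < 1 -> blaschke j g -> blaschke (k + j) f.
Proof.
revert j g; induction k as [|k IH]; intros j g Hr D L B.
- now inversion D; subst.
- destruct (descends_pred _ _ _ _ D) as (g0 & D0 & S0 & Sg & N).
  assert (L0 : nsq (g0 O) < 1) by (destruct N as [[L0 _]|[E ->]]; auto).
  replace (S k + j)%nat with (k + S j)%nat by lia.
  apply (IH (S j) g0); auto; [intros; apply Hr; lia|].
  apply (blaschke_previous j (r (S k)) g0 g); auto; apply Hr; lia.
Qed.

(** The step at which the algorithm first meets a unimodular constant; it reads
    off the degree. *)
Lemma first_constant r k f g : descends r k f g -> nsq (g O) = 1 -> nsq (f O) < 1 ->
  exists j h, (j < k)%nat /\ descends r j f h /\ nsq (h O) < 1 /\ schur_next (r (S j)) h g.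
Proof.
revert g; induction k as [|k IH]; intros g D E L.
- inversion D; subst; lra.
- destruct (descends_pred _ _ _ _ D) as (g0 & D0 & S0 & Sg & N).
  destruct N as [[L0 M]|[E0 ->]].
  + exists k, g0; repeat split; auto; now left.
  + destruct (IH g0 D0 E0 L) as (j & h & Hj & H); exists j, h; split; [lia | exact H].
Qed.

Lemma degree_of_step r j f h g : (forall m, (1 <= m <= S j)%nat -> -1 < r m < 1) ->
  descends r j f h -> nsq (h O) < 1 -> schur g -> schur_next (r (S j)) h g -> nsq (g O) = 1 ->
  blaschke (S j) f.
Proof.
intros Hr D L Sg N E; replace (S j) with (j + 1)%nat by lia.
apply (blaschke_descends r j 1 f h); auto; [intros; apply Hr; lia|].
apply (blaschke_previous 0 (r (S j)) h g); auto.
- apply (descends_schur _ _ _ _ D).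
- apply Hr; lia.
- rewrite (schur_unimodular_const g Sg E); now constructor.
Qed.

Lemma not_a_node (r : nat -> R) k : exists a b, -1 <= a < b /\ b <= 1 /\
  forall x m, a < x < b -> (1 <= m <= k)%nat -> r m <> x.
Proof.
induction k as [|k (a & b & Hab & Hb & H)]; [exists (-1), 1; repeat split; try lra; intros; lia|].
assert (C : exists a' b', a <= a' < b' /\ b' <= b /\ (r (S k) <= a' \/ b' <= r (S k))).
{ destruct (Rle_lt_dec (r (S k)) ((a + b) / 2)).
  - exists ((a + b) / 2), b; repeat split; lra.
  - exists a, ((a + b) / 2); repeat split; lra. }
destruct C as (a' & b' & Ha & Hb' & C); exists a', b'; repeat split; try lra.
intros x m Hx Hm; destruct (Nat.eq_dec m (S k)) as [->|]; [lra | apply H; [lra | lia]].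
Qed.

(** * Interpolants *)

Lemma interpolant_series n r s f : (1 <= n)%nat -> admissible n r s -> interpolant n r s f ->
  exists a, schur a /\ eq_on_ball f (power_series a) /\ matches n r s a.
Proof.
intros Hn (Hr & _ & Hs) (Rf & Bf & Vf).
destruct (slice_regular_expansion f Rf) as [a Ea]; exists a.
assert (Ta := has_expansion_tame f a Ea).
assert (E : eq_on_ball f (power_series a)) by (intros q Hq; now apply has_expansion_eq).
repeat split; auto.
- apply schur_of_bounded; auto; intros q Hq; rewrite <- (E q Hq); apply Rlt_le, in_ball_nsq; auto.
- intros m Hm; unfold at_real; rewrite <- E by (apply in_ball_real; auto); auto.
Qed.

Lemma matches_head n r s a : (1 <= n)%nat -> admissible n r s -> schur a -> matches n r s a -> nsq (a O) < 1.
Proof.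
intros Hn (Hr & _ & Hs) Sa M; destruct (schur_head a Sa) as [|E]; auto.
rewrite <- (at_real_const a (r 1%nat) Sa E), (M 1%nat) by lia; apply in_ball_nsq, Hs; lia.
Qed.

Lemma series_interpolant n r s a : (1 <= n)%nat -> admissible n r s -> schur a -> matches n r s a ->
  interpolant n r s (power_series a).
Proof.
intros Hn A Sa M; repeat split; auto.
- now apply power_series_slice_regular, schur_tame.
- intros q Hq; apply in_ball_nsq, schur_ball_strict; auto; now apply (matches_head n r s).
Qed.

(** The last entry is the value at [r n] of a series that becomes constant after
    one more step, and this constant is arbitrary.  It can be recovered from the
    interpolant at a point that is not a node. *)
Lemma infinitely_many_interpolants n r s : (1 <= n)%nat -> admissible n r s ->
  ext_in_ball (Qtab r s (n - 1) n) -> infinitely_many_solutions (interpolant n r s).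
Proof.
intros Hn A HQ; destruct (Qtab r s (n - 1) n) as [p|] eqn:Ep; [|easy]; simpl in HQ.
assert (Hp : nsq p < 1) by now apply in_ball_nsq.
pose (c := fun i => qreal (/ (INR i + 2))).
assert (Hc : forall i, nsq (c i) < 1).
{ intros i; assert (H := pos_INR i); apply real_in_ball; split.
  - apply Rlt_trans with 0; [lra | apply Rinv_0_lt_compat; lra].
  - rewrite <- Rinv_1; apply Rinv_lt_contravar; lra. }
assert (X : forall i, exists f, schur f /\ matches n r s f /\ descends r n f (cst (c i))).
{ intros i; assert (Hr := proj1 A).
  assert (Sc : schur (cst (c i))) by (apply schur_cst, Rlt_le, Hc).
  destruct (schur_previous (r n) p (cst (c i)) Sc ltac:(apply Hr; lia) Hp) as (g & Sg & _ & Eg & N).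
  destruct (descends_to n r s (n - 1) g) as (f & M & D); auto; [lia | |].
  - intros l Hl; replace l with n by lia; now rewrite Ep, Eg.
  - exists f; repeat split; auto; [apply (descends_schur _ _ _ _ D)|].
    replace n with (S (n - 1)) by lia; apply descends_one with g; auto.
    now replace (S (n - 1)) with n by lia. }
destruct (choice _ X) as [F HF]; exists (fun i => power_series (F i)); split.
- intros i; destruct (HF i) as (Sf & M & _); now apply series_interpolant.
- intros i j Hij E; apply Hij.
  destruct (HF i) as (Si & _ & Di); destruct (HF j) as (Sj & _ & Dj).
  assert (EF : F i = F j) by (apply power_series_inj_ball; auto; now apply schur_tame).
  rewrite <- EF in Dj; destruct (not_a_node r n) as (a & b & Hab & Hb & Hn').
  destruct A as (Hr & Hd & Hs).
  assert (V : at_real (cst (c i)) ((a + b) / 2) = at_real (cst (c j)) ((a + b) / 2)).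
  { apply (descends_determines r n (F i)); auto; [lra|]; intros m Hm; apply Hn'; auto; lra. }
  unfold at_real in V; rewrite !power_series_cst in V; apply (f_equal cre) in V.
  unfold c, qreal, cre in V; simpl in V; apply Rinv_eq_reg in V; apply INR_eq; lra.
Qed.

Lemma no_interpolant n r s f : (1 <= n)%nat -> admissible n r s -> interpolant n r s f ->
  ext_in_ball (Qtab r s (n - 1) n) \/ ext_in_sphere (Qtab r s (n - 1) n).
Proof.
intros Hn A I; destruct (interpolant_series n r s f Hn A I) as (a & Sa & _ & M).
destruct (descends_exists r (n - 1) a Sa) as [g D]; [intros; apply A; lia|].
rewrite (Qtab_descends n r s (n - 1) a g) by (auto; lia); simpl.
assert (B := at_real_le1 g (r n) (proj2 (descends_schur _ _ _ _ D)) ltac:(apply A; lia)).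
destruct (Rle_lt_or_eq_dec _ _ B); [left; now apply in_ball_nsq | right; now apply in_sphere_nsq].
Qed.

(** By the maximum principle the last entry determines the last series, and the
    steps are injective. *)
Lemma unique_interpolant n r s : (1 <= n)%nat -> admissible n r s ->
  ext_in_sphere (Qtab r s (n - 1) n) ->
  exists a w, schur a /\ matches n r s a /\ nsq w = 1 /\ descends r (n - 1) a (cst w) /\
    forall g, interpolant n r s g -> eq_on_ball g (power_series a).
Proof.
intros Hn A HQ; destruct (Qtab r s (n - 1) n) as [w|] eqn:Ew; [|easy]; simpl in HQ.
assert (Hw : nsq w = 1) by now apply in_sphere_nsq.
destruct (descends_to n r s (n - 1) (cst w)) as (a & M & D); auto; [lia | apply schur_cst; lra | |].
- intros l Hl; replace l with n by lia; rewrite Ew; unfold at_real; now rewrite power_series_cst.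
- exists a, w; repeat split; auto; [apply (descends_schur _ _ _ _ D)|].
  intros f I; destruct (interpolant_series n r s f Hn A I) as (b & Sb & Eb & Mb).
  destruct (descends_exists r (n - 1) b Sb) as [g Dg]; [intros; apply A; lia|].
  assert (Q := Qtab_descends n r s (n - 1) b g A Mb Dg ltac:(lia) n ltac:(lia)).
  rewrite Ew in Q; injection Q as Q.
  assert (G : g = cst w).
  { rewrite Q; apply schur_maximum; [apply (descends_schur _ _ _ _ Dg) | apply A; lia | congruence]. }
  rewrite G in Dg; now rewrite (descends_injective n r s (n - 1) a b (cst w)) by (auto; lia).
Qed.

Lemma row_constant_value n r s k a g w : (S k < n)%nat -> admissible n r s -> matches n r s a ->
  descends r (S k) a g -> in_sphere w ->
  (forall l, (S k + 1 <= l <= n)%nat -> Qtab r s (S k) l = Some w) -> g = cst w.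
Proof.
intros Hk A M D Hw H; assert (Q := H n ltac:(lia)).
rewrite (Qtab_descends n r s (S k) a g) in Q by (auto; lia); injection Q as Q.
rewrite <- Q; apply schur_maximum; [apply (descends_schur _ _ _ _ D) | apply A; lia |].
rewrite Q; now apply in_sphere_nsq.
Qed.

(** A series that is not a unimodular constant takes all its values in the ball,
    so one entry of the row decides for all of them. *)
Lemma row_in_ball n r s k a g l : admissible n r s -> matches n r s a -> descends r k a g ->
  (S k <= l <= n)%nat -> (ext_in_ball (Qtab r s k l) <-> nsq (g O) < 1).
Proof.
intros A M D Hl; rewrite (Qtab_descends n r s k a g) by (auto; lia); simpl.
destruct (descends_schur _ _ _ _ D) as [_ Sg]; split; intros H.
- destruct (schur_head g Sg) as [|E]; auto.
  rewrite <- (at_real_const g (r l) Sg E); now apply in_ball_nsq.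
- apply in_ball_nsq, at_real_lt1; auto; apply A; lia.
Qed.

(** Row [k] is constant and unimodular exactly when the [k]-th series is a
    constant; if the previous one is not, exactly [k] Blaschke factors were
    removed. *)
Lemma degree_criterion n r s a w : (2 <= n)%nat -> admissible n r s -> matches n r s a -> nsq w = 1 ->
  descends r (n - 1) a (cst w) ->
  (exists k, (1 <= k <= n - 1)%nat /\ blaschke k a) /\
  (forall k, (1 <= k <= n - 1)%nat -> (blaschke k a <-> row_constant_unimodular n r s k /\
    exists l, (k <= l <= n)%nat /\ ext_in_ball (Qtab r s (k - 1) l))).
Proof.
intros Hn A M Hw D; destruct (descends_schur _ _ _ _ D) as [Sa _].
assert (La : nsq (a O) < 1) by (apply (matches_head n r s); auto; lia).
destruct (first_constant r (n - 1) a (cst w) D Hw La) as (j & h & Hj & Dh & Lh & Nh).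
assert (Bj : blaschke (S j) a).
{ apply (degree_of_step r j a h (cst w)); auto; [intros; apply A; lia|].
  apply schur_cst; lra. }
assert (Dw := descends_one r j a h (cst w) Dh (schur_cst w (Req_le _ _ Hw)) Nh).
split; [exists (S j); split; [lia | exact Bj]|].
intros k Hk; split.
- intros Bk; replace k with (S j) by now apply (blaschke_degree_unique (S j) k a).
  split.
  + exists w; split; [now apply in_sphere_nsq|]; intros l Hl.
    rewrite (Qtab_descends n r s (S j) a (cst w)) by (auto; lia).
    unfold at_real; now rewrite power_series_cst.
  + exists n; split; [lia|]; replace (S j - 1)%nat with j by lia.
    apply (row_in_ball n r s j a h); auto; lia.
- intros [(w' & Hw' & R) (l & Hl & B)].
  destruct k as [|k]; [lia|]; replace (S k - 1)%nat with k in B by lia.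
  destruct (descends_exists r (S k) a Sa) as [g Dg]; [intros; apply A; lia|].
  destruct (descends_pred _ _ _ _ Dg) as (g0 & D0 & S0 & Sg & N).
  assert (G : g = cst w') by (apply (row_constant_value n r s k a g w'); auto; lia).
  apply (degree_of_step r k a g0 g); auto.
  + intros; apply A; lia.
  + now apply (row_in_ball n r s k a g0 l).
  + rewrite G; now apply in_sphere_nsq.
Qed.

Theorem theorem5p9 :
  forall (n : nat) (r : nat -> R) (s : nat -> quat),
  (3 <= n)%nat ->
  (forall m : nat, (1 <= m <= n)%nat -> -1 < r m < 1) ->
  (forall i j : nat, (1 <= i <= n)%nat -> (1 <= j <= n)%nat ->
     i <> j -> r i <> r j) ->
  (forall m : nat, (1 <= m <= n)%nat -> in_ball (s m)) ->
  (ext_in_ball (Qtab r s (n - 1) n) ->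
     infinitely_many_solutions (interpolant n r s)) /\
  (ext_in_sphere (Qtab r s (n - 1) n) ->
     exists f : quat -> quat,
       interpolant n r s f /\
       (forall g : quat -> quat, interpolant n r s g -> eq_on_ball g f) /\
       regular_blaschke f /\
       (exists kappa0 : nat,
          (1 <= kappa0 <= n - 1)%nat /\ blaschke_of_degree kappa0 f) /\
       (forall kappa0 : nat, (1 <= kappa0 <= n - 1)%nat ->
          (blaschke_of_degree kappa0 f <->
             row_constant_unimodular n r s kappa0 /\
             (exists l : nat, (kappa0 <= l <= n)%nat /\
                ext_in_ball (Qtab r s (kappa0 - 1) l))) /\
          (row_constant_unimodular n r s kappa0 ->
             (exists l : nat, (kappa0 <= l <= n)%nat /\
                ext_in_ball (Qtab r s (kappa0 - 1) l)) ->
             forall l : nat, (kappa0 <= l <= n)%nat ->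
                ext_in_ball (Qtab r s (kappa0 - 1) l)))) /\
  (~ ext_in_ball (Qtab r s (n - 1) n) ->
   ~ ext_in_sphere (Qtab r s (n - 1) n) ->
     ~ exists f : quat -> quat, interpolant n r s f).
Proof.
intros n r s Hn Hr Hd Hs; assert (A : admissible n r s) by exact (conj Hr (conj Hd Hs)).
assert (Hn1 : (1 <= n)%nat) by lia.
split; [now apply infinitely_many_interpolants|]; split.
- intros HQ; destruct (unique_interpolant n r s Hn1 A HQ) as (a & w & Sa & M & Hw & D & U).
  assert (Ta := schur_tame a Sa).
  destruct (degree_criterion n r s a w ltac:(lia) A M Hw D) as [(k0 & Hk0 & B0) C].
  assert (B : blaschke_of_degree k0 (power_series a)) by (apply blaschke_of_degree_series; auto; split; [lia | exact B0]).
  exists (power_series a); split; [now apply series_interpolant|]; split; [exact U|].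
  split; [now exists k0|]; split; [now exists k0|].
  intros k Hk; split.
  + split; intros H.
    * apply C; auto; now apply blaschke_of_degree_series in H.
    * apply blaschke_of_degree_series; auto; split; [lia | now apply C].
  + intros _ (l & Hl & Bl) l' Hl'.
    destruct (descends_exists r (k - 1) a Sa) as [g D']; [intros; apply Hr; lia|].
    apply (row_in_ball n r s (k - 1) a g l'); auto; [lia|].
    apply (row_in_ball n r s (k - 1) a g l); auto; lia.
- intros N1 N2 [f I]; now destruct (no_interpolant n r s f Hn1 A I).
Qed.
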